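(* Let $q\in\mathbb Z_{\ge1}$ and $s\in\mathbb R_{\ge0}$, and let $\mathbf H_{q,s}$ be the Kirchhoff Laplacian on the polynomially growing antitree $\mathcal A^q$ with edge lengths $|e|=(n+1)^{-s}$ for each edge $e$ connecting $S_n$ and $S_{n+1}$, $n\ge0$. Then $$\lambda_0(\mathbf H_{q,s})=\lambda_0^{\mathrm{ess}}(\mathbf H_{q,s})=0$$ if and only if $s\in[0,1)$. If $s\ge1$, then the operator $\mathbf H_{q,s}$ is uniformly positive and $$\tfrac14\le\lambda_0(\mathbf H_{q,s})\le\pi^2,\qquad \lambda_0^{\mathrm{ess}}(\mathbf H_{q,s})=\begin{cases}q^2,& s=1,\\ +\infty,& s>1.\end{cases}$$
   Context: Antitree $\mathcal A^q$. The vertex set is $\mathcal V=\bigsqcup_{n\ge0}S_n$ with $\#S_n=(n+1)^q$ (so $S_0=\{o\}$); every vertex of $S_n$ is joined by an edge to every vertex of $S_{n+1}$ for all $n\ge0$, and there are no other edges. Each edge $e$ is identified with the interval $[0,|e|]$ and endpoints at common vertices are glued, giving a metric graph $\mathcal G$. $\mathcal E_v$ is the set of edges incident to $v$. Operator. $L^2(\mathcal G)=\bigoplus_eL^2(e)$. The pre-minimal operator acts as $-d^2/dx_e^2$ on each edge, on functions $f=(f_e)_e$ with $f_e\in H^2(e)$, nonzero on only finitely many edges, such that at every vertex $v$, $f$ is continuous and $\sum_{e\in\mathcal E_v}f_e'(v)=0$ (derivatives from $v$ into the edge). The Kirchhoff Laplacian is the Friedrichs extension of this operator, i.e. the self-adjoint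 operator associated with the closure of the form $f\mapsto\int_{\mathcal G}|f'|^2dx$ on its domain. $\lambda_0=\inf\sigma$, $\lambda_0^{\mathrm{ess}}=\inf\sigma_{\mathrm{ess}}$ ($=+\infty$ if the essential spectrum is empty). Uniformly positive means $\lambda_0>0$. *)

(* Defs.v *)
From HB Require Import structures.
From mathcomp Require Import all_boot all_order all_algebra.
From mathcomp Require Import all_classical all_reals all_analysis.
From mathcomp Require Import complex.

Set Implicit Arguments.
Unset Strict Implicit.
Unset Printing Implicit Defensive.

Import Order.TTheory GRing.Theory Num.Theory.
Import numFieldNormedType.Exports.

Local Open Scope classical_set_scope.
Local Open Scope ring_scope.
Local Open Scope complex_scope.

Local Notation re := complex.Re.
Local Notation im := complex.Im.
Local Notation normc := ComplexField.Normc.normc.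

(* A complex Hilbert space presented by representatives, as L^2 is by
   functions: [carrier] is the set of vectors that represent an element, and two
   vectors at distance zero represent the same element.  [ip] is linear in its
   first argument. *)
Record hspace (R : realType) := HSpace {
  vec : lmodType R[i];
  carrier : set vec;
  ip : vec -> vec -> R[i]
}.

(* An unbounded operator is given by its graph: [A f h] means that
   f is in the domain of A and A f = h. *)
Definition operator (R : realType) (X : hspace R) := vec X -> vec X -> Prop.

Section Hilbert.
Variables (R : realType) (X : hspace R).
Implicit Types (f g h : vec X) (A : operator X) (z : R[i]).

Definition hnorm f : R := Num.sqrt (re (ip f f)).

Definition heq f g : Prop := hnorm (f - g) = 0.

Definition resolvent_set A : set R[i] :=
  [set z | (forall g, carrier g -> exists f h, A f h /\ heq (h - z *: f) g) /\
           (exists c : R, forall f h, A f h ->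
              hnorm f <= c * hnorm (h - z *: f))].

Definition spectrum A : set R[i] := ~` resolvent_set A.

Definition op_eigenspace A z : set (vec X) :=
  [set f | exists2 h, A f h & heq h (z *: f)].

Definition finite_dimensional (E : set (vec X)) : Prop :=
  exists n (b : 'I_n -> vec X), (forall i, E (b i)) /\
    forall f, E f -> exists c : 'I_n -> R[i], heq f (\sum_(i < n) c i *: b i).

Definition discrete_spectrum A : set R[i] :=
  [set z | [/\ exists2 f, op_eigenspace A z f & ~ heq f 0,
               finite_dimensional (op_eigenspace A z) &
               exists2 eps : R, 0 < eps & forall w,
                 spectrum A w -> normc (w - z) < eps -> w = z]].

Definition essential_spectrum A : set R[i] :=
  spectrum A `\` discrete_spectrum A.

(* Only applied to subsets of the real line (spectra of self-adjoint
   operators); the infimum of the empty set is +oo. *)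
Definition inf_spec (S : set R[i]) : \bar R :=
  ereal_inf [set x%:E | x in [set x : R | S x%:C]].

Definition lambda0 A : \bar R := inf_spec (spectrum A).

Definition lambda0_ess A : \bar R := inf_spec (essential_spectrum A).

Definition uniformly_positive A : Prop := (0 < lambda0 A)%E.

Section form.
Variables (D : set (vec X)) (a : vec X -> vec X -> R[i]).

Definition form_cvg (u : nat -> vec X) f : Prop :=
  [/\ forall n, D (u n),
      (fun n => hnorm (u n - f)) @ \oo --> (0 : R) &
      forall eps : R, 0 < eps -> exists N : nat, forall m n : nat,
        (N <= m)%N -> (N <= n)%N -> re (a (u m - u n) (u m - u n)) < eps].

Definition closure_dom : set (vec X) :=
  [set f | carrier f /\ exists u, form_cvg u f].

(* [closure_form f g z]: the closure of the form [a] takes the value z at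
   (f, g). *)
Definition closure_form f g z : Prop :=
  exists u v, [/\ form_cvg u f, form_cvg v g &
    (fun n => normc (a (u n) (v n) - z)) @ \oo --> (0 : R)].

(* The operator associated with the closure of the form [a] on [D]. *)
Definition form_operator : operator X := fun f h =>
  [/\ closure_dom f, carrier h &
      forall g, closure_dom g -> closure_form f g (ip h g)].

End form.
End Hilbert.

Section Edge.
Variable R : realType.
Implicit Types (l x : R) (f g h : R -> R[i]).
Let mu := @lebesgue_measure R.

Definition cintegral l f : R[i] :=
  (\int[mu]_(t in `[0, l]) re (f t)) +i* (\int[mu]_(t in `[0, l]) im (f t)).

Definition cmeasurable l f : Prop :=
  measurable_fun `[0, l] (fun t => re (f t)) /\
  measurable_fun `[0, l] (fun t => im (f t)).

Definition sqint l f : \bar R :=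
  (\int[mu]_(t in `[0%R, l]) ((normc (f t)) ^+ 2)%:E)%E.

(* Derivative relative to [0, l], hence one-sided at the endpoints. *)
Definition rderiv l (u : R -> R) x : R :=
  lim ((u y - u x) / (y - x) @[y --> within `[0, l] (x^')]).

Definition cderiv l f x : R[i] :=
  rderiv l (fun y => re (f y)) x +i* rderiv l (fun y => im (f y)) x.

(* f and f' are absolutely continuous on [0, l] and f'' = h is in L^2. *)
Definition H2 l f : Prop :=
  (forall x, x \in `[0, l] -> f x = f 0 + cintegral x (cderiv l f)) /\
  exists h, [/\ cmeasurable l h, (sqint l h < +oo)%E &
    forall x, x \in `[0, l] -> cderiv l f x = cderiv l f 0 + cintegral x h].

End Edge.

(* The edge e is the interval [0, len e], with 0 at [src e] and len e at
   [tgt e]. *)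
Record metric_graph (R : realType) := MetricGraph {
  vertex : eqType;
  edge : choiceType;
  src : edge -> vertex;
  tgt : edge -> vertex;
  len : edge -> R;
  loopless : forall e, src e != tgt e;
  locally_finite : forall v, finite_set [set e | src e = v \/ tgt e = v];
  len_gt0 : forall e, 0 < len e
}.

Section MetricGraph.
Variables (R : realType) (G : metric_graph R).
Implicit Types (v : vertex G) (e : edge G) (f g : edge G -> R -> R[i]).

Definition incident v : set (edge G) := [set e | src e = v \/ tgt e = v].

(* Sum of an absolutely summable family. *)
Definition rsum (F : edge G -> R) : R :=
  fine (\esum_(e in [set: edge G]) (Num.max (F e) 0)%:E) -
  fine (\esum_(e in [set: edge G]) (Num.max (- F e) 0)%:E).

Definition csum (F : edge G -> R[i]) : R[i] :=
  rsum (fun e => re (F e)) +i* rsum (fun e => im (F e)).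

Definition L2 : set (edge G -> R -> R[i]) :=
  [set f | (forall e, cmeasurable (len e) (f e)) /\
           (\esum_(e in [set: edge G]) sqint (len e) (f e) < +oo)%E].

Definition L2_ip f g : R[i] :=
  csum (fun e => cintegral (len e) (fun t => f e t * conjc (g e t))).

Definition L2_space : hspace R := HSpace L2 L2_ip.

Definition vertex_value f v e : R[i] :=
  f e (if src e == v then 0 else len e).

Definition outward_deriv f v e : R[i] :=
  if src e == v then cderiv (len e) (f e) 0
  else - cderiv (len e) (f e) (len e).

Definition premin_dom : set (edge G -> R -> R[i]) :=
  [set f | [/\ forall e, H2 (len e) (f e),
    finite_set [set e | exists2 x, x \in `[0, len e] & f e x != 0],
    forall v e e', incident v e -> incident v e' ->
      vertex_value f v e = vertex_value f v e' &
    forall v, \sum_(e \in incident v) outward_deriv f v e = 0]].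

Definition energy f g : R[i] :=
  csum (fun e => cintegral (len e)
    (fun t => cderiv (len e) (f e) t * conjc (cderiv (len e) (g e) t))).

Definition kirchhoff_laplacian : operator L2_space :=
  @form_operator R L2_space premin_dom energy.

End MetricGraph.
Arguments kirchhoff_laplacian {R} G.

Section Antitree.
Variables (R : realType) (q : nat) (s : R).

Definition antitree_vertex := {n : nat & 'I_(n.+1 ^ q)}.

Definition antitree_edge := {n : nat & ('I_(n.+1 ^ q) * 'I_(n.+2 ^ q))%type}.

Definition antitree_src (e : antitree_edge) : antitree_vertex :=
  existT _ (tag e) (tagged e).1.

Definition antitree_tgt (e : antitree_edge) : antitree_vertex :=
  existT _ (tag e).+1 (tagged e).2.

Definition antitree_len (e : antitree_edge) : R :=
  (tag e).+1%:R `^ (- s).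

Lemma antitree_loopless e : antitree_src e != antitree_tgt e.
Proof.
by apply/eqP => /(congr1 tag) /= /eqP; rewrite ltn_eqF.
Qed.

Lemma antitree_locally_finite v :
  finite_set [set e | antitree_src e = v \/ antitree_tgt e = v].
Proof.
pose T n : Type := ('I_(n.+1 ^ q) * 'I_(n.+2 ^ q))%type.
apply: (@sub_finite_set _ _
  (\bigcup_(n in `I_(tag v).+1) range (@existT nat T n))).
  move=> -[n x] ev; exists n; last by exists x.
  by case: ev => /(congr1 tag) /= <- /=.
apply: bigcup_finite => [|n _]; first exact: finite_II.
exact/finite_image/finite_finset.
Qed.

Lemma antitree_len_gt0 e : 0 < antitree_len e.
Proof. by rewrite powR_gt0 // ltr0n. Qed.

Definition antitree : metric_graph R :=
  MetricGraph antitree_loopless antitree_locally_finite antitree_len_gt0.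

End Antitree.

(* Main.v *)
(* Lower bounds are of Hardy type.  For G affine on each edge and depending only
   on the level, 0 <= int |f' + G f|^2 bounds int |f'|^2 below by
   int (G' - G^2) |f|^2 plus vertex terms, which have the right sign as soon as
   (n+1)^q G_n(l_n) <= (n+3)^q G_(n+1)(0), l_n being the length of the edges
   between S_n and S_(n+1).  For s >= 1, G_n(x) = (1 - l_n + x) / 2 gives 1/4.
   On the levels n >= N, G_n(x) = m - b (l_n - x) gives b - m^2, where N depends
   on m and b: for s = 1 one takes m = q and any b < 2 q^2, for s > 1 m = 1 and
   any b.  On the finitely many remaining edges the Poincare inequality on short
   pieces gives the same bound up to finitely many functionals, and such a
   finite-rank perturbation cannot create essential spectrum below it.

   Upper bounds come from test functions.  (1 - x^2)^2 on the star of the root has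
   Rayleigh quotient 3 < pi^2.  In terms of the height t = l_0 + ... + l_(n-1) + x,
   the number of edges at height t is close to c e^(2 kap t) on arbitrarily long
   windows, where kap = q if s = 1 and kap = 0 if s < 1; hence the functions
   e^(-kap t) (cos (a t) - cos (b t)), with a and b close to k, are approximate
   eigenvectors for kap^2 + k^2.  Thus all of (kap^2, oo) is in the spectrum, and
   being without isolated points it is in the essential spectrum. *)
Require Import Defs.
From mathcomp Require Import all_boot all_order all_algebra.
From mathcomp Require Import all_classical all_reals all_analysis.
From mathcomp Require Import measurable_realfun complex ring lra.

Set Implicit Arguments.
Unset Strict Implicit.
Unset Printing Implicit Defensive.

Import Order.TTheory GRing.Theory Num.Theory.
Import numFieldNormedType.Exports.

Local Open Scope classical_set_scope.
Local Open Scope ring_scope.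
Local Open Scope complex_scope.

Local Notation re := complex.Re.
Local Notation im := complex.Im.
Local Notation normc := ComplexField.Normc.normc.

(** * Complex numbers and sequences *)

(** The spectrum is a set of complex numbers, and a discrete point must be isolated in the whole
    plane. So, with [P] the finite-rank perturbation, [(A + P - w) f = g] is solved for every
    complex [w] with [re w < c]. For real [w] the form is coercive and a minimizing sequence
    produces [f]; other [w] are reached algebraically from the bounded inverse at [re w]. Inverting
    [A - w] then amounts to a finite linear system, singular exactly at eigenvalues, and a dimension
    count makes the eigenvalues below [c] finite in number and in multiplicity. No spectral theorem
    enters.

    For the upper bounds the obstacle is the core of the form: its members are H^2 on each edge and
    satisfy the Kirchhoff conditions, while the flux of a natural quasi-mode jumps at every sphere.
    Weyl's criterion is therefore used weakly, by testing the form on its core. In this sense a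
    quasi-mode may be modified by anything small in H^1, and small H^1 functions can have arbitrary
    end slopes; moreover its derivative may be replaced by a nearby field whose flux is
    conserved. *)

Section NormC.
Variable R : realType.
Implicit Types (z w : R[i]).

Lemma normc_sqr z : normc z ^+ 2 = re z ^+ 2 + im z ^+ 2.
Proof. by case: z => x y /=; rewrite sqr_sqrtr // addr_ge0 ?sqr_ge0. Qed.

Lemma normc_ge0 z : 0 <= normc z.
Proof. by case: z => x y; exact: sqrtr_ge0. Qed.

Lemma le_normc_add z w : normc (z + w) <= normc z + normc w.
Proof. exact: le_normcD. Qed.

Lemma normc_opp z : normc (- z) = normc z.
Proof. by case: z => x y /=; rewrite !sqrrN. Qed.

Lemma normc_distC z w : normc (z - w) = normc (w - z).
Proof. by rewrite -normc_opp opprB. Qed.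

Lemma normc_conj z : normc (conjc z) = normc z.
Proof. by case: z => x y /=; rewrite sqrrN. Qed.

Lemma normc_real (x : R) : normc x%:C = `|x|.
Proof. by rewrite /= expr0n addr0 sqrtr_sqr. Qed.

Lemma abs_re_le z : `|re z| <= normc z.
Proof.
case: z => x y /=; rewrite -sqrtr_sqr ler_wsqrtr // lerDl sqr_ge0 //.
Qed.

Lemma abs_im_le z : `|im z| <= normc z.
Proof.
case: z => x y /=; rewrite -sqrtr_sqr ler_wsqrtr // lerDr sqr_ge0 //.
Qed.

Lemma mulc_conj z : z * conjc z = (normc z ^+ 2)%:C.
Proof. by rewrite normc_sqr; case: z => x y; simpc; congr Complex; ring. Qed.

Lemma normcM z w : normc (z * w) = normc z * normc w.
Proof. exact: ComplexField.Normc.normcM. Qed.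

Lemma re_conj z : re (conjc z) = re z. Proof. by case: z. Qed.
Lemma im_conj z : im (conjc z) = - im z. Proof. by case: z. Qed.
Lemma re_add z w : re (z + w) = re z + re w. Proof. by case: z; case: w. Qed.
Lemma im_add z w : im (z + w) = im z + im w. Proof. by case: z; case: w. Qed.
Lemma re_opp z : re (- z) = - re z. Proof. by case: z. Qed.
Lemma im_opp z : im (- z) = - im z. Proof. by case: z. Qed.
Lemma re_mul z w : re (z * w) = re z * re w - im z * im w.
Proof. by case: z; case: w. Qed.
Lemma im_mul z w : im (z * w) = re z * im w + im z * re w.
Proof. by case: z; case: w. Qed.
Lemma re_rmul (x : R) z : re (x%:C * z) = x * re z.
Proof. by rewrite re_mul /= mul0r subr0. Qed.
Lemma conjcM z w : conjc (z * w) = conjc z * conjc w.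
Proof. exact: rmorphM. Qed.
Lemma conjcD z w : conjc (z + w) = conjc z + conjc w.
Proof. exact: rmorphD. Qed.

Lemma conjcN z : conjc (- z) = - conjc z.
Proof. by case: z => x y; simpc. Qed.
Lemma conjc_sum (I : Type) (s : seq I) (F : I -> R[i]) :
  conjc (\sum_(i <- s) F i) = \sum_(i <- s) conjc (F i).
Proof.
elim: s => [|i s IH]; first by rewrite !big_nil conjc0.
by rewrite !big_cons conjcD IH.
Qed.
Lemma re_sum (I : Type) (s : seq I) (F : I -> R[i]) :
  re (\sum_(i <- s) F i) = \sum_(i <- s) re (F i).
Proof.
elim: s => [|i s IH]; first by rewrite !big_nil.
by rewrite !big_cons re_add IH.
Qed.

Lemma complexP z w : re z = re w -> im z = im w -> z = w.
Proof. by case: z; case: w => a b c d /= -> ->. Qed.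

End NormC.

Section RealSequences.
Variable R : realType.
Implicit Types (u v : nat -> R).

Lemma cvg0_epsP u : (u @ \oo --> (0 : R)) <->
  forall eps, 0 < eps -> exists N, forall n, (N <= n)%N -> `|u n| < eps.
Proof.
split=> [/cvgrPdist_lt cu eps /cu [N _ H]|H].
  by exists N => n Nn; have := H n Nn; rewrite /= sub0r normrN.
apply/cvgrPdist_lt => eps /H [N HN]; exists N => // n Nn /=.
by rewrite sub0r normrN; exact: HN.
Qed.

Lemma cvg0_le u v : (forall n, `|u n| <= v n) -> v @ \oo --> (0 : R) ->
  u @ \oo --> (0 : R).
Proof.
move=> uv /cvg0_epsP cv; apply/cvg0_epsP => eps /cv [N HN].
exists N => n /HN; apply: le_lt_trans.
exact: le_trans (uv n) (ler_norm _).
Qed.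

Lemma cvg0D u v : u @ \oo --> (0 : R) -> v @ \oo --> (0 : R) ->
  (fun n => u n + v n) @ \oo --> (0 : R).
Proof. by move=> cu cv; rewrite -[0]addr0; exact: cvgD. Qed.

Lemma cvg0Ml (c : R) u : u @ \oo --> (0 : R) ->
  (fun n => c * u n) @ \oo --> (0 : R).
Proof. by move=> cu; rewrite -[0](mulr0 c); apply: cvgM => //; exact: cvg_cst. Qed.

Lemma cvg0_sqr u : (fun n => u n ^+ 2) @ \oo --> (0 : R) ->
  u @ \oo --> (0 : R).
Proof.
move=> /cvg0_epsP cu; apply/cvg0_epsP => eps e0.
have [N HN] := cu _ (exprn_gt0 2 e0); exists N => n /HN.
rewrite normrX => H; rewrite ltNge; apply/negP => h.
by move: H; rewrite ltNge lerXn2r // ?nnegrE // ltW.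
Qed.

Lemma cvg_inv_succ : (fun n => n.+1%:R^-1) @ \oo --> (0 : R).
Proof. exact: cvg_harmonic. Qed.

Lemma le_of_eps (x y : R) : (forall eps, 0 < eps -> x <= y + eps) -> x <= y.
Proof. by move=> H; apply/ler_addgt0Pr. Qed.

(** The quadratic is tested at its minimizer [1 / r], or at a large [t] if [r = 0]. [A] occurs in
    both coefficients because in the main use it is [|a f g|^2], with [f] perturbed by [- t * a f g]
    times [g]; the conclusion is then the Cauchy-Schwarz inequality. *)
Lemma discriminant_le (p A r : R) : 0 <= A -> 0 <= r ->
  (forall t, 0 <= p - 2 * t * A + t ^+ 2 * (A * r)) -> A <= p * r.
Proof.
move=> A0 r0 H; have p0 : 0 <= p by have := H 0; rewrite !(mulr0, mul0r, expr0n, subr0, addr0).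
have [r_0|rn0] := eqVneq r 0.
  rewrite r_0 mulr0 leNgt; apply/negP => Apos.
  have := H ((p + 1) / A).
  rewrite r_0 !mulr0 addr0 -mulrA divfK ?gt_eqF // => h; lra.
have rpos : 0 < r by rewrite lt_def rn0.
have := H r^-1.
have -> : p - 2 * r^-1 * A + r^-1 ^+ 2 * (A * r) = p - A / r by field.
by rewrite subr_ge0 ler_pdivrMr.
Qed.

End RealSequences.

Definition ccvg (R : realType) (x : nat -> R[i]) (z : R[i]) : Prop :=
  (fun n => normc (x n - z)) @ \oo --> (0 : R).

Section ComplexSequences.
Variable R : realType.
Implicit Types (z w : R[i]) (x y : nat -> R[i]).

Lemma ccvg_unique x z w : ccvg x z -> ccvg x w -> z = w.
Proof.
move=> xz xw; apply/eqP; rewrite -subr_eq0; apply/eqP/ComplexField.Normc.eq0_normc.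
apply/eqP; rewrite eq_le normc_ge0 andbT; apply: le_of_eps => eps e0.
have /cvg0_epsP/(_ _ e0) [N HN] := cvg0D xz xw.
have /ltW := HN N (leqnn _); rewrite add0r; apply: le_trans.
apply: le_trans (ler_norm _).
by rewrite (normc_distC (x N) z); apply: le_trans (le_normc_add _ _); rewrite subrKA.
Qed.

Lemma ccvg_close x y z : ccvg x z ->
  (fun n => normc (x n - y n)) @ \oo --> (0 : R) -> ccvg y z.
Proof.
move=> xz xy; apply: cvg0_le (cvg0D xy xz) => n.
rewrite ger0_norm ?normc_ge0 // normc_distC (normc_distC (x n) z).
have -> : z - y n = (z - x n) + (x n - y n) by rewrite subrKA.
by rewrite addrC; exact: le_normc_add.
Qed.

Lemma ccvg_cst z : ccvg (fun=> z) z.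
Proof.
rewrite /ccvg (_ : (fun=> _) = (fun=> 0 : R)); first exact: cvg_cst.
by apply: funext => n; rewrite subrr -[RHS](normr0 R) -normc_real.
Qed.

Lemma ccvgD x y z w : ccvg x z -> ccvg y w -> ccvg (fun n => x n + y n) (z + w).
Proof.
move=> xz yw; apply: cvg0_le (cvg0D xz yw) => n.
rewrite ger0_norm ?normc_ge0 // opprD addrACA; exact: le_normc_add.
Qed.

Lemma ccvgMl c x z : ccvg x z -> ccvg (fun n => c * x n) (c * z).
Proof.
move=> xz; apply: cvg0_le (cvg0Ml (normc c) xz) => n.
by rewrite ger0_norm ?normc_ge0 // -mulrBr normcM.
Qed.

Lemma ccvg_conj x z : ccvg x z -> ccvg (fun n => conjc (x n)) (conjc z).
Proof.
by apply: cvg0_le => n; rewrite ger0_norm ?normc_ge0 // -rmorphB normc_conj.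
Qed.

Lemma ccvgN x z : ccvg x z -> ccvg (fun n => - x n) (- z).
Proof.
by apply: cvg0_le => n; rewrite ger0_norm ?normc_ge0 // -opprD normc_opp.
Qed.

Lemma ccvgB x y z w : ccvg x z -> ccvg y w -> ccvg (fun n => x n - y n) (z - w).
Proof. by move=> xz yw; apply: ccvgD => //; exact: ccvgN. Qed.

Lemma ccvgM x y z w : ccvg x z -> ccvg y w -> ccvg (fun n => x n * y n) (z * w).
Proof.
move=> xz yw.
have prod : (fun n => normc (x n - z) * normc (y n - w)) @ \oo --> (0 : R).
  by rewrite -[0](mulr0 0); apply: cvgM.
apply: cvg0_le (cvg0D prod (cvg0D (cvg0Ml (normc w) xz) (cvg0Ml (normc z) yw))) => n.
rewrite ger0_norm ?normc_ge0 // (_ : x n * y n - z * w =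
  (x n - z) * (y n - w) + (w * (x n - z) + z * (y n - w))); last by ring.
apply: le_trans (le_normc_add _ _) _; rewrite -!normcM lerD2l.
exact: le_normc_add.
Qed.

Lemma ccvg_sum (I : Type) (s : seq I) (x : I -> nat -> R[i]) (z : I -> R[i]) :
  (forall i, ccvg (x i) (z i)) ->
  ccvg (fun n => \sum_(i <- s) x i n) (\sum_(i <- s) z i).
Proof.
move=> H; elim: s => [|i s IH].
  by rewrite big_nil; under eq_fun do rewrite big_nil; exact: ccvg_cst.
by rewrite big_cons; under eq_fun do rewrite big_cons; apply: ccvgD.
Qed.

Lemma ccvg_re_le x z (c : R) : (forall n, re (x n) <= c) -> ccvg x z -> re z <= c.
Proof.
move=> xc xz; apply: le_of_eps => eps e0.
have /cvg0_epsP/(_ _ e0) [N /(_ N (leqnn N)) /ltW h] := xz.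
rewrite -(subrK (x N) z) re_add addrC lerD //.
apply: le_trans h; apply: le_trans (ler_norm _) _.
by rewrite (ger0_norm (normc_ge0 _)) normc_distC abs_re_le.
Qed.

Lemma ccvg_re_ge x z (c : R) : (forall n, c <= re (x n)) -> ccvg x z -> c <= re z.
Proof.
move=> xc /ccvgN xz; rewrite -lerN2 -re_opp; apply: ccvg_re_le xz => n.
by rewrite re_opp lerN2.
Qed.

End ComplexSequences.

(** * Nonnegative Hermitian forms *)

Section Sesquilinear.
Variables (R : realType) (V : lmodType R[i]).
Implicit Types (D : set V) (a : V -> V -> R[i]).

(** The laws are relative to a domain because [cderiv] is a limit, with a meaningless value where
    the limit fails to exist: the energy is sesquilinear only among functions that are regular on
    every edge. *)
Record sesq D a : Prop := Sesq {
  sesq0 : D 0;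
  sesq_lin : forall c f g, D f -> D g -> D (c *: f + g);
  sesqPl : forall c f g h, D f -> D g -> D h ->
    a (c *: f + g) h = c * a f h + a g h;
  sesqC : forall f g, D f -> D g -> a g f = conjc (a f g);
  sesq_ge0 : forall f, D f -> 0 <= re (a f f) }.

Definition snorm a f : R := Num.sqrt (re (a f f)).

Variables (D : set V) (a : V -> V -> R[i]).
Hypothesis aS : sesq D a.
Implicit Types (f g h : V).

Lemma sesqD f g : D f -> D g -> D (f + g).
Proof. by move=> Df Dg; rewrite -[f]scale1r; apply: (sesq_lin aS). Qed.

Lemma sesqZ c f : D f -> D (c *: f).
Proof. by move=> Df; rewrite -[_ *: _]addr0; apply: (sesq_lin aS) => //; exact: sesq0 aS. Qed.

Lemma sesqN f : D f -> D (- f).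
Proof. by move=> Df; rewrite -scaleN1r; apply: sesqZ. Qed.

Lemma sesqB f g : D f -> D g -> D (f - g).
Proof. by move=> Df Dg; apply: sesqD => //; exact: sesqN. Qed.

Lemma sesq_sum (I : Type) (s : seq I) (F : I -> V) :
  (forall i, D (F i)) -> D (\sum_(i <- s) F i).
Proof.
move=> DF; elim: s => [|i s IH]; first by rewrite big_nil; exact: sesq0 aS.
by rewrite big_cons; apply: sesqD.
Qed.

Lemma sesq0l f : D f -> a 0 f = 0.
Proof.
move=> Df; have D0 := sesq0 aS.
have := sesqPl aS 1 D0 D0 Df; rewrite scaler0 addr0 mul1r => /eqP.
by rewrite -subr_eq0 opprD addNKr oppr_eq0 => /eqP.
Qed.

Lemma sesqZl c f g : D f -> D g -> a (c *: f) g = c * a f g.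
Proof.
move=> Df Dg; rewrite -[c *: f]addr0 (sesqPl aS) ?sesq0l ?addr0 //; exact: sesq0 aS.
Qed.

Lemma sesqDl f g h : D f -> D g -> D h -> a (f + g) h = a f h + a g h.
Proof. by move=> Df Dg Dh; rewrite -[f in LHS]scale1r (sesqPl aS) // mul1r. Qed.

Lemma sesqNl f g : D f -> D g -> a (- f) g = - a f g.
Proof. by move=> Df Dg; rewrite -scaleN1r sesqZl // mulN1r. Qed.

Lemma sesqBl f g h : D f -> D g -> D h -> a (f - g) h = a f h - a g h.
Proof. by move=> Df Dg Dh; rewrite sesqDl ?sesqNl //; exact: sesqN. Qed.

Lemma sesqDr f g h : D f -> D g -> D h -> a f (g + h) = a f g + a f h.
Proof.
move=> Df Dg Dh; rewrite (sesqC aS (sesqD Dg Dh) Df) sesqDl // conjcD.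
by rewrite -!(sesqC aS).
Qed.

Lemma sesqZr c f g : D f -> D g -> a f (c *: g) = conjc c * a f g.
Proof.
move=> Df Dg; rewrite (sesqC aS (sesqZ c Dg) Df) sesqZl // conjcM.
by rewrite -!(sesqC aS).
Qed.

Lemma sesqNr f g : D f -> D g -> a f (- g) = - a f g.
Proof.
by move=> Df Dg; rewrite -scaleN1r sesqZr // conjcN conjc1 mulN1r.
Qed.

Lemma sesqBr f g h : D f -> D g -> D h -> a f (g - h) = a f g - a f h.
Proof. by move=> Df Dg Dh; rewrite sesqDr ?sesqNr //; exact: sesqN. Qed.

Lemma sesq_suml (I : Type) (s : seq I) (F : I -> V) g :
  (forall i, D (F i)) -> D g ->
  a (\sum_(i <- s) F i) g = \sum_(i <- s) a (F i) g.
Proof.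
move=> DF Dg; elim: s => [|i s IH]; first by rewrite !big_nil sesq0l.
by rewrite !big_cons sesqDl ?IH //; exact: sesq_sum.
Qed.

Lemma sesq_im f : D f -> im (a f f) = 0.
Proof.
move=> Df; have := congr1 (@complex.Im R) (sesqC aS Df Df); rewrite im_conj; lra.
Qed.

Lemma sesq_real f : D f -> a f f = (re (a f f))%:C.
Proof. by move=> Df; apply: complexP => //=; exact: sesq_im. Qed.

Lemma snorm_ge0 f : 0 <= snorm a f. Proof. exact: sqrtr_ge0. Qed.

Lemma snorm_sqr f : D f -> snorm a f ^+ 2 = re (a f f).
Proof. by move=> Df; rewrite sqr_sqrtr // (sesq_ge0 aS). Qed.

Lemma re_sesq_add f (c : R[i]) g : D f -> D g ->
  re (a (f + c *: g) (f + c *: g)) =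
  re (a f f) + 2 * re (conjc c * a f g) + normc c ^+ 2 * re (a g g).
Proof.
move=> Df Dg; have Dcg := sesqZ c Dg; have DA := sesqD Df Dcg.
rewrite sesqDl // !sesqDr // sesqZr // sesqZl // sesqZr // sesqZl //.
rewrite (sesqC aS Df Dg) (mulrA _ c (a g g)) (mulrC _ c) mulc_conj.
rewrite -(re_rmul (normc c ^+ 2)) !re_add.
have -> : re (c * conjc (a f g)) = re (conjc c * a f g).
  by rewrite -[LHS]re_conj conjcM conjcK.
lra.
Qed.

Lemma sesq_CS f g : D f -> D g -> normc (a f g) <= snorm a f * snorm a g.
Proof.
move=> Df Dg; rewrite -(ler_pXn2r (ltn0Sn 1)) ?nnegrE ?normc_ge0 ?mulr_ge0 ?snorm_ge0 //.
rewrite exprMn !snorm_sqr //; apply: discriminant_le.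
- exact: exprn_ge0 (normc_ge0 _).
- exact: sesq_ge0 aS _ Dg.
move=> t; have := sesq_ge0 aS (sesqD Df (sesqZ ((- t)%:C * a f g) Dg)).
rewrite re_sesq_add // conjcM conjc_real -mulrA re_rmul (mulrC (conjc _)).
rewrite mulc_conj /= normcM normc_real normrN exprMn real_normK ?num_real //.
by congr (0 <= _); ring.
Qed.

Lemma snorm_add f g : D f -> D g -> snorm a (f + g) <= snorm a f + snorm a g.
Proof.
move=> Df Dg; rewrite -(ler_pXn2r (ltn0Sn 1)) ?nnegrE ?addr_ge0 ?snorm_ge0 //.
rewrite snorm_sqr; last exact: sesqD.
have := re_sesq_add 1 Df Dg; rewrite scale1r => ->.
rewrite sqrrD !snorm_sqr // conjc1 mul1r ComplexField.Normc.normc1.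
rewrite expr1n mul1r.
have : re (a f g) <= snorm a f * snorm a g.
  apply: le_trans (sesq_CS Df Dg); apply: le_trans (ler_norm _) _.
  exact: abs_re_le.
lra.
Qed.

Lemma snormZ c f : D f -> snorm a (c *: f) = normc c * snorm a f.
Proof.
move=> Df; rewrite /snorm sesqZl // ?sesqZr //; last exact: sesqZ.
rewrite mulrA mulc_conj re_rmul sqrtrM ?sqr_ge0 // sqrtr_sqr.
by rewrite ger0_norm ?normc_ge0.
Qed.

Lemma snormN f : D f -> snorm a (- f) = snorm a f.
Proof.
by move=> Df; rewrite -scaleN1r snormZ // normc_opp ComplexField.Normc.normc1 mul1r.
Qed.

Lemma snorm_distC f g : D f -> D g -> snorm a (f - g) = snorm a (g - f).
Proof. by move=> Df Dg; rewrite -snormN ?opprB //; exact: sesqB. Qed.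

Lemma snorm_sub_le f g : D f -> D g -> snorm a f <= snorm a g + snorm a (f - g).
Proof.
by move=> Df Dg; rewrite -{1}(subrK g f) addrC snorm_add //; exact: sesqB.
Qed.

Lemma snorm_triangle h f g : D f -> D g -> D h ->
  snorm a (f - g) <= snorm a (f - h) + snorm a (h - g).
Proof.
move=> Df Dg Dh; rewrite -(subrKA h f (- g)).
by apply: snorm_add; apply: sesqB.
Qed.

Lemma sesq_dist_le f f' g g' : D f -> D f' -> D g -> D g' ->
  normc (a f g - a f' g') <=
  snorm a (f - f') * snorm a g + snorm a f' * snorm a (g - g').
Proof.
move=> Df Df' Dg Dg'.
have -> : a f g - a f' g' = a (f - f') g + a f' (g - g').
  by rewrite sesqBl // sesqBr // subrKA.
by apply: le_trans (le_normc_add _ _) (lerD _ _); apply: sesq_CS => //; exact: sesqB.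
Qed.

End Sesquilinear.

Section FiniteRankPerturbation.
Variables (R : realType) (V : lmodType R[i]).

(** The hypothesis on [u] is the nonnegativity of the perturbed form, so that Cauchy-Schwarz and the
    minimization argument apply to it. With [m = 0] it covers [a - x b]. *)
Lemma sesq_perturb (D H : set V) a b (x : R) m (e : 'I_m -> V) :
  sesq D a -> D `<=` H -> sesq H b -> (forall i, H (e i)) ->
  (forall u, D u -> x * re (b u u) <=
     re (a u u) + \sum_(i < m) normc (b u (e i)) ^+ 2) ->
  sesq D (fun u v => a u v - x%:C * b u v + \sum_(i < m) b u (e i) * b (e i) v).
Proof.
move=> aS sub bS He ge; split; first exact: sesq0 aS.
- exact: sesq_lin aS.
- move=> c f g h Df Dg Dh; rewrite (sesqPl aS) // (sesqPl bS); try exact: sub.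
  under eq_bigr do rewrite (sesqPl bS c (sub _ Df) (sub _ Dg) (He _)) mulrDl -mulrA.
  rewrite big_split /= -mulr_sumr; ring.
- move=> f g Df Dg; have [Hf Hg] := (sub _ Df, sub _ Dg).
  rewrite (sesqC aS Df Dg) (sesqC bS Hf Hg) [in RHS]conjcD [in RHS]conjcD.
  rewrite conjcN conjcM conjc_real conjc_sum; congr (_ + _).
  apply: eq_bigr => i _; rewrite conjcM -(sesqC bS) // -(sesqC bS) // mulrC //.
- move=> f Df; rewrite re_add re_add re_opp re_rmul.
  rewrite re_sum (eq_bigr (fun i => normc (b f (e i)) ^+ 2)).
    by have := ge _ Df; lra.
  by move=> i _; rewrite (sesqC bS (sub _ Df) (He i)) mulc_conj.
Qed.

End FiniteRankPerturbation.

(** [hspace] carries data only; these are the properties on which the abstract argument rests,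
    established for the graph in [hilbert_L2]. *)
Record hilbert (R : realType) (X : hspace R) : Prop := Hilbert {
  hilS : sesq (@carrier R X) (@ip R X);
  hil_complete : forall u : nat -> vec X, (forall n, carrier (u n)) ->
    (forall eps : R, 0 < eps -> exists N, forall m n, (N <= m)%N -> (N <= n)%N ->
       hnorm (u m - u n) < eps) ->
    exists2 f, carrier f & (fun n => hnorm (u n - f)) @ \oo --> (0 : R) }.

(** * Solving a coercive form equation by minimization *)

Section Riesz.
Variables (R : realType) (X : hspace R) (HX : hilbert X).
Let S := hilS HX.
Implicit Types (f g h : vec X).

Lemma hnorm_ge0 f : 0 <= hnorm f. Proof. exact: sqrtr_ge0. Qed.

Lemma hnorm_sqr f : carrier f -> hnorm f ^+ 2 = re (ip f f).
Proof. exact: snorm_sqr S f. Qed.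

Lemma heq_refl f : carrier f -> heq f f.
Proof.
move=> Cf; rewrite /heq subrr /hnorm (sesq0l S) ?sqrtr0 //; exact: sesq0 S.
Qed.

Lemma heq_ip f g h : carrier f -> carrier g -> carrier h ->
  heq f g -> ip f h = ip g h.
Proof.
move=> Cf Cg Ch fg; apply/eqP; rewrite -subr_eq0 -(sesqBl S) //.
apply/eqP/ComplexField.Normc.eq0_normc/eqP; rewrite eq_le normc_ge0 andbT.
apply: le_trans (sesq_CS S (sesqB S Cf Cg) Ch) _.
by rewrite (_ : snorm _ _ = 0) ?mul0r.
Qed.

Lemma heq_of_ip f g : carrier f -> carrier g ->
  (forall v, carrier v -> ip f v = ip g v) -> heq f g.
Proof.
move=> Cf Cg H; have CB := sesqB S Cf Cg.
by rewrite /heq /hnorm (sesqBl S) ?H ?subrr ?sqrtr0.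
Qed.

Lemma hcvg_heq (u : nat -> vec X) f f' : (forall n, carrier (u n)) -> carrier f -> carrier f' ->
  heq f f' -> (fun n => hnorm (u n - f)) @ \oo --> (0 : R) ->
  (fun n => hnorm (u n - f')) @ \oo --> (0 : R).
Proof.
move=> Cu Cf Cf' ff'; apply: cvg0_le => n; rewrite ger0_norm ?hnorm_ge0 //.
by apply: le_trans (snorm_triangle S (Cu n) Cf' Cf) _; rewrite [X in _ + X]ff' addr0.
Qed.

Lemma ip_cvg (u v : nat -> vec X) f g : (forall n, carrier (u n)) -> (forall n, carrier (v n)) ->
  carrier f -> carrier g ->
  (fun n => hnorm (u n - f)) @ \oo --> (0 : R) ->
  (fun n => hnorm (v n - g)) @ \oo --> (0 : R) ->
  ccvg (fun n => ip (u n) (v n)) (ip f g).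
Proof.
move=> Cu Cv Cf Cg uf vg.
have uv : (fun n => hnorm (u n - f) * hnorm (v n - g)) @ \oo --> (0 : R).
  by rewrite -[0](mulr0 0); apply: cvgM.
apply: cvg0_le (cvg0D uv (cvg0D (cvg0Ml (hnorm g) uf) (cvg0Ml (hnorm f) vg))) => n.
rewrite ger0_norm ?normc_ge0 //.
apply: le_trans (sesq_dist_le S (Cu n) Cf (Cv n) Cg) _.
rewrite addrA lerD2r [hnorm g * _]mulrC -mulrDr; apply: ler_wpM2l; first exact: hnorm_ge0.
by rewrite addrC; exact: (snorm_sub_le S).
Qed.

Variables (D : set (vec X)) (b : vec X -> vec X -> R[i]) (delta : R).
Hypotheses (DC : D `<=` @carrier R X) (bS : sesq D b) (delta0 : 0 < delta).
Hypothesis coercive : forall u, D u -> delta * re (ip u u) <= re (b u u).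

(* A sequence minimizing [b u u - 2 re (ip g u)] is Cauchy, and satisfies the
   Euler equation up to an error that is uniform in the test vector. *)
Lemma riesz g : carrier g -> exists f (u : nat -> vec X) (eta : nat -> R),
  [/\ carrier f, forall n, D (u n),
      (fun n => hnorm (u n - f)) @ \oo --> (0 : R), eta @ \oo --> (0 : R) &
  (forall m n, snorm b (u m - u n) <= eta m + eta n) /\
  (forall n v, D v -> normc (b (u n) v - ip g v) <= eta n * snorm b v)].
Proof.
move=> Cg; pose J u := re (b u u) - 2 * re (ip g u).
pose E := [set J u | u in D].
have D0 := sesq0 bS.
have lbE : lbound E (- (hnorm g ^+ 2 / delta)).
  move=> _ [u Du <-]; rewrite /J; have := coercive Du.
  rewrite -(hnorm_sqr (DC Du)) => H.
  have H2 : re (ip g u) <= hnorm g * hnorm u.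
    apply: le_trans (sesq_CS S Cg (DC Du)); apply: le_trans (ler_norm _) _.
    exact: abs_re_le.
  have -> : - (hnorm g ^+ 2 / delta) =
     delta * hnorm u ^+ 2 - 2 * (hnorm g * hnorm u) -
     delta * (hnorm u - hnorm g / delta) ^+ 2.
    by field; exact: lt0r_neq0.
  have : 0 <= delta * (hnorm u - hnorm g / delta) ^+ 2.
    by rewrite mulr_ge0 ?sqr_ge0 // ltW.
  lra.
have hiE : has_inf E by split; [exists (J 0), 0 | exists (- (hnorm g ^+ 2 / delta))].
have ex n : exists u, D u /\ J u < inf E + n.+1%:R^-1.
  have [|_ [u Du <-] Ju] := @inf_adherent _ E n.+1%:R^-1 _ hiE.
    by rewrite invr_gt0 ltr0n.
  by exists u.
have [u uP] := choice ex; have Du n := (uP n).1.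
pose eta n : R := Num.sqrt (n.+1%:R^-1).
have eta0 : eta @ \oo --> (0 : R).
  apply: cvg0_sqr; rewrite (_ : (fun n => _) = (fun n => n.+1%:R^-1)).
    exact: cvg_inv_succ.
  by apply: funext => n; rewrite sqr_sqrtr // invr_ge0.
(* Moving [u n] along [v] cannot bring [J] below its infimum, which is less than [1 / (n + 1)] below
   [J (u n)]. This is a quadratic inequality in the step [t], and [discriminant_le] bounds its
   linear coefficient. *)
have euler n v : D v -> normc (b (u n) v - ip g v) <= eta n * snorm b v.
  move=> Dv; set e := b (u n) v - ip g v.
  rewrite -(ler_pXn2r (ltn0Sn 1)) ?nnegrE ?normc_ge0 ?mulr_ge0 ?sqrtr_ge0 //.
  rewrite exprMn (snorm_sqr bS) // sqr_sqrtr ?invr_ge0 //.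
  apply: discriminant_le; first exact: exprn_ge0 (normc_ge0 _).
    exact: sesq_ge0 bS _ Dv.
  move=> t; pose c : R[i] := (- t)%:C * e.
  have Dcv := sesqZ bS c Dv; have DA := sesqD bS (Du n) Dcv.
  have : inf E <= J (u n + c *: v) by apply: ge_inf => //; [exact: hiE.2|exists (u n + c *: v)].
  rewrite /J (re_sesq_add bS) // (sesqDr S) ?(sesqZr S) //; try exact: DC.
  have -> : re (b (u n) (u n)) + 2 * re (conjc c * b (u n) v) +
      normc c ^+ 2 * re (b v v) - 2 * re (ip g (u n) + conjc c * ip g v) =
     J (u n) + 2 * re (conjc c * e) + normc c ^+ 2 * re (b v v).
    by rewrite /J /e mulrBr !re_add re_opp; ring.
  rewrite {1}/c conjcM conjc_real -mulrA re_rmul (mulrC (conjc _)) mulc_conj /=.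
  rewrite normcM normc_real normrN exprMn real_normK ?num_real //.
  have key (p A r m N : R) : p < m + N ->
      m <= p + 2 * (- t * A) + t ^+ 2 * A * r ->
      0 <= N - 2 * t * A + t ^+ 2 * (A * r).
    rewrite mulrA => h1 h2; lra.
  exact: key (uP n).2.
(* The two Euler equations, tested with [u m - u n] and subtracted. *)
have cau m n : snorm b (u m - u n) <= eta m + eta n.
  have DB := sesqB bS (Du m) (Du n).
  have [->|nz] := eqVneq (snorm b (u m - u n)) 0; first by rewrite addr_ge0 ?sqrtr_ge0.
  have pos : 0 < snorm b (u m - u n) by rewrite lt_def nz sqrtr_ge0.
  rewrite -(ler_pM2r pos) -expr2 (snorm_sqr bS) // mulrDl.
  apply: le_trans (lerD (euler m _ DB) (euler n _ DB)).
  rewrite {1}(sesqBl bS) //; apply: le_trans (ler_norm _) _.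
  apply: le_trans (abs_re_le _) _.
  rewrite (normc_distC (b (u n) _)); apply: le_trans (le_normc_add _ _).
  by rewrite subrKA.
have hle v : D v -> hnorm v <= (Num.sqrt delta)^-1 * snorm b v.
  move=> Dv; rewrite mulrC ler_pdivlMr ?sqrtr_gt0 //.
  rewrite -(ler_pXn2r (ltn0Sn 1)) ?nnegrE ?mulr_ge0 ?sqrtr_ge0 //.
  rewrite exprMn (snorm_sqr bS) // hnorm_sqr; last exact: DC.
  by rewrite sqr_sqrtr ?(ltW delta0) // mulrC; exact: coercive.
have [||f Cf uf] := hil_complete HX (u := u).
- by move=> n; exact: DC.
- move=> eps e0; have e1 : 0 < eps * Num.sqrt delta / 2.
    by rewrite divr_gt0 ?mulr_gt0 ?sqrtr_gt0.
  have /cvg0_epsP/(_ _ e1) [N HN] := eta0; exists N => m n /HN + /HN.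
  rewrite !ger0_norm ?sqrtr_ge0 // => hm hn.
  apply: le_lt_trans (hle _ (sesqB bS (Du m) (Du n))) _.
  rewrite mulrC ltr_pdivrMr ?sqrtr_gt0 //; have := cau m n; lra.
by exists f, u, eta; split.
Qed.

End Riesz.

(** * The operator of a closable form *)

Section FormOperator.
Variables (R : realType) (X : hspace R) (HX : hilbert X).
Variables (D : set (vec X)) (a : vec X -> vec X -> R[i]).
Hypotheses (DC : D `<=` @carrier R X) (aS : sesq D a).
Hypothesis closable : forall u : nat -> vec X, (forall n, D (u n)) ->
  (fun n => hnorm (u n)) @ \oo --> (0 : R) ->
  (forall eps : R, 0 < eps -> exists N, forall m n, (N <= m)%N -> (N <= n)%N ->
     re (a (u m - u n) (u m - u n)) < eps) ->
  (fun n => snorm a (u n)) @ \oo --> (0 : R).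
Let S := hilS HX.
Let A := form_operator D a.
Implicit Types (f g h : vec X).

Lemma form_cvgP (u : nat -> vec X) f : form_cvg D a u f <->
  [/\ forall n, D (u n), (fun n => hnorm (u n - f)) @ \oo --> (0 : R) &
   forall eps : R, 0 < eps -> exists N, forall m n, (N <= m)%N -> (N <= n)%N ->
     snorm a (u m - u n) < eps].
Proof.
split=> -[Du uf cau]; split=> // eps e0.
  have [N HN] := cau _ (exprn_gt0 2 e0); exists N => m n /HN + /[dup] ? => /(_ n) => h.
  move=> /h; rewrite -(snorm_sqr aS) ?ltr_pXn2r ?nnegrE ?sqrtr_ge0 ?ltW //.
  exact: (sesqB aS).
have e1 : 0 < Num.sqrt eps by rewrite sqrtr_gt0.
have [N HN] := cau _ e1; exists N => m n Nm Nn; have := HN _ _ Nm Nn.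
rewrite -(ltr_pXn2r (ltn0Sn 1)) ?nnegrE ?sqrtr_ge0 //.
by rewrite (snorm_sqr aS (sesqB aS (Du m) (Du n))) sqr_sqrtr ?ltW.
Qed.

Lemma form_cvg_bounded (u : nat -> vec X) f : form_cvg D a u f ->
  exists2 M, 0 <= M & forall n, snorm a (u n) <= M.
Proof.
move=> /form_cvgP[Du _ cau]; have [N HN] := cau _ ltr01.
have pos n : 0 <= \sum_(i < n) snorm a (u i) by apply: sumr_ge0 => i _; exact: sqrtr_ge0.
exists (\sum_(i < N.+1) snorm a (u i) + 1); first by rewrite addr_ge0.
move=> n; case: (ltnP n N.+1) => [nN|/ltnW Nn].
  rewrite (bigD1 (Ordinal nN)) //= -addrA lerDl addr_ge0 // sumr_ge0 // => i _.
  exact: sqrtr_ge0.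
apply: le_trans (snorm_sub_le aS (Du n) (Du N)) _.
rewrite big_ord_recr /= lerD ?lerDr ?pos //; exact: ltW (HN _ _ Nn (leqnn _)).
Qed.

Lemma form_cvg_lin (c : R[i]) (u v : nat -> vec X) f g : carrier f -> carrier g ->
  form_cvg D a u f -> form_cvg D a v g ->
  form_cvg D a (fun n => c *: u n + v n) (c *: f + g).
Proof.
move=> Cf Cg /form_cvgP[Du uf cu] /form_cvgP[Dv vg cv]; apply/form_cvgP.
split=> [n||eps e0]; first exact: (sesq_lin aS).
  apply: cvg0_le (cvg0D (cvg0Ml (normc c) uf) vg) => n.
  rewrite ger0_norm ?hnorm_ge0 // opprD addrACA -scalerBr.
  have CB := sesqB S (DC (Du n)) Cf; rewrite -(snormZ S c CB).
  by apply: (snorm_add S); [exact: (sesqZ S)|exact: (sesqB S) (DC (Dv n)) Cg].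
have c1 : 0 < normc c + 1 by rewrite ltr_wpDl ?normc_ge0.
have e1 : 0 < eps / 2 / (normc c + 1) by rewrite !divr_gt0.
have [N1 H1] := cu _ e1; have [N2 H2] := cv _ (divr_gt0 e0 (ltr0n _ 2)).
exists (maxn N1 N2) => m n; rewrite !geq_max => /andP[m1 m2] /andP[n1 n2].
have DBu := sesqB aS (Du m) (Du n).
rewrite opprD addrACA -scalerBr.
apply: le_lt_trans (snorm_add aS (sesqZ aS c DBu) (sesqB aS (Dv m) (Dv n))) _.
rewrite [ltRHS](splitr eps) (snormZ aS) // ler_ltD ?H2 //.
apply: le_trans (ler_wpM2l (normc_ge0 c) (ltW (H1 _ _ m1 n1))) _.
rewrite mulrA ler_pdivrMr // mulrC ler_wpM2l ?divr_ge0 ?(ltW e0) //.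
by rewrite lerDl.
Qed.

(** Closability for the difference of the two sequences, which tends to 0 in the Hilbert norm and is
    Cauchy for the form. *)
Lemma form_cvg_diff (u v : nat -> vec X) f : carrier f ->
  form_cvg D a u f -> form_cvg D a v f ->
  (fun n => snorm a (u n - v n)) @ \oo --> (0 : R).
Proof.
move=> Cf uf vf.
have /= := form_cvg_lin (-1) Cf Cf vf uf.
move=> [Dw w0 cw]; under eq_fun do rewrite -[u _ - _]addrC -scaleN1r.
apply: closable => //; move: w0; rewrite scaleN1r addNr.
by under eq_fun do rewrite subr0.
Qed.

(** The closed form is a relation that holds as soon as some pair of approximating sequences
    realizes the value. Bounded form norms and [form_cvg_diff] show that the limit does not depend
    on the pair. *)
Lemma form_limit (u u' v v' : nat -> vec X) f g z : carrier f -> carrier g ->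
  form_cvg D a u f -> form_cvg D a u' f -> form_cvg D a v g -> form_cvg D a v' g ->
  ccvg (fun n => a (u n) (v n)) z -> ccvg (fun n => a (u' n) (v' n)) z.
Proof.
move=> Cf Cg uf u'f vg v'g; move=> /ccvg_close; apply.
have [M1 M10 H1] := form_cvg_bounded vg; have [M2 M20 H2] := form_cvg_bounded u'f.
have uu := form_cvg_diff Cf uf u'f; have vv := form_cvg_diff Cg vg v'g.
apply: cvg0_le (cvg0D (cvg0Ml M1 uu) (cvg0Ml M2 vv)) => n.
move: uf u'f vg v'g => [Du _ _] [Du' _ _] [Dv _ _] [Dv' _ _].
rewrite ger0_norm ?normc_ge0 //; apply: le_trans (sesq_dist_le aS _ _ _ _) _ => //.
by rewrite mulrC lerD // ler_wpM2r ?sqrtr_ge0.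
Qed.

Lemma op_carrier f h : A f h -> carrier f /\ carrier h.
Proof. by case=> -[]. Qed.

Lemma op_seq f h : A f h -> exists u, form_cvg D a u f.
Proof. by case=> -[]. Qed.

Lemma opE f h (u v : nat -> vec X) g : A f h -> carrier g ->
  form_cvg D a u f -> form_cvg D a v g -> ccvg (fun n => a (u n) (v n)) (ip h g).
Proof.
move=> [[Cf _] Ch /(_ g) H] Cg uf vg.
have [|u' [v' [u'f v'g lim]]] := H; first by split => //; exists v.
exact: form_limit u'f uf v'g vg lim.
Qed.

Lemma op_intro f h (u : nat -> vec X) : carrier f -> carrier h ->
  form_cvg D a u f ->
  (forall v g, carrier g -> form_cvg D a v g ->
     ccvg (fun n => a (u n) (v n)) (ip h g)) -> A f h.
Proof.
move=> Cf Ch uf H; split=> //; first by split => //; exists u.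
by move=> g [Cg [v vg]]; exists u, v; split => //; exact: H.
Qed.

Lemma op_cst f : D f -> form_cvg D a (fun=> f) f.
Proof.
move=> Df; have D0 := sesqB aS Df Df; apply/form_cvgP.
split=> // [|eps e0].
  rewrite (_ : (fun _ => _) = (fun=> 0 : R)); first exact: cvg_cst.
  by apply: funext => n; apply: heq_refl HX _ _; exact: DC.
by exists 0%N => m n _ _; rewrite /snorm subrr (sesq0l aS) ?sqrtr0 //; exact: sesq0 aS.
Qed.

Lemma op_heq f f' h h' : A f h -> carrier f' -> carrier h' ->
  heq f f' -> heq h h' -> A f' h'.
Proof.
move=> Afh Cf' Ch' ff' hh'; have [Cf Ch] := op_carrier Afh.
have [u uf] := op_seq Afh; have uf' : form_cvg D a u f'.
  case: uf => Du uf cau; split => //.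
  by apply: (hcvg_heq HX) ff' uf => // n; exact: DC.
apply: (op_intro Cf' Ch' uf') => v g Cg vg.
by rewrite -(heq_ip HX Ch Ch' Cg hh'); exact: opE Afh Cg uf vg.
Qed.

Lemma op_lin (c : R[i]) f h f' h' : A f h -> A f' h' ->
  A (c *: f + f') (c *: h + h').
Proof.
move=> Afh Afh'; have [Cf Ch] := op_carrier Afh; have [Cf' Ch'] := op_carrier Afh'.
have [u uf] := op_seq Afh; have [u' uf'] := op_seq Afh'.
apply: (op_intro (u := fun n => c *: u n + u' n)).
- exact: (sesq_lin S).
- exact: (sesq_lin S).
- exact: form_cvg_lin.
move=> v g Cg vg; rewrite (sesqPl S) //.
have E n : a (c *: u n + u' n) (v n) = c * a (u n) (v n) + a (u' n) (v n).
  by case: uf uf' vg => Du _ _ [Du' _ _] [Dv _ _]; rewrite (sesqPl aS).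
rewrite /ccvg; under eq_fun do rewrite E; apply: ccvgD; last exact: opE Afh' Cg uf' vg.
by apply: ccvgMl; exact: opE Afh Cg uf vg.
Qed.

Lemma op_sym f h f' h' : A f h -> A f' h' -> ip h f' = ip f h'.
Proof.
move=> Afh Afh'; have [Cf Ch] := op_carrier Afh; have [Cf' Ch'] := op_carrier Afh'.
have [u uf] := op_seq Afh; have [u' uf'] := op_seq Afh'.
rewrite (sesqC S Ch' Cf).
apply: (ccvg_unique (opE Afh Cf' uf uf')).
have /ccvg_conj := opE Afh' Cf uf' uf.
rewrite /ccvg; under eq_fun => n.
  by case: uf uf' => Du _ _ [Du' _ _]; rewrite -(sesqC aS (Du' n) (Du n)); over.
by [].
Qed.

(** A bound known on the core passes to the domain of the operator: along an approximating sequence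
    the form tends to [ip h f], and the functionals [ip _ (e i)] are continuous. *)
Lemma op_energy (c : R) m (e : 'I_m -> vec X) f h : A f h ->
  (forall i, carrier (e i)) ->
  (forall u, D u -> c * re (ip u u) <=
     re (a u u) + \sum_(i < m) normc (ip u (e i)) ^+ 2) ->
  c * re (ip f f) <= re (ip h f) + \sum_(i < m) normc (ip f (e i)) ^+ 2.
Proof.
move=> Afh Ce ge; have [Cf Ch] := op_carrier Afh; have [u uf] := op_seq Afh.
have Du n : D (u n) by case: uf.
have Cu n := DC (Du n).
have u_f : (fun n => hnorm (u n - f)) @ \oo --> (0 : R) by case: uf.
have ipE g : carrier g -> ccvg (fun n => ip (u n) g) (ip f g).
  move=> Cg; apply: (ip_cvg HX (v := fun=> g)) => //.
  rewrite (_ : (fun _ => _) = (fun=> 0 : R)); first exact: cvg_cst.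
  by apply: funext => n; exact: heq_refl HX _ Cg.
pose s g := \sum_(i < m) ip g (e i) * conjc (ip g (e i)).
have sE g : re (s g) = \sum_(i < m) normc (ip g (e i)) ^+ 2.
  by rewrite /s re_sum; apply: eq_bigr => i _; rewrite mulc_conj.
have lim : ccvg (fun n => a (u n) (u n) - c%:C * ip (u n) (u n) + s (u n))
    (ip h f - c%:C * ip f f + s f).
  apply: ccvgD; first apply: ccvgB; first exact: (opE Afh Cf uf uf).
    by apply: ccvgMl; exact: (ip_cvg HX).
  by apply: ccvg_sum => i; apply: ccvgM; [|apply: ccvg_conj]; exact: ipE.
suff : 0 <= re (ip h f - c%:C * ip f f + s f).
  by rewrite !re_add re_opp re_rmul sE; lra.
apply: ccvg_re_ge lim => n; rewrite !re_add re_opp re_rmul sE.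
have := ge _ (Du n); lra.
Qed.

(** * Finite-rank perturbations and the spectrum below a level *)

Section Perturbed.
Variables (c : R) (m : nat) (e : 'I_m -> vec X).
Hypothesis Ce : forall i, carrier (e i).
Hypothesis ge_c : forall u, D u -> c * re (ip u u) <=
  re (a u u) + \sum_(i < m) normc (ip u (e i)) ^+ 2.

Let P f := \sum_(i < m) ip f (e i) *: e i.

Let CP f : carrier (P f).
Proof. by apply: (sesq_sum S) => i; exact: (sesqZ S). Qed.

Let ipP f g : carrier g -> ip (P f) g = \sum_(i < m) ip f (e i) * ip (e i) g.
Proof.
move=> Cg; rewrite (sesq_suml S) // => [|i]; last exact: (sesqZ S).
by apply: eq_bigr => i _; rewrite (sesqZl S).
Qed.

Let P_lin (k : R[i]) f g : carrier f -> carrier g -> P (k *: f + g) = k *: P f + P g.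
Proof.
move=> Cf Cg; rewrite /P scaler_sumr -big_split; apply: eq_bigr => i _ /=.
by rewrite (sesqPl S) // scalerDl scalerA.
Qed.

(* [sol w g f] says that (A + P - w) f = g. *)
Let sol (w : R[i]) g f := A f (g + w *: f - P f).

Lemma sol_carrier w g f : sol w g f -> carrier f.
Proof. by move=> /op_carrier[]. Qed.

Lemma sol_lin w (k : R[i]) g f g' f' : sol w g f -> sol w g' f' ->
  sol w (k *: g + g') (k *: f + f').
Proof.
move=> s s'; have Cf := sol_carrier s; have Cf' := sol_carrier s'.
have := op_lin k s s'; rewrite /sol P_lin //; congr (A _ _).
rewrite !scalerDr !scalerN !scalerA (mulrC w k) -!scalerA opprD.
by rewrite addrACA (addrACA (k *: g)).
Qed.

(** In [op_energy] the term [ip (P f) f] cancels the sum of squared functionals, which leaves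
    [(c - re w) |f|^2 <= re (ip g f)]. *)
Lemma sol_bound w g f : carrier g -> sol w g f ->
  (c - re w) * hnorm f <= hnorm g.
Proof.
move=> Cg s; have Cf := sol_carrier s.
have [hf0|hf0] := eqVneq (hnorm f) 0; first by rewrite hf0 mulr0 hnorm_ge0.
have hfp : 0 < hnorm f by rewrite lt_def hf0 hnorm_ge0.
rewrite -(ler_pM2r hfp) -mulrA -expr2 (hnorm_sqr HX) //.
have Cwf := sesqZ S w Cf; have := op_energy s Ce ge_c.
rewrite (sesqBl S) ?(sesqDl S) ?(sesqZl S) ?ipP //; last exact: (sesqD S).
rewrite !re_add re_opp re_mul (sesq_im S) // mulr0 subr0 re_sum.
under [X in - X]eq_bigr => i _ do rewrite (sesqC S Cf (Ce i)) mulc_conj /=.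
move=> H; have : re (ip g f) <= hnorm g * hnorm f.
  apply: le_trans (sesq_CS S Cg Cf); apply: le_trans (ler_norm _) _.
  exact: abs_re_le.
lra.
Qed.

Lemma sol_unique w g f f' : re w < c -> carrier g -> sol w g f -> sol w g f' ->
  heq f f'.
Proof.
move=> wc Cg s s'; have := sol_lin (-1) s' s.
rewrite !scaleN1r addNr addrC => s0.
have := sol_bound (sesq0 S) s0; rewrite {2}/hnorm (sesq0l S) ?sqrtr0; last exact: sesq0 S.
rewrite pmulr_rle0 ?subr_gt0 // => h.
by apply/eqP; rewrite eq_le h hnorm_ge0.
Qed.

(** Below [c] the form of [A + P - x] is coercive with constant [c - x], so [riesz] applies. Its
    Euler equation holds for test vectors in [D]; passing to the closure needs [u] to converge in
    the form norm of [a] as well. *)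
Lemma solve_real (x : R) g : x < c -> carrier g -> exists f, sol x%:C g f.
Proof.
move=> xc Cg.
have xge u : D u -> x * re (ip u u) <=
    re (a u u) + \sum_(i < m) normc (ip u (e i)) ^+ 2.
  move=> Du; apply: le_trans (ge_c Du); apply: ler_wpM2r (ltW xc).
  exact: sesq_ge0 S _ (DC Du).
pose b u v := a u v - x%:C * ip u v + \sum_(i < m) ip u (e i) * ip (e i) v.
have bS : sesq D b := sesq_perturb aS DC S Ce xge.
have bE u : D u -> re (b u u) = re (a u u) - x * re (ip u u) +
    \sum_(i < m) normc (ip u (e i)) ^+ 2.
  move=> Du; rewrite /b !re_add re_opp re_rmul re_sum; congr (_ + _).
  by apply: eq_bigr => i _; rewrite (sesqC S (DC Du) (Ce i)) mulc_conj.
have d0 : 0 < c - x by rewrite subr_gt0.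
have coer u : D u -> (c - x) * re (ip u u) <= re (b u u).
  by move=> Du; rewrite bE //; have := ge_c Du; lra.
have [f [u [eta [Cf Du uf eta0 [cau eul]]]]] := riesz HX DC bS d0 coer Cg.
exists f; have Cu n := DC (Du n).
(* [a] is [b + x ip] minus a nonnegative sum, and coercivity bounds [x ip] by [|x| / (c - x)] times
   [b]. *)
have ab v : D v -> snorm a v <= Num.sqrt (1 + `|x| / (c - x)) * snorm b v.
  move=> Dv; have k0 : 0 <= 1 + `|x| / (c - x).
    by rewrite addr_ge0 // divr_ge0 // ltW.
  rewrite /snorm -sqrtrM // ler_wsqrtr // mulrDl mul1r.
  have := coer _ Dv; rewrite -ler_pdivlMl // => h.
  have h1 : x * re (ip v v) <= `|x| / (c - x) * re (b v v).
    rewrite -mulrA; apply: le_trans (ler_wpM2l (normr_ge0 x) h).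
    by rewrite ler_wpM2r ?ler_norm //; exact: sesq_ge0 S _ (DC Dv).
  have h2 : 0 <= \sum_(i < m) normc (ip v (e i)) ^+ 2.
    by apply: sumr_ge0 => i _; exact: sqr_ge0.
  have := bE _ Dv; lra.
have fu : form_cvg D a u f.
  apply/form_cvgP; split => // eps e0.
  set K := Num.sqrt _ in ab; have K0 : 0 <= K by exact: sqrtr_ge0.
  have e1 : 0 < eps / 2 / (K + 1) by rewrite !divr_gt0 // ltr_wpDl.
  have /cvg0_epsP/(_ _ e1) [N HN] := eta0; exists N => p n /HN hp /HN hn.
  apply: le_lt_trans (ab _ (sesqB aS (Du p) (Du n))) _.
  have h : snorm b (u p - u n) <= eps / (K + 1).
    apply: le_trans (cau p n) _; rewrite (splitr eps) !mulrDl.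
    apply: ltW; apply: ltrD; exact: le_lt_trans (ler_norm _) _.
  apply: le_lt_trans (ler_wpM2l K0 h) _.
  rewrite mulrCA -[ltRHS]mulr1 ltr_pM2l // ltr_pdivrMr ?ltr_wpDl // mul1r.
  by rewrite ltrDl.
apply: (op_intro (u := u)) => //.
  by apply: (sesqB S) => //; apply: (sesqD S) => //; exact: (sesqZ S).
move=> v g' Cg' vg.
have Dv n : D (v n) by case: vg.
have Cv n := DC (Dv n).
have v_g : (fun n => hnorm (v n - g')) @ \oo --> (0 : R) by case: vg.
have Cxf := sesqZ S x%:C Cf.
have cst h : carrier h -> (fun=> hnorm (h - h)) @ \oo --> (0 : R).
  move=> Ch; rewrite (_ : (fun _ => _) = (fun=> 0 : R)); first exact: cvg_cst.
  by apply: funext => n; exact: heq_refl HX _ Ch.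
rewrite (sesqBl S) ?(sesqDl S) ?(sesqZl S) ?ipP //; last exact: (sesqD S).
(* The Euler equation has error [eta n * snorm b (v n)], so the norms of the test sequence must stay
   bounded. *)
have bnd : exists2 M, 0 <= M & forall n, snorm b (v n) <= M.
  have [Ma Ma0 HMa] := form_cvg_bounded vg.
  have [N HN] := (cvg0_epsP _).1 v_g 1 ltr01.
  pose Mh := \sum_(i < N) hnorm (v i) + (hnorm g' + 1).
  have HMh n : hnorm (v n) <= Mh.
    case: (ltnP n N) => [nN|/HN].
      rewrite /Mh (bigD1 (Ordinal nN)) //= -addrA lerDl !addr_ge0 ?hnorm_ge0 //.
      by rewrite sumr_ge0 // => i _; exact: hnorm_ge0.
    rewrite ger0_norm ?hnorm_ge0 // => h.
    apply: le_trans (snorm_sub_le S (Cv n) Cg') _.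
    apply: (@le_trans _ _ (hnorm g' + 1)); first by rewrite lerD2l ltW.
    by rewrite lerDr sumr_ge0 // => i _; exact: hnorm_ge0.
  have Mh0 : 0 <= Mh := le_trans (hnorm_ge0 _) (HMh 0%N).
  exists (Num.sqrt (Ma ^+ 2 + `|x| * Mh ^+ 2 + \sum_(i < m) (Mh * hnorm (e i)) ^+ 2)).
    exact: sqrtr_ge0.
  move=> n; rewrite ler_wsqrtr // bE //; apply: lerD; last first.
    apply: ler_sum => i _; rewrite ler_pXn2r ?nnegrE ?normc_ge0 ?mulr_ge0 ?hnorm_ge0 //.
    apply: le_trans (sesq_CS S (Cv n) (Ce i)) _.
    exact: ler_wpM2r (hnorm_ge0 _) _ _ (HMh n).
  apply: lerD; first by rewrite -(snorm_sqr aS) // ler_pXn2r ?nnegrE ?sqrtr_ge0.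
  rewrite -(hnorm_sqr HX) // -mulNr.
  apply: (@le_trans _ _ (`|x| * hnorm (v n) ^+ 2)).
    by rewrite ler_wpM2r ?sqr_ge0 // -normrN ler_norm.
  by rewrite ler_wpM2l // ler_pXn2r ?nnegrE ?hnorm_ge0.
have [M M0 HM] := bnd.
have bcv : ccvg (fun n => b (u n) (v n)) (ip g g').
  apply: (@ccvg_close _ (fun n => ip g (v n))).
    apply: (ip_cvg HX (u := fun=> g)) => //; exact: cst.
  apply: cvg0_le (cvg0Ml M eta0) => n; rewrite ger0_norm ?normc_ge0 //.
  rewrite normc_distC; apply: le_trans (eul n _ (Dv n)) _.
  have en0 : 0 <= eta n.
    have := le_trans (sqrtr_ge0 _) (cau n n); lra.
  by rewrite mulrC ler_wpM2r.
have E n : a (u n) (v n) = b (u n) (v n) + x%:C * ip (u n) (v n) -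
    \sum_(i < m) ip (u n) (e i) * ip (e i) (v n).
  by rewrite /b; ring.
rewrite /ccvg; under eq_fun do rewrite E.
apply: ccvgB; first apply: ccvgD => //.
  by apply: ccvgMl; exact: (ip_cvg HX).
apply: ccvg_sum => i; apply: ccvgM.
  by apply: (ip_cvg HX (v := fun=> e i)) => //; exact: cst.
by apply: (ip_cvg HX (u := fun=> e i)) => //; exact: cst.
Qed.

(* With T the inverse of A + P - x, which is self-adjoint, (1 - i y T) is
   inverted through (1 - i y T)(1 + i y T) = 1 + y^2 T^2 >= 1. *)
Lemma solve (w : R[i]) g : re w < c -> carrier g -> exists f, sol w g f.
Proof.
move=> wc Cg; pose x := re w; pose y := im w.
have exT h : exists f, carrier h -> sol x%:C h f.
  have [Ch|nCh] := pselect (carrier h); last by exists 0.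
  by have [f] := solve_real wc Ch; exists f.
have [T TP] := choice exT.
have CT h : carrier h -> carrier (T h) by move=> /TP/sol_carrier.
have d0 : 0 < c - x by rewrite subr_gt0.
have Tb h : carrier h -> hnorm (T h) <= (c - x)^-1 * hnorm h.
  by move=> Ch; rewrite ler_pdivlMl //; exact: (@sol_bound x%:C h _ Ch (TP _ Ch)).
(* [T] is a choice of solutions, hence linear only up to distance zero. *)
have Tlin (k : R[i]) h h' : carrier h -> carrier h' ->
    heq (T (k *: h + h')) (k *: T h + T h').
  move=> Ch Ch'; have CL := sesq_lin S k Ch Ch'.
  exact: (@sol_unique x%:C _ _ _ wc CL (TP _ CL) (sol_lin _ (TP _ Ch) (TP _ Ch'))).
have Tsym h h' : carrier h -> carrier h' -> ip (T h) h' = ip h (T h').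
  move=> Ch Ch'; have CTh := CT _ Ch; have CTh' := CT _ Ch'.
  have := op_sym (TP _ Ch) (TP _ Ch').
  have CxT := sesqZ S x%:C CTh; have CxT' := sesqZ S x%:C CTh'.
  rewrite (sesqBl S) ?(sesqDl S) ?(sesqZl S) ?ipP //; last exact: (sesqD S).
  rewrite (sesqBr S) ?(sesqDr S) ?(sesqZr S) //; last exact: (sesqD S).
  rewrite conjc_real (sesqC S (CP (T h')) CTh) ipP // conjc_sum.
  under [X in _ = _ - X]eq_bigr => i _.
    rewrite conjcM -!(sesqC S) // mulrC; over.
  by move=> H; apply/eqP; rewrite eq_sym -(inj_eq (addIr (x%:C * ip (T h) (T h') -
     \sum_(i < m) ip (T h) (e i) * ip (e i) (T h')))) !addrA; apply/eqP.
(* The form of [1 + y^2 T^2], coercive on the whole space with constant 1. *)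
pose b u v := ip u v + (y ^+ 2)%:C * ip (T u) (T v).
have bS : sesq (@carrier R X) b.
  split; [exact: sesq0 S|exact: sesq_lin S| | |].
  - move=> k f h v Cf Ch Cv; have CL := sesq_lin S k Cf Ch.
    rewrite /b (sesqPl S) // (heq_ip HX _ _ (CT _ Cv) (Tlin k f h Cf Ch)) //;
      [|exact: CT|by apply: (sesq_lin S); exact: CT].
    by rewrite (sesqPl S k (CT _ Cf) (CT _ Ch) (CT _ Cv)) !mulrDr (mulrCA _ k) addrACA.
  - move=> f h Cf Ch; rewrite /b conjcD conjcM conjc_real -(sesqC S Cf Ch).
    by rewrite -(sesqC S (CT _ Cf) (CT _ Ch)).
  - move=> f Cf; rewrite /b re_add re_rmul; apply: addr_ge0.
      exact: sesq_ge0 S _ Cf.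
    by apply: mulr_ge0; [exact: sqr_ge0|exact: sesq_ge0 S _ (CT _ Cf)].
have coer u : carrier u -> 1 * re (ip u u) <= re (b u u).
  move=> Cu; rewrite mul1r /b re_add re_rmul lerDl; apply: mulr_ge0.
    exact: sqr_ge0.
  exact: sesq_ge0 S _ (CT _ Cu).
have [k [u [eta [Ck Cu uk eta0 [_ eul]]]]] := riesz HX (@subset_refl _ _) bS ltr01 coer Cg.
have CTk := CT _ Ck; have CTTk := CT _ CTk.
have Tuk : (fun n => hnorm (T (u n) - T k)) @ \oo --> (0 : R).
  apply: cvg0_le (cvg0Ml (c - x)^-1 uk) => n; rewrite ger0_norm ?hnorm_ge0 //.
  rewrite ler_pdivlMl //.
  have := sol_lin (-1) (TP _ Ck) (TP _ (Cu n)).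
  rewrite !scaleN1r ![- _ + _]addrC.
  exact: (@sol_bound x%:C _ _ (sesqB S (Cu n) Ck)).
have Ckk : carrier (k + (y ^+ 2)%:C *: T (T k)) by apply: (sesqD S) => //; exact: (sesqZ S).
have kk : heq (k + (y ^+ 2)%:C *: T (T k)) g.
  apply: (heq_of_ip HX) => // v Cv; have CTv := CT _ Cv.
  rewrite (sesqDl S) ?(sesqZl S) ?(Tsym _ _ CTk Cv) //; last exact: (sesqZ S).
  have cst h : carrier h -> (fun=> hnorm (h - h)) @ \oo --> (0 : R).
    move=> Ch; rewrite (_ : (fun _ => _) = (fun=> 0 : R)); first exact: cvg_cst.
    by apply: funext => n; exact: heq_refl HX _ Ch.
  have l1 : ccvg (fun n => b (u n) v) (ip k v + (y ^+ 2)%:C * ip (T k) (T v)).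
    apply: ccvgD; first by apply: (ip_cvg HX (v := fun=> v)) => //; exact: cst.
    apply: ccvgMl; apply: (ip_cvg HX (u := T \o u) (v := fun=> T v)) => //.
      by move=> n; exact: CT.
    exact: cst.
  apply: (ccvg_unique l1).
  apply: cvg0_le (cvg0Ml (snorm b v) eta0) => n; rewrite ger0_norm ?normc_ge0 //.
  by rewrite mulrC; exact: eul.
(* With [(1 + y^2 T^2) k = g] and [p = (1 + i y T) k], the vector [T p] satisfies
   [(A + P - x) T p = p], and [p - i y T p = (1 - i y T) (1 + i y T) k = g]. As [w = x + i y], it
   solves the equation for [w]. *)
pose z : R[i] := 'i * y%:C.
pose p := z *: T k + k.
have Cp : carrier p := sesq_lin S z CTk Ck.
have CTp := CT _ Cp.
have Tp : heq (T p) (z *: T (T k) + T k) := Tlin z _ _ CTk Ck.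
exists (T p); have s := TP _ Cp.
apply: (op_heq s) => //.
- by apply: (sesqB S) => //; apply: (sesqD S) => //; exact: (sesqZ S).
- exact: heq_refl HX _ CTp.
have CxT := sesqZ S x%:C CTp; have CwT := sesqZ S w CTp.
have Cg1 := sesqD S Cp CxT; have Cg2 := sesqD S Cg CwT; have CPT := CP (T p).
apply: (heq_of_ip HX) => [||v Cv]; [exact: (sesqB S)|exact: (sesqB S)|].
rewrite (sesqBl S Cg1 CPT Cv) (sesqBl S Cg2 CPT Cv) (sesqDl S Cp CxT Cv).
rewrite (sesqDl S Cg CwT Cv) (sesqZl S _ CTp Cv) (sesqZl S _ CTp Cv).
congr (_ - _).
have wE : w = x%:C + z by rewrite /z /x /y; case: (w) => r t; simpc.
rewrite wE mulrDl [RHS]addrCA [LHS]addrC; congr (_ + _).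
rewrite (heq_ip HX CTp _ Cv Tp); last exact: (sesq_lin S).
rewrite /p (sesqPl S _ CTk Ck Cv) (sesqPl S _ CTTk CTk Cv).
rewrite -(heq_ip HX Ckk Cg Cv kk) (sesqDl S Ck (sesqZ S _ CTTk) Cv).
rewrite (sesqZl S _ CTTk Cv).
have zz : z * z = - (y ^+ 2)%:C by rewrite /z; simpc; rewrite expr2.
by rewrite mulrDr mulrA zz mulNr [RHS]addrA addrK addrC.
Qed.

Let phi f : 'rV[R[i]]_m := \row_j ip f (e j).

Let phi_lin (k : R[i]) f g : carrier f -> carrier g -> phi (k *: f + g) = k *: phi f + phi g.
Proof. by move=> Cf Cg; apply/rowP => j; rewrite !mxE (sesqPl S). Qed.

Let phi_sum n (k : 'I_n -> R[i]) (F : 'I_n -> vec X) : (forall i, carrier (F i)) ->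
  phi (\sum_i k i *: F i) = \sum_i k i *: phi (F i).
Proof.
move=> CF; apply/rowP => j; rewrite mxE summxE (sesq_suml S) //.
  by apply: eq_bigr => i _; rewrite !mxE (sesqZl S).
by move=> i; exact: (sesqZ S).
Qed.

Let phi_heq f g : carrier f -> carrier g -> heq f g -> phi f = phi g.
Proof. by move=> Cf Cg fg; apply/rowP => j; rewrite !mxE (heq_ip HX Cf Cg (Ce j) fg). Qed.

Let sol_sum w n (k : 'I_n -> R[i]) (G F : 'I_n -> vec X) g f :
  (forall i, sol w (G i) (F i)) -> sol w g f ->
  sol w (\sum_i k i *: G i + g) (\sum_i k i *: F i + f).
Proof.
move=> sF s; elim: n k G F sF => [|n IH] k G F sF; first by rewrite !big_ord0 !add0r.
rewrite !big_ord_recl -!addrA; apply: sol_lin => //.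
by apply: (IH (fun i => k (lift ord0 i))) => i.
Qed.

(* An eigenvector annihilated by every functional [ip _ (e i)] violates the
   lower bound, and the resolvent equation reduces to an m x m linear system. *)
Lemma resolvent_or_eigenvalue (w : R[i]) : re w < c -> ~ resolvent_set A w ->
  exists f, A f (w *: f) /\ ~ heq f 0.
Proof.
move=> wc nres; apply: contrapT => noeig; apply: nres.
have exT h : exists f, carrier h -> sol w h f.
  have [Ch|nCh] := pselect (carrier h); last by exists 0.
  by have [f] := solve wc Ch; exists f.
have [T TP] := choice exT.
have CT h : carrier h -> carrier (T h) by move=> /TP/sol_carrier.
(* [(A - w) f = g] means [f = T (g + P f)], that is, [T g] plus the combination of the [T (e i)]
   with coefficients [phi f]. Applying [phi] gives the linear system [phi f (1 - K) = phi (T g)]. *)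
pose K : 'M[R[i]]_m := \matrix_i phi (T (e i)).
have KE (al : 'rV_m) : al *m K = phi (\sum_i al 0 i *: T (e i)).
  rewrite phi_sum => [|i]; last exact: CT.
  by rewrite mulmx_sum_row; apply: eq_bigr => i _; rewrite rowK.
have solE g f (al : 'rV_m) : phi f = al -> sol w (\sum_i al 0 i *: e i + g) f ->
    A f (g + w *: f).
  move=> phif; rewrite /sol (_ : P f = \sum_i al 0 i *: e i); last first.
    by apply: eq_bigr => i _; rewrite -phif mxE.
  by rewrite addrC !addrA addNr add0r.
have C0 := sesq0 S; have D0 := sesq0 aS.
have sol00 : sol w 0 0.
  have [f s] := solve wc C0; have Cf := sol_carrier s.
  have /= := sol_lin (-1) s s; by rewrite !scaleN1r !addNr.
have [Ku|nKu] := boolP (1%:M - K \in unitmx); last first.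
  (* A vector with [al = al K] gives the eigenvector [\sum_i al_i T (e i)], which is nonzero because
     its image under [phi] is [al]. *)
  exfalso; have /det0P[al al0] : \det (1%:M - K) == 0.
    by move: nKu; rewrite unitmxE unitfE negbK.
  rewrite mulmxBr mulmx1 KE => /eqP; rewrite subr_eq0 => /eqP alE.
  pose f := \sum_i al 0 i *: T (e i); have Cf : carrier f.
    by apply: (sesq_sum S) => i; apply: (sesqZ S); exact: CT.
  apply: noeig; exists f; split.
    have := sol_sum (al 0) (fun i => TP _ (Ce i)) sol00.
    rewrite !addr0 => s; have := @solE 0 f al (esym alE); rewrite add0r addr0.
    exact.
  move=> f0; move/eqP: al0; apply; rewrite alE (phi_heq Cf C0 f0).
  by apply/rowP => j; rewrite !mxE (sesq0l S).
split=> [g Cg|].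
  pose al := phi (T g) *m invmx (1%:M - K).
  pose f := \sum_i al 0 i *: T (e i) + T g.
  have CTg := CT _ Cg.
  have Cs : carrier (\sum_i al 0 i *: T (e i)).
    by apply: (sesq_sum S) => i; apply: (sesqZ S); exact: CT.
  have phif : phi f = al.
    rewrite /f -[X in phi (X + _)]scale1r phi_lin // scale1r -KE.
    have : al *m (1%:M - K) = phi (T g) by rewrite mulmxKV.
    by rewrite mulmxBr mulmx1 => <-; rewrite addrC subrK.
  exists f, (g + w *: f); split; last first.
    by rewrite addrK; exact: heq_refl.
  by apply: (solE _ _ al) => //; exact: (sol_sum _ (fun i => TP _ (Ce i)) (TP _ Cg)).
(* Every solution has [phi f = phi (T g) Q]; bounding each entry by a multiple of [hnorm (T g)]
   leads to the constant [C0']. *)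
pose Q := invmx (1%:M - K).
pose C0' := 1 + \sum_i (\sum_j hnorm (e j) * normc (Q j i)) * hnorm (T (e i)).
exists (C0' * (c - re w)^-1) => f h Afh.
have [Cf Ch] := op_carrier Afh.
pose g := h - w *: f; have Cg : carrier g by apply: (sesqB S) => //; exact: (sesqZ S).
have CTg := CT _ Cg.
pose al := phi f; pose f' := \sum_i al 0 i *: T (e i) + T g.
have Cs : carrier (\sum_i al 0 i *: T (e i)).
  by apply: (sesq_sum S) => i; apply: (sesqZ S); exact: CT.
have Cg' : carrier (\sum_i al 0 i *: e i + g).
  by apply: (sesqD S) => //; apply: (sesq_sum S) => i; exact: (sesqZ S).
have sf : sol w (\sum_i al 0 i *: e i + g) f.
  rewrite /sol (_ : P f = \sum_i al 0 i *: e i); last first.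
    by apply: eq_bigr => i _; rewrite mxE.
  by rewrite addrC addrA addrA addNr add0r /g subrK.
have ff' : heq f f'.
  by apply: (sol_unique wc Cg' sf); exact: (sol_sum _ (fun i => TP _ (Ce i)) (TP _ Cg)).
have alE : al = phi (T g) *m Q.
  have : al *m (1%:M - K) = phi (T g).
    rewrite mulmxBr mulmx1 KE {1}/al (phi_heq Cf _ ff'); last exact: (sesqD S).
    by rewrite /f' -[X in phi (X + _)]scale1r phi_lin // scale1r addrAC subrr add0r.
  by move=> <-; rewrite mulmxK.
have d0 : 0 < c - re w by rewrite subr_gt0.
have Tg : hnorm (T g) <= (c - re w)^-1 * hnorm g.
  by rewrite ler_pdivlMl //; exact: sol_bound (TP _ Cg).
have alb i : normc (al 0 i) <= hnorm (T g) * \sum_j hnorm (e j) * normc (Q j i).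
  rewrite alE mxE mulr_sumr; elim/big_ind2: _ => [|x1 x2 y1 y2 h1 h2|j _].
  - by rewrite ComplexField.Normc.normc0.
  - exact: le_trans (le_normc_add _ _) (lerD h1 h2).
  - rewrite mxE normcM mulrA ler_wpM2r ?normc_ge0 //; exact: (sesq_CS S).
have fT : hnorm f <= C0' * hnorm (T g).
  have Cf' : carrier f' by apply: (sesqD S).
  apply: le_trans (snorm_sub_le S Cf Cf') _; rewrite [X in _ + X]ff' addr0.
  apply: le_trans (snorm_add S Cs CTg) _; rewrite addrC mulrDl mul1r lerD2l.
  rewrite mulr_suml; have : forall n (F : 'I_n -> vec X), (forall i, carrier (F i)) ->
      snorm (@ip R X) (\sum_i F i) <= \sum_i hnorm (F i).
    move=> n F CF; elim: n F CF => [|n IH] F CF.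
      by rewrite !big_ord0 /snorm (sesq0l S) ?sqrtr0.
    rewrite !big_ord_recl; apply: le_trans (snorm_add S _ _) _ => //.
      by apply: (sesq_sum S).
    by rewrite lerD2l; apply: IH.
  move=> tri; apply: le_trans (tri _ _ _) _ => [i|]; first by apply: (sesqZ S); exact: CT.
  apply: ler_sum => i _; rewrite /hnorm -/(snorm _ _) (snormZ S); last exact: CT.
  by rewrite mulrAC ler_wpM2r ?hnorm_ge0 // mulrC.
apply: le_trans fT _; rewrite -mulrA ler_wpM2l // /C0' addr_ge0 // sumr_ge0 // => i _.
rewrite mulr_ge0 ?hnorm_ge0 // sumr_ge0 // => j _.
by rewrite mulr_ge0 ?hnorm_ge0 ?normc_ge0.
Qed.

(** Isolation of a point of the spectrum is demanded among complex points, so non-real eigenvalues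
    have to be excluded too. *)
Lemma eigenvalue_real (w : R[i]) f : A f (w *: f) -> ~ heq f 0 -> im w = 0.
Proof.
move=> Af nz; have [Cf _] := op_carrier Af.
have := op_sym Af Af; rewrite (sesqZl S) // (sesqZr S) //.
move=> /(congr1 (@complex.Im R)); rewrite !im_mul (sesq_im S) // !mulr0 !add0r.
have n0 : re (ip f f) != 0.
  apply/eqP => h; apply: nz; rewrite /heq subr0 /hnorm h sqrtr0 //.
rewrite im_conj => h.
have : im w * re (ip f f) * 2 = 0 by lra.
by move=> /eqP; rewrite !mulf_eq0 (negPf n0) pnatr_eq0 !orbF => /eqP.
Qed.

Lemma op_eigenspaceE (w : R[i]) f : op_eigenspace A w f <-> A f (w *: f).
Proof.
split=> [[h Afh hw]|Af]; last first.
  by exists (w *: f) => //; apply: heq_refl => //; have [] := op_carrier Af.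
have [Cf Ch] := op_carrier Afh; apply: (op_heq Afh) => //; first exact: (sesqZ S).
exact: heq_refl.
Qed.

Lemma op_zero : A 0 0.
Proof.
have D0 := sesq0 aS; have C0 := sesq0 S.
apply: (op_intro C0 C0 (op_cst D0)) => v g Cg [Dv _ _].
rewrite (sesq0l S) // /ccvg.
rewrite (_ : (fun _ => _) = (fun=> 0 : R)); first exact: cvg_cst.
by apply: funext => n; rewrite (sesq0l aS) // subrr ComplexField.Normc.normc0.
Qed.

(* Test vectors killed by all functionals see the form above level c. *)
Lemma eigensum_null n (lam : 'I_n -> R) (F : 'I_n -> vec X) :
  injective lam -> (forall i, lam i < c) -> (forall i, A (F i) ((lam i)%:C *: F i)) ->
  phi (\sum_i F i) = 0 -> forall i, heq (F i) 0.
Proof.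
move=> linj lc AF phi0.
have CF i : carrier (F i) by have [] := op_carrier (AF i).
have orth i j : i != j -> ip (F i) (F j) = 0.
  move=> ij; have := op_sym (AF i) (AF j); rewrite (sesqZl S) // (sesqZr S) // conjc_real.
  move=> /eqP; rewrite -subr_eq0 -mulrBl -rmorphB mulf_eq0 => /orP[|/eqP //].
  move=> /eqP/complexI/eqP; rewrite subr_eq0 => /eqP/linj h; by rewrite h eqxx in ij.
pose f := \sum_i F i; pose h := \sum_i (lam i)%:C *: F i.
have Afh : A f h.
  rewrite /f /h; clear phi0 orth linj lc.
  elim: n lam F AF CF {f h} => [|n IH] lam F AF CF; first by rewrite !big_ord0; exact: op_zero.
  rewrite !big_ord_recl -[X in A (X + _)]scale1r -[X in A _ (X + _)]scale1r.
  by apply: op_lin => //; apply: (IH (fun i => lam (lift ord0 i))) => i.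
have Cf : carrier f by apply: (sesq_sum S).
have ipf (k : 'I_n -> R[i]) : ip (\sum_i k i *: F i) f = \sum_i k i * (hnorm (F i) ^+ 2)%:C.
  rewrite (sesq_suml S) // => [|i]; last exact: (sesqZ S).
  apply: eq_bigr => i _; rewrite (sesqZl S) //; congr (_ * _).
  rewrite (sesqC S Cf (CF i)) (sesq_suml S) // (bigD1 i) //= big1 ?addr0.
    by rewrite -(sesqC S) // (sesq_real S) // (hnorm_sqr HX).
  by move=> j ji; exact: orth.
(* The functionals vanish on [f], and by orthogonality the energy bound becomes
   [\sum_i (c - lam i) |F i|^2 <= 0] with positive coefficients. *)
have := op_energy Afh Ce ge_c.
have -> : \sum_(i < m) normc (ip f (e i)) ^+ 2 = 0.
  apply: big1 => i _; have := congr1 (fun M : 'rV_m => M 0 i) phi0; rewrite !mxE => ->.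
  by rewrite ComplexField.Normc.normc0 expr0n.
rewrite addr0 /h ipf.
have -> : ip f f = \sum_i 1 * (hnorm (F i) ^+ 2)%:C.
  by rewrite -ipf; congr (ip _ _); apply: eq_bigr => i _; rewrite scale1r.
rewrite !re_sum; under eq_bigr do rewrite mul1r /=.
under [X in _ <= X]eq_bigr do rewrite re_rmul /=.
rewrite mulr_sumr -subr_ge0 -sumrB => ge0 i.
have : \sum_i (c - lam i) * hnorm (F i) ^+ 2 = 0.
  apply/eqP; rewrite eq_le; apply/andP; split.
    rewrite -oppr_ge0 -sumrN; apply: le_trans ge0 _; apply: ler_sum => j _.
    by rewrite mulrBl opprB.
  by apply: sumr_ge0 => j _; rewrite mulr_ge0 ?sqr_ge0 // subr_ge0 ltW.
move=> /eqP; rewrite psumr_eq0 => [/allP/(_ i)|j _]; last first.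
  by rewrite mulr_ge0 ?sqr_ge0 // subr_ge0 ltW.
rewrite mem_index_enum => /(_ isT); rewrite mulf_eq0 subr_eq0 gt_eqF //= sqrf_eq0.
by rewrite /heq subr0 => /eqP.
Qed.

Let eigs : set R := [set x | x < c /\ exists f, A f (x%:C *: f) /\ ~ heq f 0].

(** [m + 1] eigenvectors have linearly dependent images under [phi]; [eigensum_null] makes every
    term of the vanishing combination null, although some coefficient is nonzero. *)
Lemma finite_eigs : finite_set eigs.
Proof.
apply: contrapT => /(@infinite_set_fset _ _ m.+1)[B BE Bm].
pose s := take m.+1 (finmap.enum_fset B).
have ss : size s = m.+1 by rewrite size_takel.
have us : uniq s by rewrite take_uniq // finmap.fset_uniq.
have sE (i : 'I_m.+1) : eigs (nth 0 s i).
  by apply: BE => /=; apply: (@mem_take m.+1); rewrite mem_nth // ss.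
have /choice[F FP] : forall i : 'I_m.+1, exists f, A f ((nth 0 s i)%:C *: f) /\ ~ heq f 0.
  by move=> i; have [_ []] := sE i => f; exists f.
have CF i : carrier (F i) by have [] := op_carrier (FP i).1.
pose M : 'M[R[i]]_(m.+1, m) := \matrix_i phi (F i).
have /rowV0Pn[k /sub_kermxP kM k0] : kermx M != 0.
  rewrite kermx_eq0 /row_free; apply/eqP => h.
  by have := rank_leq_col M; rewrite h ltnn.
have AkF i : A (k 0 i *: F i) ((nth 0 s i)%:C *: (k 0 i *: F i)).
  have := op_lin (k 0 i) (FP i).1 op_zero; rewrite !addr0 scalerA mulrC -scalerA //.
have := @eigensum_null _ (fun i => nth 0 s i) (fun i => k 0 i *: F i) _ _ AkF.
move=> H; move/eqP: k0; apply; apply/rowP => i; rewrite mxE.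
have : heq (k 0 i *: F i) 0.
  apply: H => [p q /eqP|p|].
  - by rewrite nth_uniq ?ss // => /eqP/val_inj.
  - by have [] := sE p.
  - rewrite phi_sum // -[RHS]kM mulmx_sum_row.
    by apply: eq_bigr => j _; rewrite rowK.
rewrite /heq subr0 -/(snorm _ _) /hnorm -/(snorm (@ip R X) _) (snormZ S) // => /eqP.
rewrite mulf_eq0 => /orP[/eqP/ComplexField.Normc.eq0_normc //|/eqP h].
by case: (FP i) => _; case; rewrite /heq subr0.
Qed.

(** On one eigenspace [phi] is injective up to distance zero, by [eigensum_null] for a single
    vector. A family of eigenvectors whose images are free and whose length is maximal therefore
    spans. *)
Lemma finite_dimensional_eigenspace (x : R) : x < c ->
  finite_dimensional (op_eigenspace A x%:C).
Proof.
move=> xc; pose E := op_eigenspace A x%:C.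
have EA f : E f <-> A f (x%:C *: f) := op_eigenspaceE x%:C f.
have CE f : E f -> carrier f by move=> /EA/op_carrier[].
have Elin (k : R[i]) f g : E f -> E g -> E (k *: f + g).
  move=> /EA Af /EA Ag; apply/EA; have := op_lin k Af Ag.
  by rewrite scalerDr !scalerA (mulrC x%:C).
have E0 : E 0 by apply/EA; rewrite scaler0; exact: op_zero.
pose Pn n := `[< exists b : n.-tuple (vec X), (forall i, E (tnth b i)) /\
   free (map phi b) >].
have ex : exists n, Pn n.
  by exists 0%N; apply/asboolP; exists [tuple]; split; [case|rewrite nil_free].
have bd n : Pn n -> (n <= m)%N.
  move=> /asboolP[b [_]]; rewrite /free => /eqP; rewrite size_map size_tuple => <-.
  by apply: leq_trans (dimvS (subvf _)) _; rewrite dimvf dim_matrix ?mul1n ?mul1r.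
have [n /asboolP[b [bE bfree]] nmax] := ex_maxnP ex bd.
exists n, (tnth b); split => // f Ef.
have Cb i := CE _ (bE i); have Cf := CE _ Ef.
have fin : phi f \in <<map phi b>>%VS.
  apply/negPn/negP => nin; have : Pn n.+1.
    apply/asboolP; exists [tuple of f :: b]; split.
      by move=> i; case: (unliftP ord0 i) => [j ->|->]; rewrite ?tnthS ?tnth0.
    by rewrite /= free_cons nin bfree.
  by move=> /nmax; rewrite ltnn.
pose mb := map_tuple phi b.
pose k i := coord mb i (phi f).
exists k.
have phik : phi f = \sum_i k i *: phi (tnth b i).
  rewrite [LHS](@coord_span _ _ _ mb) //; apply: eq_bigr => i _.
  by rewrite -tnth_nth tnth_map.
have Cs : carrier (\sum_i k i *: tnth b i).
  by apply: (sesq_sum S) => i; exact: (sesqZ S).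
have Es : E (\sum_i k i *: tnth b i).
  elim/big_ind: _ => // [f1 f2 E1 E2|i _]; first by rewrite -[f1]scale1r; exact: Elin.
  by rewrite -[_ *: _]addr0; exact: Elin.
pose g := f - \sum_i k i *: tnth b i.
have Eg : E g by rewrite /g addrC -scaleN1r; exact: Elin.
have := @eigensum_null 1 (fun=> x) (fun=> g) _ _ _ _ ord0.
rewrite /heq subr0; apply => //.
- by move=> p q _; rewrite !ord1.
- by move=> _; apply/EA.
- rewrite big_ord1 /g addrC -scaleN1r phi_lin // phi_sum //.
  by rewrite phik scaleN1r addNr.
Qed.

Lemma spectrum_below_discrete (x : R) : x < c -> ~ essential_spectrum A x%:C.
Proof.
move=> xc [xspec]; apply.
have specE (w : R[i]) : re w < c -> spectrum A w -> exists2 y, eigs y & w = y%:C.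
  move=> wc /(resolvent_or_eigenvalue wc)[f [Af nz]].
  have wr : w = (re w)%:C by apply: complexP => //=; exact: eigenvalue_real Af nz.
  by exists (re w) => //; split => //; exists f; rewrite -wr.
have [y [yc [f [Af nz]]] /complexI xy] := specE x%:C xc xspec; subst y.
split.
- by exists f => //; apply/op_eigenspaceE.
- exact: finite_dimensional_eigenspace.
have [e1 e10 He1] : exists2 e1 : R, 0 < e1 & forall y, eigs y -> `|y - x| < e1 -> y = x.
  have /finite_seqP[s sE] := finite_eigs; rewrite sE.
  elim: s {sE} => [|z s [e1 e10 IH]]; first by exists 1.
  have [->|zx] := eqVneq z x.
    by exists e1 => // y; rewrite /= inE => /orP[/eqP -> //|ys]; exact: IH.
  exists (Num.min e1 `|z - x|); first by rewrite lt_min e10 normr_gt0 subr_eq0.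
  move=> y; rewrite /= inE lt_min => /orP[/eqP ->|ys /andP[h _]].
    by rewrite ltxx andbF.
  exact: IH.
(* The radius [c - x] keeps [re w < c], where the spectrum consists of finitely many eigenvalues. *)
exists (Num.min e1 (c - x)); first by rewrite lt_min e10 subr_gt0.
move=> w wspec; rewrite lt_min => /andP[h1 h2].
have wc : re w < c.
  have := le_lt_trans (abs_re_le _) h2; rewrite re_add re_opp /= ltr_norml; lra.
have [y ye wy] := specE w wc wspec; rewrite wy; congr _%:C; apply: He1 => //.
by move: h1; rewrite wy -rmorphB normc_real.
Qed.

Lemma lambda0_ess_ge : (c%:E <= lambda0_ess A)%E.
Proof.
apply: le_ereal_inf_tmp => _ [x /= xess <-]; rewrite lee_fin leNgt; apply/negP => xc.
exact: spectrum_below_discrete xc xess.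
Qed.

End Perturbed.

(** * The bottom of the spectrum and Weyl's criterion *)

Lemma lambda0_ge (c : R) :
  (forall u, D u -> c * re (ip u u) <= re (a u u)) -> (c%:E <= lambda0 A)%E.
Proof.
(* The case of no functionals: spectrum below [c] would consist of eigenvalues, whose eigenvectors
   violate the bound. *)
move=> ge; pose e (i : 'I_0) : vec X := 0.
have Ce i : carrier (e i) := sesq0 S.
have ge' u : D u -> c * re (ip u u) <=
    re (a u u) + \sum_(i < 0) normc (ip u (e i)) ^+ 2.
  by move=> Du; rewrite big_ord0 addr0; exact: ge.
apply: le_ereal_inf_tmp => _ [x /= xspec <-]; rewrite lee_fin leNgt; apply/negP => xc.
have [f [Af nz]] := @resolvent_or_eigenvalue c _ e Ce ge' x%:C xc xspec.
have [Cf _] := op_carrier Af.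
have := op_energy Af Ce ge'; rewrite big_ord0 addr0 (sesqZl S) // re_rmul.
rewrite -(hnorm_sqr HX) // -subr_le0 -mulrBl pmulr_rle0 ?subr_gt0 // => h.
apply: nz; rewrite /heq subr0; apply/eqP; rewrite -sqrf_eq0 eq_le h.
exact: sqr_ge0.
Qed.

Lemma ccvg_ip_self (u : nat -> vec X) f : carrier f -> form_cvg D a u f ->
  ccvg (fun n => ip (u n) (u n)) (ip f f).
Proof. by move=> Cf [Du uf _]; apply: (ip_cvg HX) => // n; exact: DC. Qed.

(* Testing against the solution of (A - l) f = u shows that approximate
   eigenvectors in the weak sense of the form prevent l from being resolvent. *)
Lemma weyl (l : R) : (forall eps : R, 0 < eps -> exists u, [/\ D u, 0 < hnorm u &
    forall v, D v -> re (a u v - l%:C * ip u v) <=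
      eps * hnorm u * Num.sqrt (re (a v v) + re (ip v v))]) ->
  spectrum A l%:C.
Proof.
move=> H [sur [C0 bnd]].
pose C := `|C0|.
(* For the solution of [(A - l) f = u] one has [|f| <= C |u|] and [A f = u + l f], so [M |u|^2]
   bounds its energy plus its squared norm. The tolerance below is chosen so that the test gives at
   most [|u|^2 / 2], whereas the tested values tend to [|u|^2]. *)
pose M := C + (`|l| + 1) * C ^+ 2.
have C_0 : 0 <= C by exact: normr_ge0.
have M0 : 0 <= M.
  by apply: addr_ge0 => //; apply: mulr_ge0; [exact: addr_ge0|exact: sqr_ge0].
have K0 : 0 < Num.sqrt (M + 1) by rewrite sqrtr_gt0 ltr_wpDl.
have eps0 : 0 < (2 * Num.sqrt (M + 1))^-1 by rewrite invr_gt0 mulr_gt0.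
have [u [Du up test]] := H _ eps0; have Cu := DC Du.
have [f [h [Afh fh]]] := sur u Cu; have [Cf Ch] := op_carrier Afh.
have Clf := sesqZ S l%:C Cf; have CB := sesqB S Ch Clf.
have fu : hnorm f <= C * hnorm u.
  apply: le_trans (bnd _ _ Afh) _.
  apply: (@le_trans _ _ (C * hnorm (h - l%:C *: f))).
    by rewrite ler_wpM2r ?hnorm_ge0 // ler_norm.
  rewrite ler_wpM2l //; apply: le_trans (snorm_sub_le S CB Cu) _.
  by rewrite [X in _ + X]fh addr0.
have [v vf] := op_seq Afh; have Dv n : D (v n) by case: vf.
have Cv n := DC (Dv n).
have v_f : (fun n => hnorm (v n - f)) @ \oo --> (0 : R) by case: vf.
have l1 : ccvg (fun n => a (v n) u - l%:C * ip (v n) u) (ip u u).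
  rewrite -[X in ccvg _ X](heq_ip HX CB Cu Cu fh) (sesqBl S) // (sesqZl S) //.
  apply: ccvgB; first exact: (opE Afh Cu vf (op_cst Du)).
  apply: ccvgMl; apply: (ip_cvg HX (v := fun=> u)) => //.
  rewrite (_ : (fun _ => _) = (fun=> 0 : R)); first exact: cvg_cst.
  by apply: funext => n; exact: heq_refl HX _ Cu.
have l2 : ccvg (fun n => a (v n) (v n) + ip (v n) (v n)) (ip h f + ip f f).
  by apply: ccvgD; [exact: (opE Afh Cf vf vf)|exact: ccvg_ip_self].
have u2 : 0 < hnorm u ^+ 2 by rewrite exprn_gt0.
have q1 : re (ip h f + ip f f) <= M * hnorm u ^+ 2.
  have -> : ip h f = ip u f + l%:C * ip f f.
    by rewrite -(heq_ip HX CB Cu Cf fh) (sesqBl S) // (sesqZl S) // subrK.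
  rewrite !re_add re_rmul -(hnorm_sqr HX Cf).
  have h1 : re (ip u f) <= C * hnorm u ^+ 2.
    apply: le_trans (ler_norm _) _; apply: le_trans (abs_re_le _) _.
    apply: le_trans (sesq_CS S Cu Cf) _.
    rewrite expr2 mulrA [leRHS]mulrC; exact: ler_wpM2l (hnorm_ge0 _) _ _ fu.
  have h2 : hnorm f ^+ 2 <= C ^+ 2 * hnorm u ^+ 2.
    by rewrite -exprMn ler_pXn2r ?nnegrE ?mulr_ge0 ?hnorm_ge0.
  have h3 : l * hnorm f ^+ 2 + hnorm f ^+ 2 <= (`|l| + 1) * (C ^+ 2 * hnorm u ^+ 2).
    apply: (@le_trans _ _ ((`|l| + 1) * hnorm f ^+ 2)).
      by rewrite mulrDl mul1r lerD2r ler_wpM2r ?sqr_ge0 ?ler_norm.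
    by rewrite ler_wpM2l // addr_ge0.
  by rewrite -addrA mulrDl -mulrA lerD.
have q2 : re (ip h f + ip f f) < (M + 1) * hnorm u ^+ 2.
  by apply: le_lt_trans q1 _; rewrite ltr_pM2r // ltrDl.
have /cvg0_epsP/(_ ((M + 1) * hnorm u ^+ 2 - re (ip h f + ip f f))) := l2.
rewrite subr_gt0 => /(_ q2)[N2 HN2].
have /cvg0_epsP/(_ (hnorm u ^+ 2 / 4) (divr_gt0 u2 (ltr0n _ 4)))[N1 HN1] := l1.
pose n := maxn N1 N2.
have reB (z w : R[i]) : re (z - w) = re z - re w by rewrite re_add re_opp.
have := HN1 n (leq_maxl _ _); have := HN2 n (leq_maxr _ _).
rewrite !ger0_norm ?normc_ge0 //.
move=> /(le_lt_trans (abs_re_le _)) /(le_lt_trans (ler_norm _)); rewrite reB => b2.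
rewrite normc_distC.
move=> /(le_lt_trans (abs_re_le _)) /(le_lt_trans (ler_norm _)); rewrite reB => b1.
have := test _ (Dv n).
have -> : re (a u (v n) - l%:C * ip u (v n)) = re (a (v n) u - l%:C * ip (v n) u).
  rewrite (sesqC aS (Dv n) Du) (sesqC S (Cv n) Cu) !re_add !re_opp !re_rmul.
  by rewrite !re_conj.
rewrite -re_add => b3.
have b4 : Num.sqrt (re (a (v n) (v n) + ip (v n) (v n))) <= Num.sqrt (M + 1) * hnorm u.
  rewrite -[X in _ * X](ger0_norm (hnorm_ge0 _)) -sqrtr_sqr -sqrtrM; last first.
    by rewrite addr_ge0.
  rewrite ler_wsqrtr //; move: b2; lra.
have b5 : re (a (v n) u - l%:C * ip (v n) u) <= hnorm u ^+ 2 / 2.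
  apply: le_trans b3 _; apply: le_trans (ler_wpM2l _ b4) _.
    by rewrite mulr_ge0 ?hnorm_ge0 // ltW.
  rewrite le_eqVlt; apply/orP; left; apply/eqP; field; exact: lt0r_neq0.
move: b1 b5; rewrite -(hnorm_sqr HX Cu); move: u2; set q := _ ^+ 2; set p := re _.
by move=> *; lra.
Qed.

(** The infimum [m] of the Rayleigh quotient over [D] lies in the spectrum: Cauchy-Schwarz for the
    nonnegative form [a - m ip] turns almost-minimizers into the approximate eigenvectors of
    [weyl]. *)
Lemma lambda0_le (c : R) u : D u -> 0 < hnorm u ->
  re (a u u) <= c * re (ip u u) -> (lambda0 A <= c%:E)%E.
Proof.
move=> Du up ac.
pose E := [set re (a v v) / re (ip v v) | v in [set v | D v /\ 0 < hnorm v]].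
have ipp v : D v -> 0 < hnorm v -> 0 < re (ip v v).
  by move=> Dv vp; rewrite -(hnorm_sqr HX (DC Dv)) exprn_gt0.
have lbE : lbound E 0.
  move=> _ [v [Dv vp] <-]; apply: divr_ge0; first exact: sesq_ge0 aS _ Dv.
  exact: ltW (ipp _ Dv vp).
have hiE : has_inf E.
  by split; [exists (re (a u u) / re (ip u u)), u|exists 0].
pose m := inf E.
have m0 : 0 <= m by apply: lb_le_inf => //; exact: hiE.1.
have mge v : D v -> m * re (ip v v) <= re (a v v).
  move=> Dv; have [v0|vn0] := eqVneq (hnorm v) 0.
    rewrite -(hnorm_sqr HX (DC Dv)) v0 expr0n mulr0; exact: sesq_ge0 aS _ Dv.
  have vp : 0 < hnorm v by rewrite lt_def vn0 hnorm_ge0.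
  rewrite -ler_pdivlMr ?ipp //; apply: ge_inf; first exact: hiE.2.
  by exists v.
have mspec : spectrum A m%:C.
  apply: weyl => eps e0.
  have [_ [v [Dv vp] <-] vlt] := inf_adherent (exprn_gt0 2 e0) hiE.
  exists v; split => // w Dw.
  pose e (i : 'I_0) : vec X := 0.
  have Ce i : carrier (e i) := sesq0 S.
  have bS := @sesq_perturb _ _ D (@carrier R X) a (@ip R X) m 0 e aS DC S Ce.
  have {}bS := bS (fun v Dv => le_trans (mge v Dv) (eq_ind_r (fun x => re (a v v) <= re (a v v) + x) (eq_ind_r (fun x => re (a v v) <= x) (lexx _) (addr0 _)) (big_ord0 _ _ _ _))).
  have := sesq_CS bS Dv Dw; rewrite /snorm !big_ord0 !addr0 => cs.
  apply: le_trans (ler_norm _) _; apply: le_trans (abs_re_le _) _.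
  apply: le_trans cs _; apply: ler_pM; rewrite ?sqrtr_ge0 //.
    rewrite -[leRHS]ger0_norm ?mulr_ge0 ?hnorm_ge0 ?(ltW e0) // -sqrtr_sqr.
    rewrite ler_wsqrtr // exprMn (hnorm_sqr HX (DC Dv)) re_add re_opp re_rmul.
    by move: vlt; rewrite ltr_pdivrMr ?ipp // mulrDl => /ltW; rewrite lerBlDl.
  rewrite ler_wsqrtr // re_add re_opp re_rmul.
  have h1 : 0 <= re (ip w w) := sesq_ge0 S (DC Dw).
  have h2 := mulr_ge0 m0 h1; lra.
apply: ge_ereal_inf; exists m%:E; first by exists m.
rewrite lee_fin; apply: (@le_trans _ _ (re (a u u) / re (ip u u))).
  by apply: ge_inf; [exact: hiE.2|exists u].
by rewrite ler_pdivrMr ?ipp.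
Qed.

Lemma lambda0_le_ess : (lambda0 A <= lambda0_ess A)%E.
Proof.
by apply: ereal_inf_le_tmp => _ [x [xs _] <-]; exists x.
Qed.

(** A half-line of spectrum has no isolated points: whatever the radius [d] around [l + eps], the
    point [l + eps + d / 2] is also in the spectrum. *)
Lemma lambda0_ess_le (l : R) : (forall x, l < x -> spectrum A x%:C) ->
  (lambda0_ess A <= l%:E)%E.
Proof.
move=> sp; apply/lee_addgt0Pr => eps e0; apply: ge_ereal_inf.
exists (l + eps)%:E; last by rewrite EFinD.
exists (l + eps) => //; have le : l < l + eps by rewrite ltrDl.
split; first exact: sp.
case=> _ _ [d d0 /(_ (l + eps + d / 2)%:C)] H.
have d2 : 0 < d / 2 by rewrite divr_gt0.
have := H (sp _ _); rewrite -rmorphB normc_real.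
have -> : l + eps + d / 2 - (l + eps) = d / 2 by lra.
rewrite gtr0_norm //; have -> : l < l + eps + d / 2 by lra.
move=> /(_ isT); have -> : d / 2 < d by lra.
move=> /(_ isT)/complexI/eqP; rewrite -subr_eq0 addrAC subrr add0r.
by rewrite gt_eqF.
Qed.

End FormOperator.

(** * Square-integrable functions and primitives on an interval *)

Section Integral.
Variable R : realType.
Local Notation mu := (@lebesgue_measure R).
Implicit Types (a b c x y : R) (f g h : R -> R).

Definition itg a b f : R := \int[mu]_(t in `[a, b]) f t.
Definition itgable a b f : Prop := mu.-integrable `[a, b] (EFin \o f).

Lemma itgable_measurable a b f : itgable a b f -> measurable_fun `[a, b] f.
Proof. by move=> /integrableP[/measurable_EFinP]. Qed.

Lemma itgD a b f g : itgable a b f -> itgable a b g ->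
  itg a b (fun t => f t + g t) = itg a b f + itg a b g.
Proof. by move=> fi gi; exact: RintegralD. Qed.

Lemma itgB a b f g : itgable a b f -> itgable a b g ->
  itg a b (fun t => f t - g t) = itg a b f - itg a b g.
Proof. by move=> fi gi; exact: RintegralB. Qed.

Lemma itgZ a b c f : itgable a b f -> itg a b (fun t => c * f t) = c * itg a b f.
Proof. by move=> fi; exact: RintegralZl. Qed.

Lemma itg_ge0 a b f : (forall t, a <= t <= b -> 0 <= f t) -> 0 <= itg a b f.
Proof. by move=> f0; apply: Rintegral_ge0 => t /=; rewrite in_itv; exact: f0. Qed.

Lemma itg_le a b f g : itgable a b f -> itgable a b g ->
  (forall t, a <= t <= b -> f t <= g t) -> itg a b f <= itg a b g.
Proof.
by move=> fi gi fg; apply: le_Rintegral => // t /=; rewrite in_itv; exact: fg.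
Qed.

Lemma eq_itg a b f g : (forall t, a <= t <= b -> f t = g t) -> itg a b f = itg a b g.
Proof. by move=> fg; apply: eq_Rintegral => t; rewrite inE /= in_itv; exact: fg. Qed.

Lemma itgableD a b f g : itgable a b f -> itgable a b g -> itgable a b (fun t => f t + g t).
Proof. by move=> fi gi; exact: (integrableD _ fi gi). Qed.

Lemma itgableZ a b c f : itgable a b f -> itgable a b (fun t => c * f t).
Proof. by move=> fi; exact: (integrableZl _ c fi). Qed.

Lemma itgableB a b f g : itgable a b f -> itgable a b g -> itgable a b (fun t => f t - g t).
Proof. by move=> fi gi; exact: (integrableB _ fi gi). Qed.

Lemma eq_itgable a b f g : (forall t, a <= t <= b -> f t = g t) ->
  itgable a b f -> itgable a b g.
Proof.
move=> fg; apply: eq_integrable => // t; rewrite inE /= in_itv => /fg /= -> //.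
Qed.

Lemma itgable_le a b f g : measurable_fun `[a, b] f ->
  (forall t, a <= t <= b -> `|f t| <= g t) -> itgable a b g -> itgable a b f.
Proof.
move=> mf fg; apply: le_integrable => //; first exact/measurable_EFinP.
by move=> t; rewrite /= in_itv => /fg h; rewrite lee_fin (le_trans h) ?ler_norm.
Qed.

Lemma continuous_itgable a b f : {within `[a, b], continuous f} -> itgable a b f.
Proof.
by move=> cf; apply: continuous_compact_integrable => //; exact: segment_compact.
Qed.

Lemma continuous_measurable_itv a b f :
  {within `[a, b], continuous f} -> measurable_fun `[a, b] f.
Proof. by move=> cf; exact: itgable_measurable (continuous_itgable cf). Qed.

Lemma itg_cst a b c : a <= b -> itg a b (fun=> c) = c * (b - a).
Proof.
move=> ab; rewrite /itg Rintegral_cst //=.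
have -> : mu `[a, b] = if a < b then (b - a)%:E else 0%E.
  by rewrite lebesgue_measure_itv /= lte_fin.
case: ltP => //= ba; have -> : a = b by apply/le_anti/andP.
by rewrite subrr.
Qed.

Lemma itgable_cst a b c : itgable a b (fun=> c).
Proof. by apply: continuous_itgable; apply: continuous_subspaceT => ?; exact: cvg_cst. Qed.

Lemma itg0 a b : itg a b (fun=> 0) = 0.
Proof. by rewrite /itg Rintegral_cst // mul0r. Qed.

Lemma itg_point a f : itg a a f = 0.
Proof. by rewrite /itg set_itv1 Rintegral_set1. Qed.

Lemma itgable_sub a b c d f : a <= c -> d <= b -> itgable a b f -> itgable c d f.
Proof.
move=> ac db; apply: integrableS => // t /=; rewrite !in_itv /= => /andP[ct td].
by rewrite (le_trans ac ct) (le_trans td db).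
Qed.

Lemma itg_split a c b f : a <= c -> c <= b -> itgable a b f ->
  itg a b f = itg a c f + itg c b f.
Proof.
move=> ac cb fi; apply/eqP; rewrite addrC -subr_eq; apply/eqP.
rewrite /itg -(@Rintegral_itv_obnd_cbnd _ c) /=.
  exact: Rintegral_itvB.
apply: integrableS fi => // t /=; rewrite !in_itv /= => /andP[ct ->].
by rewrite (le_trans ac (ltW ct)).
Qed.

Definition sqi a b f : Prop := measurable_fun `[a, b] f /\
  (\int[mu]_(t in `[a, b]) ((f t) ^+ 2)%:E < +oo)%E.

Lemma sqi_sqr a b f : sqi a b f -> itgable a b (fun t => f t ^+ 2).
Proof.
move=> [mf fi]; apply/integrableP; split.
  by apply/measurable_EFinP; exact: measurable_funX.
apply: le_lt_trans fi; rewrite le_eqVlt; apply/orP; left; apply/eqP.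
by apply: eq_integral => t _ /=; rewrite ger0_norm ?sqr_ge0.
Qed.

Lemma sqiP a b f : sqi a b f <->
  measurable_fun `[a, b] f /\ itgable a b (fun t => f t ^+ 2).
Proof.
split=> [fs|[mf /integrableP[_ fi]]].
  by split; [exact: fs.1|exact: sqi_sqr].
split=> //; apply: le_lt_trans fi; rewrite le_eqVlt; apply/orP; left; apply/eqP.
by apply: eq_integral => t _ /=; rewrite ger0_norm ?sqr_ge0.
Qed.

Lemma sqi_itg a b f : sqi a b f ->
  (\int[mu]_(t in `[a, b]) ((f t) ^+ 2)%:E)%E = (itg a b (fun t => f t ^+ 2))%:E.
Proof.
move=> [_ fi]; rewrite /itg /Rintegral fineK // ge0_fin_numE //.
by apply: integral_ge0 => t _; rewrite lee_fin sqr_ge0.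
Qed.

Lemma itgableM a b f g : sqi a b f -> sqi a b g -> itgable a b (fun t => f t * g t).
Proof.
move=> fs gs.
apply: (@itgable_le _ _ _ (fun t => f t ^+ 2 + g t ^+ 2)).
- by apply: measurable_funM; [exact: fs.1|exact: gs.1].
- move=> t _; rewrite normrM.
  have := sqr_ge0 (`|f t| - `|g t|); have := sqr_ge0 (`|f t| + `|g t|).
  rewrite sqrrB sqrrD !real_normK ?num_real //; have := normr_ge0 (f t).
  have := normr_ge0 (g t); set p := `|f t|; set q := `|g t|; rewrite !mulr2n; lra.
- by apply: itgableD; exact: sqi_sqr.
Qed.

Lemma sqi_lin a b c f g : sqi a b f -> sqi a b g -> sqi a b (fun t => c * f t + g t).
Proof.
move=> fs gs; apply/sqiP; split.
  by apply: measurable_funD; [apply: measurable_funM => //; exact: fs.1|exact: gs.1].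
apply: (@eq_itgable _ _ (fun t => c ^+ 2 * f t ^+ 2 + (2 * c) * (f t * g t) + g t ^+ 2)).
  by move=> t _; ring.
apply: itgableD; last exact: sqi_sqr.
apply: itgableD; apply: itgableZ; [exact: sqi_sqr|exact: itgableM].
Qed.

Lemma sqi_cst a b c : sqi a b (fun=> c).
Proof. by apply/sqiP; split => //; exact: itgable_cst. Qed.

Lemma sqiZ a b c f : sqi a b f -> sqi a b (fun t => c * f t).
Proof.
by move=> fs; have := sqi_lin c fs (sqi_cst a b 0); under eq_fun do rewrite addr0.
Qed.

Lemma sqiB a b f g : sqi a b f -> sqi a b g -> sqi a b (fun t => f t - g t).
Proof.
move=> fs gs; have := sqi_lin (-1) gs fs.
by under eq_fun do rewrite mulN1r addrC.
Qed.

Lemma continuous_sqi a b f : {within `[a, b], continuous f} -> sqi a b f.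
Proof.
move=> cf; apply/sqiP; split; first exact: continuous_measurable_itv.
by apply: continuous_itgable => t; apply: cvgM; exact: cf.
Qed.

Lemma sqi_itgable a b f : sqi a b f -> itgable a b f.
Proof.
move=> fs; have := itgableM fs (sqi_cst a b 1); apply: eq_itgable => t _.
by rewrite mulr1.
Qed.

Lemma sqi_sub a b c d f : a <= c -> d <= b -> sqi a b f -> sqi c d f.
Proof.
move=> ac db /sqiP[mf fi]; apply/sqiP; split; last exact: itgable_sub fi.
apply: measurable_funS mf => // t /=; rewrite !in_itv /= => /andP[ct td].
by rewrite (le_trans ac ct) (le_trans td db).
Qed.

Lemma itg_sqr_ge0 a b f : 0 <= itg a b (fun t => f t ^+ 2).
Proof. by apply: itg_ge0 => t _; exact: sqr_ge0. Qed.

Lemma itg_CS a b f g : sqi a b f -> sqi a b g ->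
  itg a b (fun t => f t * g t) ^+ 2 <=
  itg a b (fun t => f t ^+ 2) * itg a b (fun t => g t ^+ 2).
Proof.
move=> fs gs; set A := itg _ _ _.
have fi := sqi_sqr fs; have gi := sqi_sqr gs; have fgi := itgableM fs gs.
apply: discriminant_le; rewrite ?sqr_ge0 ?itg_sqr_ge0 // => t.
have -> : itg a b (fun t => f t ^+ 2) - 2 * t * A ^+ 2 +
    t ^+ 2 * (A ^+ 2 * itg a b (fun t => g t ^+ 2)) =
    itg a b (fun x => (f x - (t * A) * g x) ^+ 2); last exact: itg_sqr_ge0.
under [RHS]eq_itg => x _.
  rewrite (_ : _ ^+ 2 = f x ^+ 2 - (2 * t * A) * (f x * g x) +
    (t * A) ^+ 2 * g x ^+ 2); last by ring.
  over.
rewrite itgD ?itgB ?itgZ //; first by rewrite -/A; ring.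
- exact: itgableZ.
- by apply: itgableB => //; exact: itgableZ.
- exact: itgableZ.
Qed.

Lemma itg_CS1 a b f : a <= b -> sqi a b f ->
  itg a b f ^+ 2 <= (b - a) * itg a b (fun t => f t ^+ 2).
Proof.
move=> ab fs; have := itg_CS fs (sqi_cst a b 1).
under eq_itg do rewrite mulr1.
by rewrite (_ : itg a b (fun=> 1 ^+ 2) = b - a) 1?mulrC // expr1n itg_cst // mul1r.
Qed.

End Integral.

(** * Completeness of L^2 on an interval *)

Section Completeness.
Variables (R : realType) (a b : R).
Hypothesis ab : a <= b.
Local Notation mu := (@lebesgue_measure R).
Implicit Types (f h : R -> R) (g : nat -> R -> R).

(** On a bounded interval the L^1 norms of the increments are summable too; the sum of their
    absolute values is integrable, hence finite almost everywhere. *)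
Let ae_cvg_of_summable g : (forall n, sqi a b (g n)) ->
  (forall k, itg a b (fun t => (g k.+1 t - g k t) ^+ 2) <= ((2 ^ k.+1)%:R^-1) ^+ 2) ->
  {ae mu, forall t, `[a, b]%classic t -> cvgn (fun k => g k t)}.
Proof.
move=> gs gk; pose d k t : R := `|g k.+1 t - g k t|.
have ds k : sqi a b (d k).
  apply/sqiP; split.
    by apply: measurableT_comp => //; exact: (sqiB (gs k.+1) (gs k)).1.
  apply: eq_itgable (sqi_sqr (sqiB (gs k.+1) (gs k))) => t _.
  by rewrite /d real_normK ?num_real.
have dk k : itg a b (d k) <= Num.sqrt (b - a) / (2 ^ k.+1)%:R.
  rewrite -(ler_pXn2r (ltn0Sn 1)) ?nnegrE ?divr_ge0 ?sqrtr_ge0 //; last first.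
    by apply: itg_ge0 => t _; exact: normr_ge0.
  apply: le_trans (itg_CS1 ab (ds k)) _.
  rewrite exprMn sqr_sqrtr ?subr_ge0 // ler_wpM2l ?subr_ge0 //.
  apply: le_trans (gk k); rewrite le_eqVlt; apply/orP; left; apply/eqP.
  by apply: eq_itg => t _; rewrite /d real_normK ?num_real.
pose F k t := (d k t)%:E.
have mF k : measurable_fun `[a, b] (F k) by apply/measurable_EFinP; exact: (ds k).1.
have F0 k t : `[a, b]%classic t -> (0 <= F k t)%E by rewrite lee_fin /d normr_ge0.
have intF k : (\int[mu]_(t in `[a, b]) F k t = (itg a b (d k))%:E)%E.
  rewrite /itg /Rintegral fineK //; apply: integrable_fin_num => //.
  exact: sqi_itgable (ds k).
have sumF : (\int[mu]_(t in `[a, b]) (\sum_(k <oo) F k t) < +oo)%E.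
  rewrite integral_nneseries //; apply: (@le_lt_trans _ _ (Num.sqrt (b - a))%:E); last exact: ltry.
  apply: le_trans (epsilon_trick0 xpredT (sqrtr_ge0 (b - a))).
  rewrite (eq_eseriesr (fun k _ => intF k)).
  apply: lee_nneseries => k *; rewrite lee_fin; last exact: dk.
  by apply: itg_ge0 => t _; exact: normr_ge0.
have iF : mu.-integrable `[a, b] (fun t => \sum_(k <oo) F k t)%E.
  apply/integrableP; split.
    apply: (@ge0_emeasurable_sum _ _ _ `[a, b]%classic F xpredT).
      by move=> k t Dt _; exact: F0.
    by move=> k _; exact: mF.
  apply: le_lt_trans sumF; rewrite le_eqVlt; apply/orP; left; apply/eqP.
  apply: eq_integral => t; rewrite inE => Dt; rewrite gee0_abs //.
  by apply: nneseries_ge0 => k _ _; exact: F0.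
have := @integrable_ae _ _ _ mu _ (measurable_itv `[a, b]) _ iF.
apply: filterS => t H Dt; have {}H := H Dt.
have cd : cvgn [normed series (fun k => g k.+1 t - g k t)].
  apply: nondecreasing_is_cvgn.
    by apply: nondecreasing_series => k _ _; exact: normr_ge0.
  exists (fine (\sum_(k <oo) F k t)%E) => _ [n _ <-] /=.
  rewrite -lee_fin fineK // -sumEFin.
  by apply: (nneseries_lim_ge (u_ := F ^~ t)) => k _ _; exact: F0.
have /normed_cvg cs := cd.
have -> : (fun k => g k t) = (fun k => g 0%N t + series (telescope (fun k => g k t)) k).
  by apply: funext => k; exact: eq_sum_telescope.
by apply: is_cvgD => //; exact: is_cvg_cst.
Qed.

(** Riesz-Fischer: the limit is the almost everywhere limit of a rapidly convergent subsequence, and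
    Fatou's lemma bounds the distance to it. *)
Lemma sqi_complete g : (forall n, sqi a b (g n)) ->
  (forall eps : R, 0 < eps -> exists N, forall m n, (N <= m)%N -> (N <= n)%N ->
     itg a b (fun t => (g m t - g n t) ^+ 2) < eps) ->
  exists2 f, sqi a b f &
    (fun n => itg a b (fun t => (g n t - f t) ^+ 2)) @ \oo --> (0 : R).
Proof.
move=> gs cau.
pose dl k : R := ((2 ^ k.+1)%:R^-1) ^+ 2.
have dl0 k : 0 < dl k by rewrite exprn_gt0 // invr_gt0 ltr0n expn_gt0.
have [N NP] := choice (fun k => cau (dl k) (dl0 k)).
(* Taking the maximum over [j <= k] and adding [k] makes the indices monotone and at least both [k]
   and [N k]. *)
pose nk k := (k + \max_(j < k.+1) N j)%N.
have nkN k : (N k <= nk k)%N.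
  by apply: leq_trans (leq_addl _ _); exact: (leq_bigmax (ord_max : 'I_k.+1)).
have nkk k : (k <= nk k)%N by exact: leq_addr.
have nkmono : {homo nk : i j / (i <= j)%N}.
  apply: homo_leq => //; first exact: leq_trans.
  by move=> k; rewrite /nk (big_ord_recr k.+1) /= leq_add // leq_maxl.
have nkS k : (N k <= nk k.+1)%N by exact: leq_trans (nkN k) (nkmono _ _ (leqnSn k)).
pose G k := g (nk k).
have Gs k : sqi a b (G k) := gs _.
have ae := ae_cvg_of_summable Gs (fun k => ltW (NP k _ _ (nkS k) (nkN k))).
(* The upper limit is measurable in any case and agrees with the limit wherever that exists. *)
pose f t := fine (limn_esup (fun k => (G k t)%:E)).
have mf : measurable_fun `[a, b] f.
  apply: (measurableT_comp (fine_measurable measurableT)).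
  apply: measurable_fun_limn_esup => k.
  by apply/measurable_EFinP; exact: (Gs k).1.
have fE t : cvgn (fun k => G k t) -> (fun k => G k t) @ \oo --> f t.
  move=> /cvg_ex[l /= Gl].
  have El : (fun k => (G k t)%:E) @ \oo --> l%:E by apply/fine_cvgP; split; [exact: nearW|exact: Gl].
  have -> : f t = l; last exact: Gl.
  rewrite /f is_cvg_limn_esupE; last by apply/cvg_ex; exists l%:E.
  by rewrite (cvg_lim _ El).
have bound n e : (exists k0, forall k, (k0 <= k)%N ->
      itg a b (fun t => (g n t - G k t) ^+ 2) <= e) ->
    (\int[mu]_(t in `[a, b]) ((g n t - f t) ^+ 2)%:E <= e%:E)%E.
  move=> [k0 He]; pose H k t := ((g n t - G k t) ^+ 2)%:E.
  have Hs k := sqiB (gs n) (Gs k).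
  have mH k : measurable_fun `[a, b] (H k).
    by apply/measurable_EFinP; exact: measurable_funX (Hs k).1.
  have H0 k t : `[a, b]%classic t -> (0 <= H k t)%E by rewrite lee_fin sqr_ge0.
  have fat := @fatou _ _ _ mu _ (measurable_itv `[a, b]) H mH H0.
  have le1 : (\int[mu]_(t in `[a, b]) ((g n t - f t) ^+ 2)%:E <=
      \int[mu]_(t in `[a, b]) limn_einf (H ^~ t))%E.
    apply: ae_ge0_le_integral => //.
    - by move=> t _; rewrite lee_fin sqr_ge0.
    - apply/measurable_EFinP; apply: measurable_funX; apply: measurable_funB => //.
      exact: (gs n).1.
    - move=> t Dt; rewrite limn_einf_lim; apply: lime_ge; first exact: is_cvg_einfs.
      by apply: nearW => k; apply: le_ereal_inf_tmp => _ [m _ <-]; exact: H0.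
    - apply: (@measurableT_comp _ _ _ _ _ _ (@oppe R) _ (fun x => limn_esup (fun k => - H k x)%E)) => //.
      by apply: measurable_fun_limn_esup => k; exact: measurableT_comp.
    move: ae; apply: filterS; first exact: (ae_filter_ringOfSetsType mu).
    move=> t ct Dt; have {}ct := fE t (ct Dt).
    have El : (fun k => H k t) @ \oo --> ((g n t - f t) ^+ 2)%:E.
      apply/fine_cvgP; split; first exact: nearW.
      have h : (fun k => g n t - G k t) @ \oo --> g n t - f t.
        by apply: cvgB => //; exact: cvg_cst.
      exact: (cvgM h h).
    rewrite is_cvg_limn_einfE; last by apply/cvg_ex; eexists; exact: El.
    by rewrite (cvg_lim _ El).
  apply: le_trans le1 (le_trans fat _).
  rewrite limn_einf_lim; apply: lime_le; first exact: is_cvg_einfs.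
  apply: nearW => k; apply: (@le_trans _ _ (\int[mu]_(t in `[a, b]) H (maxn k k0) t)%E).
    by apply: ereal_inf_lbound; exists (maxn k k0) => //=; exact: leq_maxl.
  by rewrite sqi_itg // lee_fin; apply: He; exact: leq_maxr.
have fs : sqi a b f.
  have hs : sqi a b (fun t => g (nk 0) t - f t).
    split; first by apply: measurable_funB => //; exact: (gs _).1.
    apply: le_lt_trans (bound (nk 0) (dl 0) _) (ltry _).
    exists 0%N => k _; apply: ltW; apply: NP => //.
    by apply: leq_trans (nkN 0) (nkmono _ _ _).
  have := sqiB (gs (nk 0)) hs.
  by congr sqi; apply: funext => t; rewrite opprB addrC subrK.
exists f => //; apply/cvg0_epsP => eps e0.
have [M HM] := cau _ (divr_gt0 e0 (ltr0n _ 2)).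
exists M => n Mn; rewrite ger0_norm ?itg_sqr_ge0 //.
apply: (@le_lt_trans _ _ (eps / 2)); last by rewrite ltr_pdivrMr // ltr_pMr // ltr1n.
rewrite -lee_fin -sqi_itg; last exact: sqiB.
apply: bound; exists M => k Mk; apply: ltW; apply: HM => //.
exact: leq_trans Mk (nkk k).
Qed.

End Completeness.

(** * Primitives and one-sided derivatives *)

Section Primitive.
Variable R : realType.
Implicit Types (a b c d l x y t : R) (u v g k h : R -> R).

(** [u] is of class C^1 on the closed interval with derivative [g]. The integral form avoids
    one-sided derivatives at the ends and passes easily to subintervals, sums and products. *)
Definition primitive a b u g : Prop := {within `[a, b], continuous g} /\
  forall x, a <= x <= b -> u x = u a + itg a x g.

Lemma eq_within_continuous a b g k : (forall x, a <= x <= b -> g x = k x) ->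
  {within `[a, b], continuous g} -> {within `[a, b], continuous k}.
Proof.
move=> gk; apply: subspace_eq_continuous => x; rewrite inE /= in_itv; exact: gk.
Qed.

Lemma itg_continuous a b h : itgable a b h ->
  {within `[a, b], continuous (fun x => itg a x h)}.
Proof.
move=> hi; have [ab|ba] := leP a b; first exact: parameterized_integral_continuous.
by rewrite set_itv_ge ?bnd_simp -?ltNge //; exact: continuous_subspace0.
Qed.

Lemma within_continuousD a b g k : {within `[a, b], continuous g} ->
  {within `[a, b], continuous k} -> {within `[a, b], continuous (fun x => g x + k x)}.
Proof. by move=> cg ck x; apply: cvgD; [exact: cg|exact: ck]. Qed.

Lemma within_continuousM a b g k : {within `[a, b], continuous g} ->
  {within `[a, b], continuous k} -> {within `[a, b], continuous (fun x => g x * k x)}.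
Proof. by move=> cg ck x; apply: cvgM; [exact: cg|exact: ck]. Qed.

Lemma within_continuous_cst a b c : {within `[a, b], continuous (fun=> c)}.
Proof. by apply: continuous_subspaceT => ?; exact: cvg_cst. Qed.

Lemma prim_continuous a b u g : primitive a b u g -> {within `[a, b], continuous u}.
Proof.
move=> [cg ug]; apply: (@eq_within_continuous _ _ (fun x => u a + itg a x g)).
  by move=> x xab; rewrite -ug.
apply: within_continuousD; first exact: within_continuous_cst.
exact: itg_continuous (continuous_itgable cg).
Qed.

Lemma prim_sqi a b u g : primitive a b u g -> sqi a b u.
Proof. by move=> /prim_continuous; exact: continuous_sqi. Qed.

Lemma prim_sqi' a b u g : primitive a b u g -> sqi a b g.
Proof. by move=> [/continuous_sqi]. Qed.

Lemma prim_sub a b c d u g : primitive a b u g -> a <= c -> d <= b ->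
  primitive c d u g.
Proof.
move=> [cg ug] ac db; split.
  apply: continuous_subspaceW cg => x /=; rewrite !in_itv /= => /andP[cx xd].
  by rewrite (le_trans ac cx) (le_trans xd db).
move=> x /andP[cx xd]; have xb := le_trans xd db; have cb := le_trans cx xb.
have gi := continuous_itgable cg.
rewrite ug ?(le_trans ac cx) // (ug c) ?ac // -addrA; congr (_ + _).
by apply: itg_split => //; exact: itgable_sub gi.
Qed.

Lemma prim_diff a b u g x y : primitive a b u g -> a <= x -> x <= y -> y <= b ->
  u y - u x = itg x y g.
Proof.
move=> p ax xy yb; have [_ /(_ y)] := prim_sub p ax yb.
by rewrite xy lexx => -> //; rewrite addrC addKr.
Qed.

Lemma eq_prim a b u v g k : (forall x, a <= x <= b -> u x = v x) ->
  (forall x, a <= x <= b -> g x = k x) -> primitive a b u g -> primitive a b v k.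
Proof.
move=> uv gk [cg ug]; split; first exact: eq_within_continuous cg.
move=> x xab; have /andP[ax xb] := xab.
rewrite -uv // -uv ?lexx ?(le_trans ax) // ug //; congr (_ + _).
by apply: eq_itg => t /andP[a_t tx]; rewrite gk // a_t (le_trans tx).
Qed.

Lemma prim_lin a b c u v g k : primitive a b u g -> primitive a b v k ->
  primitive a b (fun x => c * u x + v x) (fun x => c * g x + k x).
Proof.
move=> [cg ug] [ck vk]; split.
  by apply: within_continuousD => //; apply: within_continuousM => //; exact: within_continuous_cst.
move=> x xab; have /andP[ax xb] := xab.
have gi := itgable_sub (lexx a) xb (continuous_itgable cg).
have ki := itgable_sub (lexx a) xb (continuous_itgable ck).
by rewrite ug // vk // itgD ?itgZ //; [ring|exact: itgableZ].
Qed.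

Lemma prim_cst a b c : primitive a b (fun=> c) (fun=> 0).
Proof.
by split=> [|x _]; [exact: within_continuous_cst|rewrite itg0 addr0].
Qed.

Lemma prim_id a b : primitive a b id (fun=> 1).
Proof.
split=> [|x /andP[ax _]]; first exact: within_continuous_cst.
by rewrite itg_cst // mul1r addrC subrK.
Qed.

Let prim_LR a b u g : a < b -> primitive a b u g ->
  let U := fun x => u a + itg a x g in
  derivable_oo_LRcontinuous U a b /\ {in `]a, b[, U^`()%classic =1 g}.
Proof.
move=> ab [cg ug] U.
have gi := continuous_itgable cg.
have cU : {within `[a, b], continuous U}.
  by apply: within_continuousD; [exact: within_continuous_cst|exact: itg_continuous].
have [cgo _ _] := (continuous_within_itvP g ab).1 cg.
have [_ U1 U2] := (continuous_within_itvP U ab).1 cU.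
have D x : x \in `]a, b[ -> derivable U x 1 /\ U^`()%classic x = g x.
  move=> xab; have := xab; rewrite in_itv /= => /andP[ax xb].
  have [d1 d2] := continuous_FTC1_closed xb gi ax (cgo _ xab).
  have dc : derivable (fun=> u a : R^o) x 1 by exact: derivable_cst.
  split; first exact: (derivableD dc d1).
  by rewrite derive1E (deriveD dc d1) derive_cst add0r -derive1E.
split; last by move=> x /D[].
by split=> // x /D[].
Qed.

Lemma prim_mul a b u v g k : primitive a b u g -> primitive a b v k ->
  primitive a b (fun x => u x * v x) (fun x => g x * v x + u x * k x).
Proof.
move=> pu pv; split.
  apply: within_continuousD; apply: within_continuousM.
  - exact: pu.1.
  - exact: prim_continuous pv.
  - exact: prim_continuous pu.
  - exact: pv.1.
move=> x /andP[ax xb]; move: ax; rewrite le_eqVlt => /predU1P[<-|ax].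
  by rewrite itg_point addr0.
have pux := prim_sub pu (lexx a) xb; have pvx := prim_sub pv (lexx a) xb.
have [dU U'] := prim_LR ax pux; have [dV V'] := prim_LR ax pvx.
have := Rintegration_by_parts ax pux.1 dU U' pvx.1 dV V'.
move=> H.
have ug y : a <= y <= x -> u a + itg a y g = u y by move=> /pux.2.
have vk y : a <= y <= x -> v a + itg a y k = v y by move=> /pvx.2.
have axx : a <= x <= x by rewrite lexx ltW.
have aax : a <= a <= x by rewrite lexx ltW.
move: H; rewrite -/(itg a x (fun y => (u a + itg a y g) * k y)).
rewrite -/(itg a x (fun y => g y * (v a + itg a y k))).
rewrite (ug x axx) (vk x axx) (ug a aax) (vk a aax).
under eq_itg => y yx do rewrite ug //.
under [X in _ - X]eq_itg => y yx do rewrite vk //.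
move=> H; rewrite itgD.
- by rewrite H; ring.
- by apply: itgableM; [exact: prim_sqi' pux|exact: prim_sqi pvx].
- by apply: itgableM; [exact: prim_sqi pux|exact: prim_sqi' pvx].
Qed.

Lemma prim_smooth a b u g : (forall x, is_derive x 1 u (g x)) -> continuous g ->
  primitive a b u g.
Proof.
move=> du cg; split; first exact: continuous_subspaceT.
have cu : continuous u.
  by move=> x; apply: differentiable_continuous; apply/derivable1_diffP; case: (du x).
move=> x /andP[ax _]; move: ax; rewrite le_eqVlt => /predU1P[<-|ax].
  by rewrite itg_point addr0.
have cw : {within `[a, x], continuous u} by exact: continuous_subspaceT.
have [_ u1 u2] := (continuous_within_itvP u ax).1 cw.
have := @continuous_FTC2 R g u a x ax.
rewrite /itg /Rintegral => ->.
- by rewrite -EFinB /= addrC subrK.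
- exact: continuous_subspaceT.
- by split=> // y _; case: (du y).
- by move=> y _; rewrite derive1E; case: (du y).
Qed.

Lemma itg_bounds a b g m M : a <= b -> itgable a b g ->
  (forall t, a <= t <= b -> m <= g t <= M) ->
  m * (b - a) <= itg a b g <= M * (b - a).
Proof.
move=> ab gi H; rewrite -!itg_cst //; apply/andP; split.
  by apply: itg_le => // [|t /H/andP[]//]; exact: itgable_cst.
by apply: itg_le => // [|t /H/andP[]//]; exact: itgable_cst.
Qed.

Lemma rderiv_prim l u g x : 0 < l -> primitive 0 l u g -> 0 <= x <= l ->
  rderiv l u x = g x.
Proof.
move=> l0 p xl; rewrite /rderiv.
(* Convergence determines the value of [lim] only along a proper filter. As [l > 0], every point of
   the interval has others arbitrarily near: to its right at 0, to its left elsewhere. *)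
have PF : ProperFilter (within `[0, l]%classic x^').
  apply: Build_ProperFilter_ex => P; rewrite /within /dnbhs /within /=.
  move=> /nbhs_ballP[d /= d0 Hd].
  have [x0|xn0] := eqVneq x 0.
    pose e := Num.min (d / 2) l.
    have e0 : 0 < e by rewrite lt_min divr_gt0.
    exists e; apply: Hd => /=.
    - rewrite /ball /= x0 sub0r normrN gtr0_norm // /e.
      by rewrite gt_min ltr_pdivrMr // ltr_pMr // ltr1n.
    - by rewrite x0 gt_eqF.
    - by rewrite in_itv /= (ltW e0) ge_min lexx orbT.
  have xp : 0 < x by rewrite lt_def xn0; case/andP: xl.
  pose e := Num.min (d / 2) x.
  have e0 : 0 < e by rewrite lt_min divr_gt0.
  exists (x - e); apply: Hd => /=.
  - rewrite /ball /= opprB addrC subrK gtr0_norm // /e.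
    by rewrite gt_min ltr_pdivrMr // ltr_pMr // ltr1n.
  - by rewrite lt_eqF // gtrDl oppr_lt0.
  - rewrite in_itv /= subr_ge0 ge_min lexx orbT /=.
    by case/andP: xl => _; apply: le_trans; rewrite gerDl oppr_le0 ltW.
apply: cvg_lim => //; apply/cvgrPdist_le => eps e0.
have /subspace_continuousP/(_ x) := p.1.
rewrite /= in_itv /= xl => /(_ isT) /cvgrPdist_le /(_ _ e0).
rewrite near_withinE => /nbhs_ballP[d /= d0 Hd].
rewrite near_withinE near_withinE; apply/nbhs_ballP; exists d => //= y yd yx.
rewrite /= in_itv /= => yl.
have gi := continuous_itgable p.1.
(* The difference quotient is the mean of [g] over [[z, w]], where [g] stays within [eps] of
   [g x]. *)
have key z w : 0 <= z -> z < w -> w <= l -> (forall t, z <= t <= w -> ball x d t) ->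
    `|g x - (u w - u z) / (w - z)| <= eps.
  move=> z0 zw wl zb; rewrite (prim_diff p z0 (ltW zw) wl).
  have wz : 0 < w - z by rewrite subr_gt0.
  have /andP[] : (g x - eps) * (w - z) <= itg z w g <= (g x + eps) * (w - z).
    apply: itg_bounds (ltW zw) (itgable_sub z0 wl gi) _ => t tzw.
    have /andP[zt tw] := tzw.
    have tl : `[0, l]%classic t by rewrite /= in_itv /= (le_trans z0) // (le_trans tw).
    by have := Hd t (zb t tzw) tl; rewrite distrC ler_distl.
  by move=> h1 h2; rewrite distrC ler_distl ler_pdivlMr // ler_pdivrMr // h1.
have bd t : (x <= t <= y) || (y <= t <= x) -> ball x d t.
  move: yd; rewrite /ball /= !ltr_norml => /andP[h1 h2] h.
  case/orP: h => /andP[h3 h4]; apply/andP; split; lra.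
case/andP: xl => x0 xl; case/andP: yl => y0 yl.
have [xy|xy|xy] := ltgtP x y; last by rewrite xy eqxx in yx.
  by apply: key => // t h; apply: bd; rewrite h.
have -> : (u y - u x) / (y - x) = (u x - u y) / (x - y).
  by rewrite -(opprB x y) -(opprB (u x)) invrN mulrNN.
by apply: key => // t h; apply: bd; rewrite h orbT.
Qed.

End Primitive.

(** * Poincare, trace and closability estimates *)

Section Estimates.
Variable R : realType.
Local Notation mu := (@lebesgue_measure R).
Implicit Types (a b c l x y t : R) (u v g k h : R -> R).

Lemma prim_osc a b u g x y : a <= b -> primitive a b u g ->
  a <= x <= b -> a <= y <= b ->
  (u x - u y) ^+ 2 <= (b - a) * itg a b (fun t => g t ^+ 2).
Proof.
move=> ab p; have gs := prim_sqi' p; have gi := sqi_sqr gs.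
wlog yx : x y / y <= x.
  by move=> H xab yab; have [/H|/ltW/H] := leP y x; [exact|rewrite -sqrrN opprB; exact].
move=> /andP[ax xb] /andP[ay yb]; rewrite (prim_diff p ay yx xb).
apply: le_trans (itg_CS1 yx (sqi_sub ay xb gs)) _.
apply: ler_pM; rewrite ?subr_ge0 ?itg_sqr_ge0 ?lerB //.
rewrite (itg_split ay yb gi) (itg_split yx xb (itgable_sub ay (lexx b) gi)).
by rewrite addrCA lerDl addr_ge0 ?itg_sqr_ge0.
Qed.

(** The deviation of [u] from its mean is bounded pointwise by its oscillation. The resulting
    constant [(b - a)^2] is not sharp, which is harmless because the pieces may be taken as short as
    desired. *)
Lemma poincare a b u g : a < b -> primitive a b u g ->
  itg a b (fun t => u t ^+ 2) <=
  (b - a) ^+ 2 * itg a b (fun t => g t ^+ 2) + (b - a)^-1 * itg a b u ^+ 2.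
Proof.
move=> ab p; have h0 : 0 < b - a by rewrite subr_gt0.
have us := prim_sqi p; have ui := sqi_itgable us; have u2 := sqi_sqr us.
set G := itg a b (fun t => g t ^+ 2); pose B := (b - a) * G.
have G0 : 0 <= G := itg_sqr_ge0 _ _ _.
have B0 : 0 <= B by rewrite mulr_ge0 // ltW.
pose m := itg a b u / (b - a).
have dev x : a <= x <= b -> (u x - m) ^+ 2 <= B.
  move=> xab; have osc y : a <= y <= b -> u x - Num.sqrt B <= u y <= u x + Num.sqrt B.
    move=> yab; rewrite -ler_distl distrC -sqrtr_sqr ler_wsqrtr //.
    exact: prim_osc (ltW ab) p xab yab.
  have /andP[h1 h2] := itg_bounds (ltW ab) ui osc.
  have : `|m - u x| <= Num.sqrt B.
    by rewrite ler_distl /m ler_pdivlMr // ler_pdivrMr // h1.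
  rewrite -(ler_pXn2r (ltn0Sn 1)) ?nnegrE ?sqrtr_ge0 // sqr_sqrtr //.
  by rewrite real_normK ?num_real // -sqrrN opprB.
have um : sqi a b (fun t => u t - m) by apply: sqiB => //; exact: sqi_cst.
have e1 : itg a b (fun t => (u t - m) ^+ 2) <= B * (b - a).
  rewrite -(itg_cst B (ltW ab)); apply: itg_le => //; first exact: sqi_sqr.
  exact: itgable_cst.
have e2 : itg a b (fun t => (u t - m) ^+ 2) =
    itg a b (fun t => u t ^+ 2) - (b - a)^-1 * itg a b u ^+ 2.
  under eq_itg => t _.
    rewrite (_ : _ ^+ 2 = (u t ^+ 2 - 2 * m * u t) + m ^+ 2); last by ring.
    over.
  have i2 := itgableZ (2 * m) ui; have i3 := itgableB u2 i2.
  rewrite (itgD i3 (itgable_cst a b (m ^+ 2))) (itgB u2 i2) itgZ //.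
  by rewrite (itg_cst _ (ltW ab)) /m; field; exact: lt0r_neq0.
move: e1; rewrite e2 /B lerBlDr => /le_trans; apply.
by rewrite lerD2r mulrAC -expr2.
Qed.

(** Average over [t] the inequality [u(x)^2 <= 2 u(t)^2 + 2 (u(x) - u(t))^2] and use [prim_osc]. *)
Lemma trace_bound a b u g x : a < b -> primitive a b u g -> a <= x <= b ->
  u x ^+ 2 <= 2 / (b - a) * itg a b (fun t => u t ^+ 2) +
              2 * (b - a) * itg a b (fun t => g t ^+ 2).
Proof.
move=> ab p xab; have h0 : 0 < b - a by rewrite subr_gt0.
have u2 := sqi_sqr (prim_sqi p).
set G := itg a b (fun t => g t ^+ 2).
have : itg a b (fun=> u x ^+ 2) <= itg a b (fun t => 2 * u t ^+ 2 + 2 * ((b - a) * G)).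
  apply: itg_le; first exact: itgable_cst.
    by apply: itgableD; [exact: itgableZ|exact: itgable_cst].
  move=> t tab; have := prim_osc (ltW ab) p xab tab; rewrite -/G.
  have := sqr_ge0 (u x - 2 * u t); set q := (b - a) * G.
  rewrite !expr2; lra.
have i1 := itgableZ 2 u2; have i2 := itgable_cst a b (2 * ((b - a) * G)).
rewrite (itgD i1 i2) itgZ // !(itg_cst _ (ltW ab)).
rewrite -ler_pdivlMr // => /le_trans; apply; rewrite le_eqVlt; apply/orP; left; apply/eqP.
by field; exact: lt0r_neq0.
Qed.

(** [trace_bound] on a subinterval of length [h] containing [x]: a small [h] controls the derivative
    term uniformly in [n], and for this fixed [h] the other term tends to 0. *)
Lemma trace_cvg0 a b (u g : nat -> R -> R) (M : R) x : a < b ->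
  (forall n, primitive a b (u n) (g n)) ->
  (fun n => itg a b (fun t => u n t ^+ 2)) @ \oo --> (0 : R) ->
  (forall n, itg a b (fun t => g n t ^+ 2) <= M) ->
  a <= x <= b -> (fun n => u n x) @ \oo --> (0 : R).
Proof.
move=> ab p u0 gM xab; apply: cvg0_sqr; apply/cvg0_epsP => eps e0.
have M0 : 0 <= M by apply: le_trans (gM 0%N); exact: itg_sqr_ge0.
pose h := Num.min (b - a) (eps / (4 * (M + 1))).
have M1 : 0 < 4 * (M + 1) by rewrite mulr_gt0 // ltr_wpDl.
have h0 : 0 < h by rewrite lt_min subr_gt0 ab divr_gt0.
have hb : h <= b - a by rewrite ge_min lexx.
have he : h <= eps / (4 * (M + 1)) by rewrite ge_min lexx orbT.
have [c [ac cb cx]] : exists c, [/\ a <= c, c + h <= b & c <= x <= c + h].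
  case/andP: xab => ax xb; have [xh|xh] := leP x (b - h).
    by exists x; split => //; [lra|lra].
  by exists (b - h); split; [lra|lra|apply/andP; split; lra].
have ch : c < c + h by rewrite ltrDl.
have e1 : 0 < eps * h / 4 by rewrite divr_gt0 // mulr_gt0.
have /cvg0_epsP/(_ _ e1)[N HN] := u0; exists N => n /HN.
rewrite !ger0_norm ?itg_sqr_ge0 ?sqr_ge0 // => hu.
have pc := prim_sub (p n) ac cb.
apply: le_lt_trans (trace_bound ch pc cx) _.
have hh : c + h - c = h by rewrite addrC addKr.
rewrite hh.
have sub k : sqi a b k -> itg c (c + h) (fun t => k t ^+ 2) <= itg a b (fun t => k t ^+ 2).
  move=> /sqi_sqr ki; have acb := le_trans ac (ltW ch).
  rewrite (itg_split ac (le_trans (ltW ch) cb) ki).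
  rewrite (itg_split (ltW ch) cb (itgable_sub ac (lexx b) ki)).
  by rewrite addrCA lerDl addr_ge0 ?itg_sqr_ge0.
have s1 := le_lt_trans (sub _ (prim_sqi (p n))) hu.
have s2 := le_trans (sub _ (prim_sqi' (p n))) (gM n).
have t1 : 2 / h * itg c (c + h) (fun t => u n t ^+ 2) < eps / 2.
  rewrite mulrAC ltr_pdivrMr // mulrC -ltr_pdivlMr //; apply: lt_le_trans s1 _.
  by rewrite le_eqVlt; apply/orP; left; apply/eqP; field.
have t2 : 2 * h * itg c (c + h) (fun t => g n t ^+ 2) <= eps / 2.
  apply: (@le_trans _ _ (2 * h * M)); first by rewrite ler_wpM2l // mulr_ge0 // ltW.
  apply: (@le_trans _ _ (2 * (eps / (4 * (M + 1))) * M)).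
    by rewrite ler_wpM2r // ler_wpM2l.
  have -> : 2 * (eps / (4 * (M + 1))) * M = eps / 2 * (M / (M + 1)).
    by field; rewrite gt_eqF // ltr_wpDl.
  rewrite -[leRHS]mulr1 ler_wpM2l //; first by rewrite divr_ge0 // ltW.
  by rewrite ler_pdivrMr ?mul1r ?lerDl // ltr_wpDl.
lra.
Qed.

(* By Lebesgue differentiation. *)
Lemma itg_null a b h : a <= b -> sqi a b h ->
  (forall x, a <= x <= b -> itg a x h = 0) -> itg a b (fun t => h t ^+ 2) = 0.
Proof.
move=> ab hs H; pose h0 := h \_ `[a, b].
have hi := sqi_itgable hs.
have h0T : mu.-integrable [set: R] (EFin \o h0).
  by rewrite -restrict_EFin; apply/integrable_restrict => //; rewrite setTI.
have F0 x : \int[mu]_(t in `]-oo, x]) h0 t = 0.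
  rewrite /h0 -Rintegral_mkcondr.
  have [ax|xa] := leP a x; last first.
    rewrite (_ : `]-oo, x] `&` `[a, b] = set0)%classic ?Rintegral_set0 //.
    apply/seteqP; split=> // t /= [+ /=]; rewrite !in_itv /= => tx /andP[+ _].
    by rewrite leNgt (le_lt_trans tx).
  have [xb|bx] := leP x b.
    rewrite (_ : `]-oo, x] `&` `[a, b] = `[a, x])%classic; first by rewrite -/(itg a x h) H ?ax.
    apply/seteqP; split=> t /=; rewrite !in_itv /=; first by case=> -> /andP[->].
    by move=> /andP[-> tx]; rewrite tx (le_trans tx).
  rewrite (_ : `]-oo, x] `&` `[a, b] = `[a, b])%classic; first by rewrite -/(itg a b h) H ?ab /=.
  apply/setIidPr => t /=; rewrite !in_itv /= => /andP[_ tb]; exact: le_trans tb (ltW bx).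
have h0i y : mu.-integrable `]-oo, y] (EFin \o h0) by apply: integrableS h0T.
have := @FTC1Ny R h0 h0i (open_integrable_locally openT h0T).
have -> : (fun x => \int[mu]_(t in [set` `]-oo, x]]) h0 t) = fun=> 0.
  by apply: funext => x; exact: F0.
move=> ae; rewrite /itg /Rintegral.
rewrite (_ : (\int[mu]_(x in `[a, b]) (h x ^+ 2)%:E)%E = 0%E) //.
rewrite -(integral0 mu `[a, b]).
apply: ge0_ae_eq_integral => //.
- by apply/measurable_EFinP; apply: measurable_funX; exact: hs.1.
- by move=> x _; rewrite lee_fin sqr_ge0.
move: ae; apply: filterS; first exact: (ae_filter_ringOfSetsType mu).
move=> x [_ Hx] xab; move: Hx.
rewrite derive1_cst /h0 patchE mem_set // => <-.
by rewrite expr0n.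
Qed.

(** The derivatives have an L^2 limit [h] by completeness. Its integral over [[a, x]] is the limit
    of [u n x - u n a], which is 0 by [trace_cvg0], so [itg_null] applies to [h]. *)
Lemma prim_closable a b (u g : nat -> R -> R) : a < b ->
  (forall n, primitive a b (u n) (g n)) ->
  (fun n => itg a b (fun t => u n t ^+ 2)) @ \oo --> (0 : R) ->
  (forall eps : R, 0 < eps -> exists N, forall m n, (N <= m)%N -> (N <= n)%N ->
     itg a b (fun t => (g m t - g n t) ^+ 2) < eps) ->
  (fun n => itg a b (fun t => g n t ^+ 2)) @ \oo --> (0 : R).
Proof.
move=> ab p u0 cau; have gs n := prim_sqi' (p n).
have [h hs gh] := sqi_complete (ltW ab) gs cau.
have le2 n : itg a b (fun t => g n t ^+ 2) <=
    2 * itg a b (fun t => (g n t - h t) ^+ 2) + 2 * itg a b (fun t => h t ^+ 2).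
  have ds := sqi_sqr (sqiB (gs n) hs); have hs2 := sqi_sqr hs.
  rewrite -itgZ // -itgZ // -itgD; try exact: itgableZ.
  apply: itg_le; [exact: sqi_sqr|by apply: itgableD; exact: itgableZ|].
  move=> t _; have := sqr_ge0 (g n t - 2 * h t); rewrite !expr2; lra.
have [M HM] : exists M, forall n, itg a b (fun t => g n t ^+ 2) <= M.
  have [N HN] := (cvg0_epsP _).1 gh 1 ltr01.
  exists (\sum_(i < N) itg a b (fun t => g i t ^+ 2) + (2 + 2 * itg a b (fun t => h t ^+ 2))).
  have s0 m : 0 <= \sum_(i < m) itg a b (fun t => g i t ^+ 2).
    by apply: sumr_ge0 => i _; exact: itg_sqr_ge0.
  have := itg_sqr_ge0 a b h => h0 n.
  case: (ltnP n N) => [nN|/HN].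
    rewrite (bigD1 (Ordinal nN)) //= -addrA lerDl !addr_ge0 ?mulr_ge0 //.
    by apply: sumr_ge0 => i _; exact: itg_sqr_ge0.
  rewrite ger0_norm ?itg_sqr_ge0 // => lt1.
  have := le2 n; have := s0 N; lra.
have h0 : itg a b (fun t => h t ^+ 2) = 0.
  apply: (itg_null (ltW ab) hs) => x xab.
  have /andP[ax xb] := xab.
  have aab : a <= a <= b by rewrite lexx ltW.
  have c1 := trace_cvg0 ab p u0 HM xab; have c2 := trace_cvg0 ab p u0 HM aab.
  have c3 : (fun n => itg a x (g n)) @ \oo --> (0 : R).
    rewrite (_ : (fun n => _) = fun n => u n x - u n a).
      by rewrite -(subr0 0); exact: cvgB c1 c2.
    by apply: funext => n; rewrite ((p n).2 x xab) addrC addKr.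
  have c4 : (fun n => itg a x h - itg a x (g n)) @ \oo --> (0 : R).
    apply: cvg0_sqr; apply: cvg0_le (cvg0Ml (b - a) gh) => n.
    have si k : sqi a b k -> sqi a x k by exact: sqi_sub.
    rewrite ger0_norm ?sqr_ge0 // -itgB; try exact: sqi_itgable (si _ _).
    have ds := sqiB hs (gs n).
    apply: le_trans (itg_CS1 ax (si _ ds)) _.
    apply: ler_pM; rewrite ?subr_ge0 ?itg_sqr_ge0 ?lerB //.
    rewrite [leRHS](itg_split ax xb (sqi_sqr (sqiB (gs n) hs))).
    rewrite [leLHS](@eq_itg _ _ _ _ (fun t => (g n t - h t) ^+ 2)).
      by rewrite lerDl itg_sqr_ge0.
    by move=> t _; rewrite -sqrrN opprB.
  have := cvg0D c4 c3; under eq_fun do rewrite subrK.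
  exact: (cvg_unique (@Rhausdorff R) (cvg_cst _)).
apply: cvg0_le (cvg0Ml 2 gh) => n.
by rewrite ger0_norm ?itg_sqr_ge0 //; have := le2 n; rewrite h0 mulr0 addr0.
Qed.

Definition rH2 l u : Prop :=
  (forall x, x \in `[0, l] -> u x = u 0 + itg 0 x (rderiv l u)) /\
  exists h, sqi 0 l h /\
    forall x, x \in `[0, l] -> rderiv l u x = rderiv l u 0 + itg 0 x h.

Lemma rH2_prim l u : rH2 l u -> primitive 0 l u (rderiv l u).
Proof.
move=> [ug [h [hs gh]]]; split; last by move=> x xl; apply: ug; rewrite in_itv.
apply: (@eq_within_continuous _ _ _ (fun x => rderiv l u 0 + itg 0 x h)).
  by move=> x xl; rewrite [RHS]gh // in_itv.
apply: within_continuousD; first exact: within_continuous_cst.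
exact: itg_continuous (sqi_itgable hs).
Qed.

Lemma rH2_intro l u g h : 0 < l -> primitive 0 l u g -> sqi 0 l h ->
  (forall x, 0 <= x <= l -> g x = g 0 + itg 0 x h) -> rH2 l u.
Proof.
move=> l0 p hs gh; have dE x : 0 <= x <= l -> rderiv l u x = g x.
  by move=> xl; exact: rderiv_prim.
have l00 : 0 <= (0 : R) <= l by rewrite lexx ltW.
split; last first.
  by exists h; split => // x; rewrite in_itv => xl; rewrite !dE // gh.
move=> x; rewrite in_itv => xl; rewrite [LHS]p.2 //; congr (_ + _).
apply: eq_itg => t /andP[t0 tx]; rewrite dE // t0 /=.
by case/andP: xl => _; exact: le_trans.
Qed.

Lemma rH2_lin l c u v : 0 < l -> rH2 l u -> rH2 l v -> rH2 l (fun x => c * u x + v x).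
Proof.
move=> l0 Hu Hv; have pu := rH2_prim Hu; have pv := rH2_prim Hv.
have [_ [h [hs gh]]] := Hu; have [_ [k [ks gk]]] := Hv.
apply: (@rH2_intro _ _ _ (fun t => c * h t + k t) l0 (prim_lin c pu pv)).
  exact: sqi_lin.
move=> x xl; have /andP[x0 xl'] := xl.
rewrite gh ?in_itv // gk ?in_itv // itgD ?itgZ.
- by ring.
- exact: itgable_sub (lexx 0) xl' (sqi_itgable hs).
- by apply: itgableZ; exact: itgable_sub (lexx 0) xl' (sqi_itgable hs).
- exact: itgable_sub (lexx 0) xl' (sqi_itgable ks).
Qed.

Lemma rderiv_lin l c u v x : 0 < l -> rH2 l u -> rH2 l v -> 0 <= x <= l ->
  rderiv l (fun x => c * u x + v x) x = c * rderiv l u x + rderiv l v x.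
Proof.
move=> l0 Hu Hv xl.
exact: (rderiv_prim l0 (prim_lin c (rH2_prim Hu) (rH2_prim Hv)) xl).
Qed.

Lemma rH2_smooth l u g k : 0 < l -> primitive 0 l u g -> primitive 0 l g k -> rH2 l u.
Proof.
move=> l0 p q; apply: (rH2_intro l0 p (prim_sqi' q)); exact: q.2.
Qed.

End Estimates.

(** * Function spaces on a metric graph *)

Section Summation.
Variables (R : realType) (G : metric_graph R).
Implicit Types (F H : edge G -> R) (A B : set (edge G)).

Definition summ F : Prop :=
  exists M : R, forall A, finite_set A -> \sum_(e \in A) `|F e| <= M.

Lemma ler_fsum A F H : finite_set A -> (forall e, F e <= H e) ->
  \sum_(e \in A) F e <= \sum_(e \in A) H e.
Proof. by move=> fA FH; rewrite !fsbig_finite //=; apply: ler_sum. Qed.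

Lemma ler_fsum_subset A B F : finite_set A -> finite_set B -> A `<=` B ->
  (forall e, 0 <= F e) -> \sum_(e \in A) F e <= \sum_(e \in B) F e.
Proof.
move=> fA fB AB F0; rewrite -lee_fin -!fsumEFin //.
apply: lee_fsum_nneg_subset => //; last by move=> e _; rewrite lee_fin.
by move=> e; rewrite !inE; exact: AB.
Qed.

Lemma fsum_lin (c : R) A F H : finite_set A ->
  \sum_(e \in A) (c * F e + H e) = c * \sum_(e \in A) F e + \sum_(e \in A) H e.
Proof. by move=> fA; rewrite fsbig_split //= mulr_fsumr. Qed.

Lemma summ_le F H : (forall e, `|F e| <= H e) -> summ H -> summ F.
Proof.
move=> FH [M HM]; exists M => A fA; apply: le_trans (HM A fA).
by apply: ler_fsum => // e; exact: le_trans (FH e) (ler_norm _).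
Qed.

Lemma summ_lin c F H : summ F -> summ H -> summ (fun e => c * F e + H e).
Proof.
move=> [M HM] [K HK]; exists (`|c| * M + K) => A fA.
apply: (@le_trans _ _ (\sum_(e \in A) (`|c| * `|F e| + `|H e|))).
  by apply: ler_fsum => // e; rewrite -normrM; exact: ler_normD.
by rewrite fsum_lin // lerD ?HK // ler_wpM2l ?HM.
Qed.

Lemma summ_esum F : (forall e, 0 <= F e) ->
  summ F <-> (\esum_(e in [set: edge G]) (F e)%:E < +oo)%E.
Proof.
move=> F0; split=> [[M HM]|].
  apply: (@le_lt_trans _ _ M%:E); last exact: ltry.
  apply: ge_ereal_sup => _ [A [fA _] <-]; rewrite fsumEFin // lee_fin.
  apply: le_trans (HM A fA); apply: ler_fsum => // e; exact: ler_norm.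
set S := esum _ _ => Sy; have S0 : (0 <= S)%E by apply: esum_ge0 => e _; rewrite lee_fin.
have Sf : S \is a fin_num by rewrite ge0_fin_numE.
exists (fine S) => A fA; rewrite -lee_fin fineK // -fsumEFin //.
apply: ereal_sup_ubound; exists A => //.
by apply: eq_fsbigr => e _; rewrite ger0_norm.
Qed.

Let nneg_spec F : (forall e, 0 <= F e) -> summ F ->
  (forall A, finite_set A -> \sum_(e \in A) F e <= fine (\esum_(e in [set: edge G]) (F e)%:E)) /\
  forall eps : R, 0 < eps -> exists2 A, finite_set A &
    fine (\esum_(e in [set: edge G]) (F e)%:E) - eps < \sum_(e \in A) F e.
Proof.
move=> F0 /(summ_esum F0); set S := esum _ _ => Sy.
have S0 : (0 <= S)%E by apply: esum_ge0 => e _; rewrite lee_fin.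
have Sf : S \is a fin_num by rewrite ge0_fin_numE.
split=> [A fA|eps e0].
  by rewrite -lee_fin fineK // -fsumEFin //; apply: ereal_sup_ubound; exists A.
have [_ [A [fA _] <-]] := ub_ereal_sup_adherent e0 Sf.
by move=> h; exists A => //; rewrite -lte_fin EFinB fineK // -fsumEFin.
Qed.

(** [rsum] is built from positive and negative parts, where additivity is not visible. Convergence
    along finite sets of edges characterizes it, with [rsum_unique] as the converse, and linearity
    follows. *)
Lemma rsum_spec F : summ F -> forall eps : R, 0 < eps ->
  exists2 A, finite_set A & forall B, finite_set B -> A `<=` B ->
    `|\sum_(e \in B) F e - rsum F| <= eps.
Proof.
move=> sF eps e0.
have p0 e : 0 <= Num.max (F e) 0 by rewrite le_max lexx orbT.
have n0 e : 0 <= Num.max (- F e) 0 by rewrite le_max lexx orbT.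
have sp : summ (fun e => Num.max (F e) 0).
  apply: (@summ_le _ (fun e => `|F e|)).
    by move=> e; rewrite ger0_norm // ge_max ler_norm normr_ge0.
  by move: sF => [M HM]; exists M => A fA; under eq_fsbigr do rewrite normr_id; exact: HM.
have sn : summ (fun e => Num.max (- F e) 0).
  apply: (@summ_le _ (fun e => `|F e|)).
    by move=> e; rewrite ger0_norm // ge_max -normrN ler_norm normr_ge0.
  by move: sF => [M HM]; exists M => A fA; under eq_fsbigr do rewrite normr_id; exact: HM.
have [pu pe] := nneg_spec p0 sp; have [nu ne] := nneg_spec n0 sn.
have [A fA hA] := pe _ e0; have [A' fA' hA'] := ne _ e0.
exists (A `|` A'); first by rewrite finite_setU.
move=> B fB AB; have h1 := pu B fB; have h2 := nu B fB.
have h3 := ler_fsum_subset fA fB (subset_trans (@subsetUl _ A A') AB) p0.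
have h4 := ler_fsum_subset fA' fB (subset_trans (@subsetUr _ A A') AB) n0.
have -> : \sum_(e \in B) F e =
    \sum_(e \in B) Num.max (F e) 0 - \sum_(e \in B) Num.max (- F e) 0.
  have := fsum_lin (-1) (fun e => Num.max (- F e) 0) (fun e => Num.max (F e) 0) fB.
  rewrite mulN1r addrC => <-; apply: eq_fsbigr => e _.
  by rewrite /Num.max; case: ltrP => h; case: ltrP => h'; lra.
rewrite /rsum ler_norml; apply/andP; split; lra.
Qed.

Lemma rsum_unique F x : summ F ->
  (forall eps : R, 0 < eps -> exists2 A, finite_set A & forall B, finite_set B ->
     A `<=` B -> `|\sum_(e \in B) F e - x| <= eps) -> rsum F = x.
Proof.
move=> sF H; apply/eqP; rewrite -subr_eq0 -normr_eq0 eq_le normr_ge0 andbT.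
apply: le_of_eps => eps e0; have e2 : 0 < eps / 2 by rewrite divr_gt0.
have [A fA HA] := H _ e2; have [A' fA' HA'] := rsum_spec sF e2.
have fU : finite_set (A `|` A') by rewrite finite_setU.
have h1 := HA _ fU (@subsetUl _ _ _); have h2 := HA' _ fU (@subsetUr _ _ _).
move: h1 h2; set S := \sum_(e \in _) _.
rewrite !ler_norml => /andP[? ?] /andP[? ?]; apply/andP; split; lra.
Qed.

Lemma rsum_lin c F H : summ F -> summ H ->
  rsum (fun e => c * F e + H e) = c * rsum F + rsum H.
Proof.
move=> sF sH; apply: rsum_unique; first exact: summ_lin.
move=> eps e0; have c1 : 0 < `|c| + 1 by rewrite ltr_wpDl.
have e1 : 0 < eps / (`|c| + 1) / 2 by rewrite !divr_gt0.
have e2 : 0 < eps / 2 by rewrite divr_gt0.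
have [A fA HA] := rsum_spec sF e1; have [A' fA' HA'] := rsum_spec sH e2.
exists (A `|` A'); first by rewrite finite_setU.
move=> B fB AB; rewrite fsum_lin //.
have h1 := HA _ fB (subset_trans (@subsetUl _ A A') AB).
have h2 := HA' _ fB (subset_trans (@subsetUr _ A A') AB).
rewrite (_ : _ - _ = c * (\sum_(e \in B) F e - rsum F) + (\sum_(e \in B) H e - rsum H));
  last by ring.
apply: le_trans (ler_normD _ _) _; rewrite normrM [leRHS]splitr lerD //.
apply: le_trans (ler_wpM2l (normr_ge0 c) h1) _.
rewrite mulrA ler_pM2r ?invr_gt0 // mulrA ler_pdivrMr // mulrC ler_wpM2l ?(ltW e0) //.
by rewrite lerDl.
Qed.

Lemma rsumN F : summ F -> rsum (fun e => - F e) = - rsum F.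
Proof.
move=> sF; have s0 : summ (fun _ : edge G => 0).
  by exists 0 => A fA; under eq_fsbigr do rewrite normr0; rewrite fsbig1.
have r0 : rsum (fun _ : edge G => 0) = 0.
  apply: rsum_unique => // eps e0; exists set0 => // B fB _.
  by rewrite fsbig1 // subrr normr0 ltW.
have := rsum_lin (-1) sF s0; rewrite r0 addr0 mulN1r => <-.
by congr rsum; apply: funext => e; rewrite mulN1r addr0.
Qed.

Lemma rsum_ge0 F : (forall e, 0 <= F e) ->
  rsum F = fine (\esum_(e in [set: edge G]) (F e)%:E).
Proof.
move=> F0; rewrite /rsum [X in _ - fine X]esum1 ?subr0.
  by congr fine; apply: eq_esum => e _; rewrite max_l.
by move=> e _; rewrite max_r // oppr_le0.
Qed.

Lemma rsum_pos F : (forall e, 0 <= F e) -> 0 <= rsum F.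
Proof. by move=> F0; rewrite rsum_ge0 // fine_ge0 // esum_ge0 // => e _; rewrite lee_fin. Qed.

Lemma fsum_le_rsum F A : (forall e, 0 <= F e) -> summ F -> finite_set A ->
  \sum_(e \in A) F e <= rsum F.
Proof. by move=> F0 sF fA; rewrite rsum_ge0 //; exact: (nneg_spec F0 sF).1. Qed.

Lemma rsum_le_bound F (M : R) : (forall e, 0 <= F e) ->
  (forall A, finite_set A -> \sum_(e \in A) F e <= M) -> summ F /\ rsum F <= M.
Proof.
move=> F0 HM; have sF : summ F.
  by exists M => A fA; under eq_fsbigr do rewrite ger0_norm //; exact: HM.
split=> //; rewrite rsum_ge0 //; apply: le_of_eps => eps e0.
have [A fA h] := (nneg_spec F0 sF).2 _ e0; have := HM A fA; lra.
Qed.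

Lemma summ_finite F A : finite_set A -> (forall e, ~ A e -> F e = 0) -> summ F.
Proof.
move=> fA F0; exists (\sum_(e \in A) `|F e|) => B fB.
rewrite (_ : \sum_(e \in B) _ = \sum_(e \in A `&` B) `|F e|).
  by apply: ler_fsum_subset => //; exact: finite_setIl.
apply/esym/fsbig_widen => // e [Be nAB] /=; rewrite F0 ?normr0 //.
by move=> Ae; apply: nAB.
Qed.

Lemma rsum_finite F A : finite_set A -> (forall e, ~ A e -> F e = 0) ->
  rsum F = \sum_(e \in A) F e.
Proof.
move=> fA F0; apply: rsum_unique; first exact: summ_finite F0.
move=> eps e0; exists A => // B fB AB.
rewrite -(@fsbig_widen _ _ _ _ A B) ?subrr ?normr0 ?ltW // => e [_ nA] /=.
exact: F0.
Qed.

Definition csummable (F : edge G -> R[i]) : Prop :=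
  summ (fun e => re (F e)) /\ summ (fun e => im (F e)).

Lemma csummable_le (F : edge G -> R[i]) H : (forall e, normc (F e) <= H e) -> summ H ->
  csummable F.
Proof.
move=> FH sH; split; apply: summ_le sH => e; apply: le_trans (FH e).
  exact: abs_re_le.
exact: abs_im_le.
Qed.

Lemma csum_lin (c : R[i]) (F K : edge G -> R[i]) : csummable F -> csummable K ->
  csum (fun e => c * F e + K e) = c * csum F + csum K.
Proof.
move=> [F1 F2] [K1 K2]; apply: complexP => /=.
  rewrite re_add re_mul /= -addrA -mulNr.
  rewrite -(rsum_lin (- im c) F2 K1) -(rsum_lin (re c) F1 (summ_lin _ F2 K1)).
  by congr rsum; apply: funext => e; rewrite re_add re_mul; ring.
rewrite im_add im_mul /= -addrA.
rewrite -(rsum_lin (im c) F1 K2) -(rsum_lin (re c) F2 (summ_lin _ F1 K2)).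
by congr rsum; apply: funext => e; rewrite im_add im_mul; ring.
Qed.

Lemma csum_conj (F : edge G -> R[i]) : csummable F ->
  csum (fun e => conjc (F e)) = conjc (csum F).
Proof.
move=> [_ F2]; apply: complexP => /=.
  by congr rsum; apply: funext => e; rewrite re_conj.
by rewrite -rsumN //; congr rsum; apply: funext => e; rewrite im_conj.
Qed.

Variables (V : lmodType R[i]) (C : edge G -> set V) (b : edge G -> V -> V -> R[i]).
Hypothesis bS : forall e, sesq (C e) (b e).
Implicit Types (f g : edge G -> V) (e : edge G).

Let Q f e := re (b e (f e) (f e)).

(** The Hilbert direct sum of abstract edge spaces; its completeness then serves both for functions
    and for their derivatives. *)
Definition dsum : set (edge G -> V) := [set f | (forall e, C e (f e)) /\ summ (Q f)].

Definition dsum_ip f g : R[i] := csum (fun e => b e (f e) (g e)).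

Let Q0 f e : (forall e, C e (f e)) -> 0 <= Q f e.
Proof. by move=> Cf; exact: sesq_ge0 (bS e) _ (Cf e). Qed.

Let Q_lin (c : R[i]) f g e : (forall e, C e (f e)) -> (forall e, C e (g e)) ->
  Q (c *: f + g) e <= 2 * normc c ^+ 2 * Q f e + 2 * Q g e.
Proof.
move=> Cf Cg; have Ccf := sesqZ (bS e) c (Cf e).
rewrite /Q -!(snorm_sqr (bS e)) //; last exact: sesqD (bS e) _ _ Ccf (Cg e).
have := snorm_add (bS e) Ccf (Cg e); rewrite (snormZ (bS e)) //.
rewrite -(ler_pXn2r (ltn0Sn 1)) ?nnegrE ?addr_ge0 ?mulr_ge0 ?normc_ge0 ?snorm_ge0 //.
move=> /le_trans; apply; set p := normc c; set x := snorm _ _; set y := snorm _ _.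
have := sqr_ge0 (p * x - y); rewrite sqrrB sqrrD exprMn !mulr2n; lra.
Qed.

Let dsum_csummable f g : dsum f -> dsum g -> csummable (fun e => b e (f e) (g e)).
Proof.
move=> [Cf sf] [Cg sg]; apply: (@csummable_le _ (fun e => 1 * Q f e + Q g e)).
  move=> e; apply: le_trans (sesq_CS (bS e) (Cf e) (Cg e)) _.
  rewrite mul1r /Q -!(snorm_sqr (bS e)) //.
  have := sqr_ge0 (snorm (b e) (f e) - snorm (b e) (g e)).
  have := mulr_ge0 (snorm_ge0 (b e) (f e)) (snorm_ge0 (b e) (g e)).
  rewrite sqrrB mulr2n; lra.
exact: summ_lin.
Qed.

Let dsum_lin (c : R[i]) f g : dsum f -> dsum g -> dsum (c *: f + g).
Proof.
move=> [Cf sf] [Cg sg]; have CL e : C e ((c *: f + g) e) := sesq_lin (bS e) c (Cf e) (Cg e).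
split=> //; apply: (@summ_le _ (fun e => 2 * normc c ^+ 2 * Q f e + (2 * Q g e + 0))).
  by move=> e; rewrite ger0_norm ?Q0 // addr0; exact: Q_lin.
apply: summ_lin => //; apply: summ_lin => //.
by exists 0 => A fA; under eq_fsbigr do rewrite normr0; rewrite fsbig1.
Qed.

Lemma re_dsum_ip f : re (dsum_ip f f) = rsum (Q f). Proof. by []. Qed.

Lemma dsum_sesq : sesq dsum dsum_ip.
Proof.
split=> //.
- have C0 e : C e 0 := sesq0 (bS e).
  split=> //; exists 0 => A fA; rewrite fsbig1 // => e _.
  have -> : Q 0 e = 0 by rewrite /Q [b e _ _](sesq0l (bS e)).
  exact: normr0.
- move=> c f g h Df Dg Dh; rewrite /dsum_ip -csum_lin; try exact: dsum_csummable.
  congr csum; apply: funext => e.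
  by case: Df Dg Dh => Cf _ [Cg _] [Ch _]; rewrite -(sesqPl (bS e)).
- move=> f g Df Dg; rewrite /dsum_ip -csum_conj; last exact: dsum_csummable.
  congr csum; apply: funext => e.
  by case: Df Dg => Cf _ [Cg _]; rewrite (sesqC (bS e)).
- by move=> f [Cf _]; rewrite re_dsum_ip; apply: rsum_pos => e; exact: Q0.
Qed.

Hypothesis bC : forall e (u : nat -> V), (forall n, C e (u n)) ->
  (forall eps : R, 0 < eps -> exists N, forall m n, (N <= m)%N -> (N <= n)%N ->
     snorm (b e) (u m - u n) < eps) ->
  exists2 f, C e f & (fun n => snorm (b e) (u n - f)) @ \oo --> (0 : R).

Lemma dsum_complete (u : nat -> edge G -> V) : (forall n, dsum (u n)) ->
  (forall eps : R, 0 < eps -> exists N, forall m n, (N <= m)%N -> (N <= n)%N ->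
     snorm dsum_ip (u m - u n) < eps) ->
  exists2 f, dsum f & (fun n => snorm dsum_ip (u n - f)) @ \oo --> (0 : R).
Proof.
move=> Du cau; have Cu n e : C e (u n e) := (Du n).1 e.
have Dd m n : dsum (u m - u n) := sesqB dsum_sesq (Du m) (Du n).
have Qle m n A : finite_set A ->
    \sum_(e \in A) Q (u m - u n) e <= snorm dsum_ip (u m - u n) ^+ 2.
  move=> fA; rewrite (snorm_sqr dsum_sesq) // re_dsum_ip.
  apply: fsum_le_rsum => //; last exact: (Dd m n).2.
  by move=> e; apply: Q0; exact: (Dd m n).1.
have /choice[f fP] : forall e, exists f : V, C e f /\
    (fun n => snorm (b e) (u n e - f)) @ \oo --> (0 : R).
  move=> e; have [|eps e0|f Cf uf] := bC (e := e) (u := fun n => u n e); last by exists f.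
    by move=> n; exact: Cu.
  have [N HN] := cau _ e0; exists N => m n /HN H /H; apply: le_lt_trans.
  rewrite -(ler_pXn2r (ltn0Sn 1)) ?nnegrE ?snorm_ge0 //.
  rewrite (snorm_sqr (bS e)); last exact: sesqB (bS e) _ _ (Cu m e) (Cu n e).
  by have := Qle m n [set e] (finite_set1 e); rewrite fsbig_set1.
have Cf e : C e (f e) := (fP e).1.
(* The Cauchy bound holds for partial sums over any finite [A]. Letting [m] tend to infinity keeps
   it, with [N] independent of [A], as summation over all edges requires. *)
have main eps : 0 < eps -> exists N, forall n, (N <= n)%N -> forall A, finite_set A ->
    \sum_(e \in A) Q (u n - f) e <= eps.
  move=> e0; have e1 : 0 < Num.sqrt (eps / 4) by rewrite sqrtr_gt0 divr_gt0.
  have [N HN] := cau _ e1; exists N => n Nn A fA.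
  have lim : (fun m => \sum_(e \in A) Q (u m - f) e) @ \oo --> (0 : R).
    under eq_fun do rewrite fsbig_finite //=.
    elim: (finmap.enum_fset _) => [|e s IH].
      by under eq_fun do rewrite big_nil; exact: cvg_cst.
    under eq_fun do rewrite big_cons; apply: cvg0D => //.
    rewrite (_ : (fun m => _) = fun m => snorm (b e) (u m e - f e) * snorm (b e) (u m e - f e)).
      by rewrite -[0](mulr0 0); apply: cvgM; exact: (fP e).2.
    apply: funext => m; rewrite -expr2 (snorm_sqr (bS e)) //.
    exact: sesqB (bS e) _ _ (Cu m e) (Cf e).
  have /cvg0_epsP/(_ (eps / 4) (divr_gt0 e0 (ltr0n _ 4)))[M HM] := lim.
  pose m := maxn N M; have := HM m (leq_maxr _ _) => /(le_lt_trans (ler_norm _)) h1.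
  have h2 : \sum_(e \in A) Q (u n - u m) e <= eps / 4.
    apply: le_trans (Qle n m A fA) _.
    have := HN n m Nn (leq_maxl _ _); set s := snorm _ _ => hs.
    rewrite -[leRHS]sqr_sqrtr ?ler_pXn2r ?nnegrE ?sqrtr_ge0 ?snorm_ge0 //; last first.
      by rewrite ltW // divr_gt0.
    exact: ltW.
  have : \sum_(e \in A) Q (u n - f) e <=
      \sum_(e \in A) (2 * Q (u n - u m) e + (2 * Q (u m - f) e + 0)).
    apply: ler_fsum => // e.
    have C1 e' : C e' ((u n - u m) e') := sesqB (bS e') (Cu n e') (Cu m e').
    have C2 e' : C e' ((u m - f) e') := sesqB (bS e') (Cu m e') (Cf e').
    have := Q_lin 1 e C1 C2; rewrite ComplexField.Normc.normc1 expr1n mulr1 addr0.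
    by rewrite scale1r subrKA.
  have z : \sum_(e \in A) (0 : R) = 0 by rewrite fsbig1.
  rewrite !fsum_lin // z addr0; lra.
have Cd n e : C e ((u n - f) e) := sesqB (bS e) (Cu n e) (Cf e).
have Df : dsum f.
  have [N /(_ N (leqnn N)) HN] := main 1 ltr01.
  have [sN _] := rsum_le_bound (fun e => Q0 e (Cd N)) HN.
  have DN : dsum (u N - f) by split.
  by have := dsum_lin (-1) DN (Du N); rewrite scaleN1r opprB subrK.
exists f => //; apply/cvg0_epsP => eps e0.
have e2 : 0 < (eps / 2) ^+ 2 by rewrite exprn_gt0 // divr_gt0.
have [N HN] := main _ e2; exists N => n /HN /(rsum_le_bound (fun e => Q0 e (Cd n)))[_ h].
rewrite ger0_norm ?snorm_ge0 //; apply: (@le_lt_trans _ _ (eps / 2)); last first.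
  by rewrite ltr_pdivrMr // ltr_pMr // ltr1n.
rewrite -(ler_pXn2r (ltn0Sn 1)) ?nnegrE ?snorm_ge0 ?divr_ge0 ?(ltW e0) //.
by rewrite (snorm_sqr dsum_sesq) //; exact: sesqB dsum_sesq _ _ (Du n) Df.
Qed.

End Summation.

(** * L^2 and H^2 on a single edge *)

Section EdgeSpace.
Variables (R : realType) (l : R).
Implicit Types (f g h : R -> R[i]).

Definition edge_L2 : set (R -> R[i]) :=
  [set f | cmeasurable l f /\ (sqint l f < +oo)%E].

Definition edge_ip f g : R[i] := cintegral l (fun t => f t * conjc (g t)).

Lemma edge_L2P f : edge_L2 f <->
  sqi 0 l (fun t => re (f t)) /\ sqi 0 l (fun t => im (f t)).
Proof.
split=> [[[mr mi] fin]|[fr fi]].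
  have mn : measurable_fun `[0, l] (fun t => normc (f t) ^+ 2).
    rewrite (_ : (fun t => _) = fun t => re (f t) ^+ 2 + im (f t) ^+ 2).
      by apply: measurable_funD; exact: measurable_funX.
    by apply: funext => t; exact: normc_sqr.
  have le (k : R -> R) : measurable_fun `[0, l] k -> (forall t, k t ^+ 2 <= normc (f t) ^+ 2) ->
      sqi 0 l k.
    move=> mk kf; split=> //; apply: le_lt_trans fin; apply: ge0_le_integral => //.
    - by move=> t _; rewrite lee_fin sqr_ge0.
    - by apply/measurable_EFinP; exact: measurable_funX.
    - exact/measurable_EFinP.
    - by move=> t _; rewrite lee_fin.
  split; apply: le => // t; rewrite normc_sqr; [rewrite lerDl|rewrite lerDr];
    exact: sqr_ge0.
split; first by split; [exact: fr.1|exact: fi.1].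
rewrite /sqint; under eq_integral do rewrite normc_sqr.
have /integrableP[_] := itgableD (sqi_sqr fr) (sqi_sqr fi).
apply: le_lt_trans; rewrite le_eqVlt; apply/orP; left; apply/eqP.
by apply: eq_integral => t _ /=; rewrite ger0_norm // addr_ge0 ?sqr_ge0.
Qed.

Lemma edge_ip_self f : edge_ip f f =
  (itg 0 l (fun t => re (f t) ^+ 2 + im (f t) ^+ 2))%:C.
Proof.
apply: complexP => /=.
  by apply: eq_itg => t _; rewrite mulc_conj normc_sqr.
rewrite -[RHS](itg0 (0 : R) l); apply: eq_itg => t _.
by rewrite mulc_conj.
Qed.

Lemma re_edge_ip_self f : edge_L2 f -> re (edge_ip f f) =
  itg 0 l (fun t => re (f t) ^+ 2) + itg 0 l (fun t => im (f t) ^+ 2).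
Proof.
move=> /edge_L2P[fr fi]; rewrite edge_ip_self /= itgD //; exact: sqi_sqr.
Qed.

Lemma sqint_edge_ip f : edge_L2 f -> sqint l f = (re (edge_ip f f))%:E.
Proof.
move=> Lf; have /edge_L2P[fr fi] := Lf; rewrite edge_ip_self /= /itg /Rintegral fineK.
  by apply: eq_integral => t _; rewrite normc_sqr.
apply: integrable_fin_num => //.
exact: itgableD (sqi_sqr fr) (sqi_sqr fi).
Qed.

Lemma re_edge_ip f g : edge_L2 f -> edge_L2 g -> re (edge_ip f g) =
  itg 0 l (fun t => re (f t) * re (g t)) + itg 0 l (fun t => im (f t) * im (g t)).
Proof.
move=> /edge_L2P[fr fi] /edge_L2P[gr gi]; rewrite -itgD; try exact: itgableM.
by apply: eq_itg => t _; rewrite re_mul re_conj im_conj mulrN opprK.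
Qed.

Lemma im_edge_ip f g : edge_L2 f -> edge_L2 g -> im (edge_ip f g) =
  itg 0 l (fun t => im (f t) * re (g t)) - itg 0 l (fun t => re (f t) * im (g t)).
Proof.
move=> /edge_L2P[fr fi] /edge_L2P[gr gi]; rewrite -itgB; try exact: itgableM.
by apply: eq_itg => t _; rewrite im_mul re_conj im_conj mulrN addrC.
Qed.

Lemma eq_edge_ip f f' g g' : (forall t, 0 <= t <= l -> f t = f' t) ->
  (forall t, 0 <= t <= l -> g t = g' t) -> edge_ip f g = edge_ip f' g'.
Proof.
by move=> ff gg; apply: complexP => /=; apply: eq_itg => t tl; rewrite ff // gg.
Qed.

Lemma edge_sesq : sesq edge_L2 edge_ip.
Proof.
have L0 : edge_L2 (0 : R -> R[i]) by apply/edge_L2P; split; exact: sqi_cst.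
have Llin (c : R[i]) f g : edge_L2 f -> edge_L2 g -> edge_L2 (c *: f + g).
  move=> /edge_L2P[fr fi] /edge_L2P[gr gi]; apply/edge_L2P; split.
    have := sqi_lin (re c) fr (sqi_lin (- im c) fi gr); congr sqi; apply: funext => t.
    by rewrite [RHS]re_add [in RHS]re_mul /=; ring.
  have := sqi_lin (re c) fi (sqi_lin (im c) fr gi); congr sqi; apply: funext => t.
  by rewrite [RHS]im_add [in RHS]im_mul /=; ring.
split=> //.
- move=> c f g h Lf Lg Lh; have Lfg := Llin c f g Lf Lg.
  have /edge_L2P[fr fi] := Lf; have /edge_L2P[gr gi] := Lg; have /edge_L2P[hr hi] := Lh.
  have rE t : re ((c *: f + g) t) = re c * re (f t) - im c * im (f t) + re (g t).
    by rewrite [LHS]re_add [in LHS]re_mul.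
  have iE t : im ((c *: f + g) t) = re c * im (f t) + im c * re (f t) + im (g t).
    by rewrite [LHS]im_add [in LHS]im_mul.
  have lin (x y : R) (k1 k2 k3 k : R -> R) : sqi 0 l k1 -> sqi 0 l k2 -> sqi 0 l k3 ->
     sqi 0 l k -> itg 0 l (fun t => (x * k1 t + y * k2 t + k3 t) * k t) =
      x * itg 0 l (fun t => k1 t * k t) + y * itg 0 l (fun t => k2 t * k t) +
      itg 0 l (fun t => k3 t * k t).
    move=> s1 s2 s3 s4; have m1 := itgableM s1 s4; have m2 := itgableM s2 s4.
    have m3 := itgableM s3 s4.
    rewrite -(itgZ x m1) -(itgZ y m2) -(itgD (itgableZ x m1) (itgableZ y m2)).
    rewrite -(itgD (itgableD (itgableZ x m1) (itgableZ y m2)) m3).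
    by apply: eq_itg => t _; ring.
  apply: complexP.
    rewrite re_add re_mul !re_edge_ip // !im_edge_ip //.
    under eq_itg do rewrite rE -mulNr.
    under [X in _ + X = _]eq_itg do rewrite iE.
    by rewrite !lin //; ring.
  rewrite im_add im_mul !re_edge_ip // !im_edge_ip //.
  under eq_itg do rewrite iE.
  under [X in _ - X = _]eq_itg do rewrite rE -mulNr.
  by rewrite !lin //; ring.
- move=> f g Lf Lg; apply: complexP.
    rewrite re_conj !re_edge_ip //; congr (_ + _); apply: eq_itg => t _; exact: mulrC.
  rewrite im_conj !im_edge_ip // opprB.
  congr (_ - _); apply: eq_itg => t _; exact: mulrC.
- move=> f Lf; rewrite re_edge_ip_self //; apply: addr_ge0; exact: itg_sqr_ge0.
Qed.

Lemma edge_complete (u : nat -> R -> R[i]) : 0 <= l -> (forall n, edge_L2 (u n)) ->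
  (forall eps : R, 0 < eps -> exists N, forall m n, (N <= m)%N -> (N <= n)%N ->
     snorm edge_ip (u m - u n) < eps) ->
  exists2 f, edge_L2 f & (fun n => snorm edge_ip (u n - f)) @ \oo --> (0 : R).
Proof.
move=> l0 Lu cau.
have ur n : sqi 0 l (fun t => re (u n t)) by have /edge_L2P[] := Lu n.
have ui n : sqi 0 l (fun t => im (u n t)) by have /edge_L2P[] := Lu n.
have Ld m n := sesqB edge_sesq (Lu m) (Lu n).
have nE m n : snorm edge_ip (u m - u n) ^+ 2 =
    itg 0 l (fun t => (re (u m t) - re (u n t)) ^+ 2) +
    itg 0 l (fun t => (im (u m t) - im (u n t)) ^+ 2).
  rewrite (snorm_sqr edge_sesq) // re_edge_ip_self //; congr (_ + _).
    by apply: eq_itg => t _; rewrite [in LHS]re_add re_opp.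
  by apply: eq_itg => t _; rewrite [in LHS]im_add im_opp.
have cau2 eps : 0 < eps -> exists N, forall m n, (N <= m)%N -> (N <= n)%N ->
     snorm edge_ip (u m - u n) ^+ 2 < eps.
  move=> e0; have e1 : 0 < Num.sqrt eps by rewrite sqrtr_gt0.
  have [N HN] := cau _ e1; exists N => m n mN nN.
  rewrite -[ltRHS]sqr_sqrtr ?(ltW e0) // ltr_pXn2r ?nnegrE ?snorm_ge0 ?sqrtr_ge0 //.
  exact: HN.
have [fr frs frc] : exists2 fr, sqi 0 l fr &
    (fun n => itg 0 l (fun t => (re (u n t) - fr t) ^+ 2)) @ \oo --> (0 : R).
  apply: sqi_complete => // eps /cau2[N HN]; exists N => m n mN nN.
  apply: le_lt_trans (HN m n mN nN); rewrite nE lerDl; exact: itg_sqr_ge0.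
have [fi fis fic] : exists2 fi, sqi 0 l fi &
    (fun n => itg 0 l (fun t => (im (u n t) - fi t) ^+ 2)) @ \oo --> (0 : R).
  apply: sqi_complete => // eps /cau2[N HN]; exists N => m n mN nN.
  apply: le_lt_trans (HN m n mN nN); rewrite nE lerDr; exact: itg_sqr_ge0.
have Lf : edge_L2 (fun t => fr t +i* fi t) by apply/edge_L2P.
exists (fun t => fr t +i* fi t) => //.
apply: cvg0_sqr.
rewrite (_ : (fun n => _) = fun n => itg 0 l (fun t => (re (u n t) - fr t) ^+ 2) +
  itg 0 l (fun t => (im (u n t) - fi t) ^+ 2)); first exact: cvg0D.
apply: funext => n; have LB := sesqB edge_sesq (Lu n) Lf.
rewrite (snorm_sqr edge_sesq) // re_edge_ip_self //; congr (_ + _).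
  by apply: eq_itg => t _; rewrite [in LHS]re_add re_opp.
by apply: eq_itg => t _; rewrite [in LHS]im_add im_opp.
Qed.

Lemma H2P f : H2 l f <-> rH2 l (fun t => re (f t)) /\ rH2 l (fun t => im (f t)).
Proof.
split=> [[fE [h [mh hfin gE]]]|[[fr [hr [hrs gr]]] [fi [hi [his gi]]]]].
  have /edge_L2P[hr hi] : edge_L2 h by split.
  split; split.
  - by move=> x xl; rewrite fE // re_add.
  - exists (fun t => re (h t)); split=> // x xl.
    by have := congr1 (@complex.Re R) (gE x xl); rewrite re_add.
  - by move=> x xl; rewrite fE // im_add.
  - exists (fun t => im (h t)); split=> // x xl.
    by have := congr1 (@complex.Im R) (gE x xl); rewrite im_add.
split.
  by move=> x xl; apply: complexP; rewrite ?re_add ?im_add; [exact: fr|exact: fi].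
exists (fun t => hr t +i* hi t).
have [mh hfin] : edge_L2 (fun t => hr t +i* hi t) by apply/edge_L2P.
split=> // x xl; apply: complexP; rewrite ?re_add ?im_add /=; [exact: gr|exact: gi].
Qed.

Lemma H2_prim f : H2 l f ->
  primitive 0 l (fun t => re (f t)) (fun t => re (cderiv l f t)) /\
  primitive 0 l (fun t => im (f t)) (fun t => im (cderiv l f t)).
Proof. by move=> /H2P[/rH2_prim ? /rH2_prim ?]. Qed.

Lemma H2_L2 f : H2 l f -> edge_L2 f.
Proof. by move=> /H2_prim[pr pi]; apply/edge_L2P; split; [exact: prim_sqi pr|exact: prim_sqi pi]. Qed.

Lemma H2_deriv_L2 f : H2 l f -> edge_L2 (cderiv l f).
Proof. by move=> /H2_prim[pr pi]; apply/edge_L2P; split; [exact: prim_sqi' pr|exact: prim_sqi' pi]. Qed.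

Hypothesis l0 : 0 < l.

Let lin_parts (c : R[i]) f g : H2 l f -> H2 l g ->
  [/\ rH2 l (fun t => - im c * im (f t) + re (g t)),
      rH2 l (fun t => im c * re (f t) + im (g t)),
      (fun t => re ((c *: f + g) t)) =
        (fun t => re c * re (f t) + (- im c * im (f t) + re (g t))) &
      (fun t => im ((c *: f + g) t)) =
        (fun t => re c * im (f t) + (im c * re (f t) + im (g t)))].
Proof.
move=> /H2P[fr fi] /H2P[gr gi]; split; [exact: rH2_lin|exact: rH2_lin| |].
  by apply: funext => t; rewrite [LHS]re_add [in LHS]re_mul; ring.
by apply: funext => t; rewrite [LHS]im_add [in LHS]im_mul; ring.
Qed.

Lemma H2_lin (c : R[i]) f g : H2 l f -> H2 l g -> H2 l (c *: f + g).
Proof.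
move=> Hf Hg; have [p1 p2 e1 e2] := lin_parts c Hf Hg.
have /H2P[fr fi] := Hf; apply/H2P; rewrite e1 e2.
by split; apply: rH2_lin.
Qed.

Lemma cderiv_lin (c : R[i]) f g x : H2 l f -> H2 l g -> 0 <= x <= l ->
  cderiv l (c *: f + g) x = c * cderiv l f x + cderiv l g x.
Proof.
move=> Hf Hg xl; have [p1 p2 e1 e2] := lin_parts c Hf Hg.
have /H2P[fr fi] := Hf; have /H2P[gr gi] := Hg.
apply: complexP; rewrite ?re_add ?im_add ?re_mul ?im_mul [LHS]/=.
  by rewrite e1 !rderiv_lin //=; ring.
by rewrite e2 !rderiv_lin //=; ring.
Qed.

Lemma cderiv_eq f g x : H2 l g -> (forall t, 0 <= t <= l -> f t = g t) ->
  0 <= x <= l -> cderiv l f x = cderiv l g x.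
Proof.
move=> /H2_prim[gr gi] fg xl; apply: complexP.
  apply: (rderiv_prim l0 _ xl); apply: eq_prim gr => // t tl; by rewrite fg.
apply: (rderiv_prim l0 _ xl); apply: eq_prim gi => // t tl; by rewrite fg.
Qed.

Lemma H2_0 : H2 l 0.
Proof.
have z : rH2 l (fun=> 0) by apply: (rH2_smooth l0) (prim_cst _ _ 0) (prim_cst _ _ 0).
by apply/H2P; split.
Qed.

Lemma cderiv_0 f x : (forall t, 0 <= t <= l -> f t = 0) -> 0 <= x <= l ->
  cderiv l f x = 0.
Proof.
move=> f0 xl; rewrite (cderiv_eq H2_0 f0 xl); apply: complexP => /=;
  exact: (rderiv_prim l0 (prim_cst _ _ 0) xl).
Qed.

End EdgeSpace.

Lemma cvg0_expr2 (R : realType) (w : nat -> R) :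
  w @ \oo --> (0 : R) -> (fun n => w n ^+ 2) @ \oo --> (0 : R).
Proof.
move=> w0; rewrite (_ : (fun n => _) = fun n => w n * w n).
  by rewrite -[0](mulr0 0); exact: cvgM.
by apply: funext => n; rewrite expr2.
Qed.

(** * L^2 and the energy form on the graph *)

Section GraphSpace.
Variables (R : realType) (G : metric_graph R).
Implicit Types (f g h : edge G -> R -> R[i]) (e : edge G).

Let C e : set (R -> R[i]) := edge_L2 (len e).
Let b e := edge_ip (R := R) (len e).
Let bS e : sesq (C e) (b e) := edge_sesq (len e).

Lemma L2E : @L2 R G = dsum C b.
Proof.
apply/seteqP; split=> f.
  move=> [mf fin]; have Cf e : C e (f e).
    split; first exact: mf.
    apply: le_lt_trans fin; apply: ereal_sup_ubound; exists [set e] => //.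
    by rewrite fsbig_set1.
  split=> //; apply/summ_esum; first by move=> e; exact: sesq_ge0 (bS e) _ (Cf e).
  by apply: le_lt_trans fin; apply: le_esum => e _; rewrite (sqint_edge_ip (Cf e)).
move=> [Cf sf]; split; first by move=> e; exact: (Cf e).1.
have /summ_esum := sf; rewrite -/(esum _ _) => H.
apply: le_lt_trans (H _) => [|e]; last exact: sesq_ge0 (bS e) _ (Cf e).
by apply: le_esum => e _; rewrite (sqint_edge_ip (Cf e)).
Qed.

Lemma hilbert_L2 : hilbert (L2_space G).
Proof.
split.
  have := dsum_sesq bS; rewrite -L2E; exact.
move=> u Cu cau; have Du n : dsum C b (u n) by rewrite -L2E; exact: Cu.
have [|f Df uf] := dsum_complete bS _ Du cau.
  by move=> e v Cv cv; apply: edge_complete => //; exact: ltW (len_gt0 e).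
by exists f => //; rewrite /= L2E.
Qed.

Definition deriv f e : R -> R[i] := cderiv (len e) (f e).

Lemma L2_ipE f g : L2_ip f g = dsum_ip b f g. Proof. by []. Qed.

Lemma energyE f g : energy f g = dsum_ip b (deriv f) (deriv g). Proof. by []. Qed.

Definition edge_support f : set (edge G) :=
  [set e | exists2 x, x \in `[0, len e] & f e x != 0].

Lemma edge_support0 f e x : ~ edge_support f e -> 0 <= x <= len e -> f e x = 0.
Proof.
move=> nS xl; apply/eqP/negPn/negP => h; apply: nS; exists x => //; rewrite in_itv.
Qed.

Lemma deriv_support0 f e x : ~ edge_support f e -> 0 <= x <= len e -> deriv f e x = 0.
Proof.
move=> nS; apply: cderiv_0; first exact: len_gt0.
by move=> t; exact: edge_support0.
Qed.

Let finite_dsum f : finite_set (edge_support f) -> (forall e, C e (f e)) -> dsum C b f.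
Proof.
move=> fin Cf; split=> //; apply: summ_finite fin _ => e nS.
rewrite /b (@eq_edge_ip _ _ _ 0 _ 0); [|move=> t; exact: edge_support0..].
by rewrite [edge_ip _ _ _](sesq0l (bS e)) //; exact: sesq0 (bS e).
Qed.

Lemma premin_L2 : @premin_dom R G `<=` @L2 R G.
Proof.
move=> f [Hf fin _ _]; rewrite L2E; apply: finite_dsum => // e.
exact: H2_L2.
Qed.

Lemma premin_deriv_L2 f : premin_dom f -> dsum C b (deriv f).
Proof.
move=> [Hf fin _ _]; have Cd e : C e (deriv f e) := H2_deriv_L2 (Hf e).
split=> //; apply: summ_finite fin _ => e nS.
rewrite /b (@eq_edge_ip _ _ _ 0 _ 0); [|move=> t; exact: deriv_support0..].
by rewrite [edge_ip _ _ _](sesq0l (bS e)) //; exact: sesq0 (bS e).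
Qed.

Lemma finite_incident (v : vertex G) : finite_set (incident v).
Proof. exact: locally_finite. Qed.

Lemma premin_lin (c : R[i]) f g : premin_dom f -> premin_dom g -> premin_dom (c *: f + g).
Proof.
move=> [Hf ff vf kf] [Hg fg vg kg]; split.
- by move=> e; apply: H2_lin; [exact: len_gt0|exact: Hf|exact: Hg].
- apply: (@sub_finite_set _ _ (edge_support f `|` edge_support g)).
    move=> e [x xl]; have [Sf|nSf] := pselect (edge_support f e); first by left.
    have [Sg|nSg] := pselect (edge_support g e); first by right.
    rewrite in_itv in xl; rewrite [X in X != 0](_ : _ = c * f e x + g e x) //.
    by rewrite (edge_support0 nSf) // (edge_support0 nSg) // mulr0 addr0 eqxx.
  by rewrite finite_setU.
- move=> v e e' ie ie'.
  have E h1 h2 e0 : vertex_value (c *: h1 + h2) v e0 =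
      c * vertex_value h1 v e0 + vertex_value h2 v e0 by [].
  by rewrite !E (vf v e e') // (vg v e e').
- move=> v; have E e : outward_deriv (c *: f + g) v e =
      c * outward_deriv f v e + outward_deriv g v e.
    have l0 := len_gt0 e; rewrite /outward_deriv; case: ifP => _.
      by rewrite [LHS](cderiv_lin l0 c (Hf e) (Hg e)) // lexx ltW.
    by rewrite [X in - X](cderiv_lin l0 c (Hf e) (Hg e)) ?lexx ?ltW // opprD mulrN.
  rewrite (eq_fsbigr (fun e => c * outward_deriv f v e + outward_deriv g v e)) //.
  rewrite fsbig_split /=; last exact: finite_incident.
  by rewrite -mulr_fsumr kf kg mulr0 addr0.
Qed.

Lemma premin_0 : @premin_dom R G 0.
Proof.
split.
- by move=> e; apply: H2_0; exact: len_gt0.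
- by apply: (@sub_finite_set _ _ set0) => // e [x _]; rewrite [X in X != 0](_ : _ = 0) // eqxx.
- by [].
- move=> v; rewrite fsbig1 // => e _; have l0 := len_gt0 e; rewrite /outward_deriv.
  by case: ifP => _; rewrite [cderiv _ _ _]cderiv_0 ?oppr0 // lexx ltW.
Qed.

Let dsum_ip_eql f f' h : (forall e t, 0 <= t <= len e -> f e t = f' e t) ->
  dsum_ip b f h = dsum_ip b f' h.
Proof.
move=> ff; congr csum; apply: funext => e; rewrite /b.
by apply: eq_edge_ip => t tl //; exact: ff.
Qed.

Lemma deriv_lin (c : R[i]) f g e t : premin_dom f -> premin_dom g -> 0 <= t <= len e ->
  deriv (c *: f + g) e t = (c *: deriv f + deriv g) e t.
Proof.
move=> [Hf _ _ _] [Hg _ _ _] tl.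
exact: (cderiv_lin (len_gt0 e) c (Hf e) (Hg e) tl).
Qed.

Lemma energy_sesq : sesq (@premin_dom R G) (@energy R G).
Proof.
have dS := dsum_sesq bS; have dd := premin_deriv_L2.
split; [exact: premin_0|exact: premin_lin| | |].
- move=> c f g h Df Dg Dh; rewrite !energyE -(sesqPl dS c (dd _ Df) (dd _ Dg) (dd _ Dh)).
  by apply: dsum_ip_eql => e t tl; exact: deriv_lin.
- by move=> f g Df Dg; rewrite !energyE (sesqC dS) //; exact: dd.
- by move=> f Df; rewrite energyE; apply: (sesq_ge0 dS); exact: dd.
Qed.

Let energy_sub f g : premin_dom f -> premin_dom g ->
  re (energy (f - g) (f - g)) = snorm (dsum_ip b) (deriv f - deriv g) ^+ 2.
Proof.
move=> Df Dg; have dS := dsum_sesq bS; have dd := premin_deriv_L2.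
have Dd := sesqB dS (dd _ Df) (dd _ Dg).
have E e t : 0 <= t <= len e -> deriv (f - g) e t = (deriv f - deriv g) e t.
  move=> tl; have := deriv_lin (-1) Dg Df tl; rewrite !scaleN1r addrC => ->.
  by rewrite addrC.
rewrite [RHS](snorm_sqr dS Dd) energyE; congr re; congr csum; apply: funext => e.
by rewrite /b; apply: eq_edge_ip => t tl; exact: E.
Qed.

(** By completeness the derivatives converge to some [p] in the direct sum, and [prim_closable] on
    each edge shows that [p] has norm 0 there. *)
Lemma energy_closable (u : nat -> edge G -> R -> R[i]) :
  (forall n, premin_dom (u n)) ->
  (fun n => hnorm (X := L2_space G) (u n)) @ \oo --> (0 : R) ->
  (forall eps : R, 0 < eps -> exists N, forall m n, (N <= m)%N -> (N <= n)%N ->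
     re (energy (u m - u n) (u m - u n)) < eps) ->
  (fun n => snorm (@energy R G) (u n)) @ \oo --> (0 : R).
Proof.
move=> Du u0 cau; have dS := dsum_sesq bS; have dd := premin_deriv_L2.
have cau' eps : 0 < eps -> exists N, forall m n, (N <= m)%N -> (N <= n)%N ->
    snorm (dsum_ip b) (deriv (u m) - deriv (u n)) < eps.
  move=> e0; have [N HN] := cau _ (exprn_gt0 2 e0); exists N => m n mN nN.
  have := HN m n mN nN; rewrite energy_sub // ltr_pXn2r ?nnegrE ?snorm_ge0 //.
  exact: ltW.
have [|p Dp up] := dsum_complete bS _ (fun n => dd _ (Du n)) cau'.
  by move=> e v Cv cv; apply: edge_complete => //; exact: ltW (len_gt0 e).
have comp f e : dsum C b f -> snorm (b e) (f e) <= snorm (dsum_ip b) f.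
  move=> Df; rewrite -(ler_pXn2r (ltn0Sn 1)) ?nnegrE ?snorm_ge0 //.
  rewrite (snorm_sqr dS) // (snorm_sqr (bS e)); last exact: Df.1.
  have := fsum_le_rsum (F := fun e => re (b e (f e) (f e))) _ Df.2 (finite_set1 e).
  rewrite fsbig_set1; apply => e'; exact: sesq_ge0 (bS e') _ (Df.1 e').
have zero e : snorm (b e) (p e) = 0.
  have l0 := len_gt0 e.
  have Hu n : H2 (len e) (u n e) by case: (Du n).
  have ipE n := re_edge_ip_self (H2_L2 (Hu n)).
  have usq : (fun n => hnorm (X := L2_space G) (u n) ^+ 2) @ \oo --> (0 : R).
    exact: cvg0_expr2.
  have ule n : re (b e (u n e) (u n e)) <= hnorm (X := L2_space G) (u n) ^+ 2.
    have Dn : dsum C b (u n) by rewrite -L2E; exact: premin_L2.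
    rewrite -(snorm_sqr (bS e)); last exact: Dn.1.
    by rewrite ler_pXn2r ?nnegrE ?snorm_ge0 //; exact: comp.
  have dle m n : re (b e (deriv (u m) e - deriv (u n) e) (deriv (u m) e - deriv (u n) e)) <=
      snorm (dsum_ip b) (deriv (u m) - deriv (u n)) ^+ 2.
    have Dd := sesqB dS (dd _ (Du m)) (dd _ (Du n)).
    rewrite -(snorm_sqr (bS e)); last exact: Dd.1 e.
    by rewrite ler_pXn2r ?nnegrE ?snorm_ge0 //; exact: (comp _ e Dd).
  have Ld n := H2_deriv_L2 (Hu n).
  have cauE eps : 0 < eps -> exists N, forall m n, (N <= m)%N -> (N <= n)%N ->
      re (b e (deriv (u m) e - deriv (u n) e) (deriv (u m) e - deriv (u n) e)) < eps.
    move=> e0; have e1 : 0 < Num.sqrt eps by rewrite sqrtr_gt0.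
    have [N HN] := cau' _ e1; exists N => m n mN nN; apply: le_lt_trans (dle m n) _.
    rewrite -[ltRHS]sqr_sqrtr ?(ltW e0) // ltr_pXn2r ?nnegrE ?snorm_ge0 ?sqrtr_ge0 //.
    exact: HN.
  have dE m n := re_edge_ip_self (sesqB (bS e) (Ld m) (Ld n)).
  have cr : (fun n => itg 0 (len e) (fun t => re (deriv (u n) e t) ^+ 2)) @ \oo --> (0 : R).
    apply: (prim_closable l0 (fun n => (H2_prim (Hu n)).1)).
      apply: cvg0_le usq => n; rewrite ger0_norm ?itg_sqr_ge0 //.
      by apply: le_trans (ule n); rewrite [leRHS]ipE lerDl itg_sqr_ge0.
    move=> eps /cauE[N HN]; exists N => m n mN nN; apply: le_lt_trans (HN m n mN nN).
    rewrite [leRHS]dE; apply: ler_wpDr; first exact: itg_sqr_ge0.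
    rewrite le_eqVlt; apply/orP; left; apply/eqP; apply: eq_itg => t _.
    by rewrite [in RHS]re_add re_opp.
  have ci : (fun n => itg 0 (len e) (fun t => im (deriv (u n) e t) ^+ 2)) @ \oo --> (0 : R).
    apply: (prim_closable l0 (fun n => (H2_prim (Hu n)).2)).
      apply: cvg0_le usq => n; rewrite ger0_norm ?itg_sqr_ge0 //.
      by apply: le_trans (ule n); rewrite [leRHS]ipE lerDr itg_sqr_ge0.
    move=> eps /cauE[N HN]; exists N => m n mN nN; apply: le_lt_trans (HN m n mN nN).
    rewrite [leRHS]dE; apply: ler_wpDl; first exact: itg_sqr_ge0.
    rewrite le_eqVlt; apply/orP; left; apply/eqP; apply: eq_itg => t _.
    by rewrite [in RHS]im_add im_opp.
  have cd : (fun n => snorm (b e) (deriv (u n) e)) @ \oo --> (0 : R).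
    apply: cvg0_sqr; rewrite (_ : (fun n => _) = fun n =>
      itg 0 (len e) (fun t => re (deriv (u n) e t) ^+ 2) +
      itg 0 (len e) (fun t => im (deriv (u n) e t) ^+ 2)); first exact: cvg0D.
    by apply: funext => n; rewrite (snorm_sqr (bS e)) ?(re_edge_ip_self (Ld n)) //; exact: Ld.
  have cp : (fun n => snorm (b e) (deriv (u n) e - p e)) @ \oo --> (0 : R).
    apply: cvg0_le up => n; rewrite ger0_norm ?snorm_ge0 //.
    exact: (comp _ e (sesqB dS (dd _ (Du n)) Dp)).
  apply/eqP; rewrite eq_le snorm_ge0 andbT; apply: le_of_eps => eps e0.
  have /cvg0_epsP/(_ _ e0)[N /(_ N (leqnn N)) h] := cvg0D cd cp.
  rewrite add0r; apply: le_trans (ltW h); apply: le_trans (ler_norm _).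
  rewrite (snorm_distC (bS e)); [|exact: Ld|exact: Dp.1].
  by apply: (snorm_sub_le (bS e)); [exact: Dp.1|exact: Ld].
have p0 : snorm (dsum_ip b) p = 0.
  rewrite /snorm re_dsum_ip (_ : (fun e => _) = fun=> 0).
    by rewrite rsum_ge0 // esum1 // sqrtr0.
  apply: funext => e; rewrite -(snorm_sqr (bS e)); last exact: Dp.1.
  by rewrite zero expr0n.
apply: cvg0_le up => n; rewrite (ger0_norm (snorm_ge0 _ _)).
by apply: le_trans (snorm_sub_le dS (dd _ (Du n)) Dp) _; rewrite p0 add0r.
Qed.

End GraphSpace.

(** * Hardy inequalities on the antitree *)

Section Levels.
Variables (R : realType) (q : nat) (s : R).
Local Notation G := (antitree q s).
Local Notation T n := ('I_(n.+1 ^ q) * 'I_(n.+2 ^ q))%type.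
Implicit Types (f g : edge G -> R -> R[i]) (F H : edge G -> R).

Definition level_edge n (p : T n) : edge G := existT (fun n => T n) n p.

Definition level (e : edge G) : nat := tag (e : antitree_edge q).

Definition width (n : nat) : R := n.+1%:R `^ (- s).

Lemma width_gt0 n : 0 < width n. Proof. by rewrite powR_gt0 // ltr0n. Qed.

Definition level_sum N M F : R := \sum_(N <= n < M) \sum_(p : T n) F (level_edge p).

Definition levels M : seq (edge G) := [seq level_edge p | n <- iota 0 M, p <- enum (T n : finType)].

Let levels_uniq M : uniq (levels M).
Proof.
apply: allpairs_uniq_dep; first exact: iota_uniq.
  by move=> n _; exact: enum_uniq.
by move=> [n p] [n' p'] _ _.
Qed.

Let mem_levels M e : (e \in levels M) = (level e < M)%N.
Proof.
case: e => n p; apply/allpairsPdep/idP => [[m [p' [+ _ /(congr1 level) /= ->]]]|nM].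
  by rewrite mem_iota.
by exists n, p; rewrite mem_iota mem_enum.
Qed.

Lemma finite_levels M : finite_set [set e | (level e < M)%N].
Proof.
apply: (@sub_finite_set _ _ [set` levels M]); last exact: finite_seq.
by move=> e /=; rewrite mem_levels.
Qed.

Lemma level_sum_levels M F : level_sum 0 M F = \sum_(e <- levels M) F e.
Proof.
rewrite big_allpairs_dep /level_sum /index_iota subn0.
by apply: eq_bigr => n _; rewrite big_enum.
Qed.

Lemma rsum_levels F M : (forall e, (M <= level e)%N -> F e = 0) ->
  rsum F = level_sum 0 M F.
Proof.
move=> F0; have out e : ~ [set` levels M] e -> F e = 0.
  by rewrite /= mem_levels => h; apply: F0; rewrite leqNgt; apply/negP.
rewrite (rsum_finite (finite_seq _) out) -(fsbig_seq _ _ (levels_uniq M)).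
by rewrite level_sum_levels.
Qed.

Lemma level_sum_cat N M K F : (N <= M)%N -> (M <= K)%N ->
  level_sum N K F = level_sum N M F + level_sum M K F.
Proof. by move=> NM MK; rewrite /level_sum (big_cat_nat NM MK). Qed.

Lemma level_sum_ge0 N M F : (forall e, 0 <= F e) -> 0 <= level_sum N M F.
Proof. by move=> F0; apply: sumr_ge0 => n _; apply: sumr_ge0 => p _; exact: F0. Qed.

Lemma card_level n : #|{: T n}| = (n.+1 ^ q * n.+2 ^ q)%N.
Proof. by rewrite card_prod !card_ord. Qed.

(** The boundary terms left by an integration by parts on every edge, when the weights depend only
    on the level: [B n] at the outer end of an edge, [A n] at the inner end. *)
Definition flux (A B : nat -> R) (phi : forall n, 'I_(n.+1 ^ q) -> R) N M : R :=
  \sum_(N <= n < M) \sum_(p : T n) (B n * phi n.+1 p.2 - A n * phi n p.1).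

(* A vertex of S_(n+1) has (n+1)^q edges coming from S_n and (n+3)^q edges going
   to S_(n+2). *)
Lemma flux_vertices A B phi N M : (N <= M)%N ->
  flux A B phi N M.+1 =
  - (A N * N.+2%:R ^+ q * \sum_i phi N i) +
  \sum_(N <= n < M)
    (n.+1%:R ^+ q * B n - n.+3%:R ^+ q * A n.+1) * \sum_i phi n.+1 i +
  M.+1%:R ^+ q * B M * \sum_i phi M.+1 i.
Proof.
have E n : \sum_(p : T n) (B n * phi n.+1 p.2 - A n * phi n p.1) =
    n.+1%:R ^+ q * B n * (\sum_i phi n.+1 i) - n.+2%:R ^+ q * A n * \sum_i phi n i.
  rewrite -(pair_bigA _ (fun i j => B n * phi n.+1 j - A n * phi n i)) /=.
  under eq_bigr do rewrite sumrB -mulr_sumr sumr_const card_ord -mulr_natl natrX.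
  rewrite sumrB sumr_const card_ord -[X in X - _]mulr_natl natrX mulrA.
  by rewrite -!mulr_sumr mulrA.
rewrite /flux; under eq_bigr do rewrite E.
elim: M => [|M IH]; rewrite ?leqn0 => NM.
  by rewrite (eqP NM) big_nat1 big_geq //; ring.
have [->|NM'] := eqVneq N M.+1.
  by rewrite big_nat1 big_geq //; ring.
have {NM NM'} NM : (N <= M)%N by rewrite -ltnS ltn_neqAle NM' NM.
rewrite big_nat_recr /=; last by rewrite ltnW // ltnS.
rewrite IH // [in RHS]big_nat_recr //=; ring.
Qed.

End Levels.

Section EdgeHardy.
Variables (R : realType) (l : R).

(* Completing the square: 0 <= int (u' + g u)^2 with g x = A + B x, where
   2 u u' g = (g u^2)' - B u^2. *)
Lemma edge_hardy (u g : R -> R) (A B c : R) : 0 <= l -> primitive 0 l u g ->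
  (forall x, 0 <= x <= l -> c + (A + B * x) ^+ 2 <= B) ->
  c * itg 0 l (fun t => u t ^+ 2) <=
  itg 0 l (fun t => g t ^+ 2) + ((A + B * l) * u l ^+ 2 - A * u 0 ^+ 2).
Proof.
move=> l0 pu cB.
have pG := prim_lin B (prim_id 0 l) (prim_cst 0 l A).
have p2 := prim_mul pG (prim_mul pu pu).
have := prim_diff p2 (lexx 0) l0 (lexx l); rewrite /= mulr0 add0r => H.
have -> : (A + B * l) * u l ^+ 2 - A * u 0 ^+ 2 =
    (B * l + A) * (u l * u l) - A * (u 0 * u 0) by ring.
rewrite {}H.
have sg := prim_sqi' pu; have su := prim_sqi pu; have i2 := prim_sqi' p2.
rewrite -(itgZ c (sqi_sqr su)).
have i2' := sqi_itgable i2.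
rewrite -(itgD (sqi_sqr sg) i2').
apply: itg_le; [exact: itgableZ (sqi_sqr su)|exact: itgableD (sqi_sqr sg) i2'|].
move=> t tl /=; have := cB t tl; set G := A + B * t => h.
have -> : g t ^+ 2 + ((B * 1 + 0) * (u t * u t) + (B * t + A) * (g t * u t + u t * g t)) =
    (g t + G * u t) ^+ 2 + (B - G ^+ 2) * u t ^+ 2 by rewrite /G; ring.
have h1 := sqr_ge0 (g t + G * u t).
have h2 : c * u t ^+ 2 <= (B - G ^+ 2) * u t ^+ 2.
  by apply: ler_wpM2r; [exact: sqr_ge0|rewrite lerBrDr].
lra.
Qed.

End EdgeHardy.

Section Traces.
Variables (R : realType) (q : nat) (s : R).
Local Notation G := (antitree q s).
Local Notation T n := ('I_(n.+1 ^ q) * 'I_(n.+2 ^ q))%type.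
Implicit Types (f g : edge G -> R -> R[i]).
Local Notation D := (@premin_dom R G).

Let sphere_gt0 n : (0 < n.+1 ^ q)%N. Proof. by rewrite expn_gt0. Qed.

(** The value at a vertex is read off one edge leaving it, which exists because the next sphere is
    nonempty; for continuous functions every other edge gives the same value. *)
Definition trace f n (i : 'I_(n.+1 ^ q)) : R[i] :=
  f (level_edge s (i, Ordinal (sphere_gt0 n.+1))) 0.

Lemma trace_src f n (p : T n) : D f -> f (level_edge s p) 0 = trace f p.1.
Proof.
case: p => i j [_ _ cont _].
have := cont (existT _ n i) (level_edge s (i, j)) (level_edge s (i, Ordinal (sphere_gt0 n.+1))).
rewrite /vertex_value /= /antitree_src /= eqxx; apply; by left.
Qed.

Lemma trace_tgt f n (p : T n) : D f -> f (level_edge s p) (width s n) = trace f p.2.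
Proof.
case: p => i j [_ _ cont _]; set e' := level_edge s (j, Ordinal (sphere_gt0 n.+2)).
have := cont (existT _ n.+1 j) (level_edge s (i, j)) e'.
rewrite /vertex_value /= /antitree_src /= eqxx.
have -> : (existT (fun n : nat => 'I_(n.+1 ^ q)) n i == existT _ n.+1 j) = false.
  by apply/negbTE/eqP => /(congr1 tag) /= /eqP; rewrite ltn_eqF.
by apply; [right|left].
Qed.

Definition vanishes_from (M : nat) f : Prop :=
  forall e x, (M <= level e)%N -> 0 <= x <= len e -> f e x = 0.

Lemma premin_vanishes f : D f -> exists M, vanishes_from M f.
Proof.
move=> [_ /finite_seqP[r rE] _ _].
have [M HM] : exists M, forall e, e \in r -> (level e < M)%N.
  elim: {rE} r => [|e r [M HM]]; first by exists 0%N.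
  exists (maxn (level e).+1 M) => e'; rewrite inE leq_max => /orP[/eqP->|/HM->].
    by rewrite leqnn.
  by rewrite orbT.
exists M => e x Me xl; apply: (edge_support0 _ xl).
have -> : edge_support f = [set` r] by rewrite -rE.
by move=> /= /HM; apply/negP; rewrite -leqNgt.
Qed.

Lemma vanishes_deriv M f : vanishes_from M f -> vanishes_from M (deriv f).
Proof.
move=> f0 e x Me xl; apply: deriv_support0 xl => -[y yl /eqP]; apply.
by apply: f0 => //; rewrite in_itv in yl.
Qed.

Lemma vanishes_leq M M' f : (M <= M')%N -> vanishes_from M f -> vanishes_from M' f.
Proof. by move=> MM f0 e x Me; apply: f0; exact: leq_trans Me. Qed.

Definition edge_sqr f e : R := re (edge_ip (len e) (f e) (f e)).

Lemma edge_sqr_ge0 f e : edge_L2 (len e) (f e) -> 0 <= edge_sqr f e.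
Proof. exact: (sesq_ge0 (edge_sesq _)). Qed.

Lemma edge_sqr0 M f e : vanishes_from M f -> (M <= level e)%N -> edge_sqr f e = 0.
Proof.
move=> f0 Me; rewrite /edge_sqr edge_ip_self /= -[RHS](itg0 (0 : R) (len e)).
by apply: eq_itg => t tl; rewrite f0 //= expr0n addr0.
Qed.

Lemma re_ip_levels M f : vanishes_from M f ->
  re (L2_ip f f) = level_sum 0 M (edge_sqr f).
Proof.
move=> f0; rewrite L2_ipE re_dsum_ip; apply: rsum_levels => e Me.
exact: edge_sqr0 Me.
Qed.

Lemma re_energy_levels M f : vanishes_from M f ->
  re (energy f f) = level_sum 0 M (edge_sqr (deriv f)).
Proof.
move=> /vanishes_deriv f0; rewrite energyE re_dsum_ip; apply: rsum_levels => e Me.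
exact: edge_sqr0 Me.
Qed.

(** Nothing is asked of [f] at the inner sphere S_N, whose boundary term has the right sign because
    [0 <= A N]. The same inequality thus serves for the whole graph and for an exterior part of
    it. *)
Lemma hardy_levels f (c : R) (A B : nat -> R) N M : D f -> vanishes_from M f ->
  (N <= M)%N -> 0 <= A N ->
  (forall n x, (N <= n)%N -> 0 <= x <= width s n -> c + (A n + B n * x) ^+ 2 <= B n) ->
  (forall n, (N <= n)%N ->
    n.+1%:R ^+ q * (A n + B n * width s n) <= n.+3%:R ^+ q * A n.+1) ->
  c * level_sum N M.+1 (edge_sqr f) <= level_sum N M.+1 (edge_sqr (deriv f)).
Proof.
move=> Df f0 NM A0 cB jump.
pose phi n (i : 'I_(n.+1 ^ q)) : R := normc (trace f i) ^+ 2.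
pose B' n := A n + B n * width s n.
have S0 n : 0 <= \sum_i phi n i by apply: sumr_ge0 => i _; exact: sqr_ge0.
have edge n (p : T n) : (N <= n)%N -> c * edge_sqr f (level_edge s p) <=
    edge_sqr (deriv f) (level_edge s p) + (B' n * phi n.+1 p.2 - A n * phi n p.1).
  move=> Nn; set e := level_edge s p.
  have He : H2 (len e) (f e) by case: Df.
  have [pr pi] := H2_prim He; have w0 := ltW (len_gt0 e).
  rewrite /edge_sqr (re_edge_ip_self (H2_L2 He)) (re_edge_ip_self (H2_deriv_L2 He)).
  have h1 := edge_hardy w0 pr (fun x => @cB n x Nn).
  have h2 := edge_hardy w0 pi (fun x => @cB n x Nn).
  rewrite /phi -(trace_src p Df) -(trace_tgt p Df) !normc_sqr.
  rewrite /B'; change (len e) with (width s n) in h1, h2 |- *.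
  have arith (k x x' y y' z z' t t' w r : R) : k * x <= y + (w * z - r * t) ->
      k * x' <= y' + (w * z' - r * t') ->
      k * (x + x') <= y + y' + (w * (z + z') - r * (t + t')) by move=> *; lra.
  exact: arith h1 h2.
have : c * level_sum N M.+1 (edge_sqr f) <=
    level_sum N M.+1 (edge_sqr (deriv f)) + flux A B' phi N M.+1.
  rewrite /level_sum /flux mulr_sumr -big_split /= !big_nat.
  apply: ler_sum => n /andP[Nn _]; rewrite mulr_sumr -big_split /=.
  by apply: ler_sum => p _; exact: edge.
move=> /le_trans; apply; rewrite gerDl flux_vertices //.
(* Summing up to [M.+1] leaves at least one level even if [N = M], and the outer sphere lies where
   [f] vanishes. *)
have -> : \sum_i phi M.+1 i = 0.
  rewrite big1 // => i _; rewrite /phi /trace f0 ?lexx ?(ltW (len_gt0 _)) //.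
  by rewrite normc_sqr expr0n addr0.
rewrite mulr0 addr0 addrC; apply: ler_wnDr.
  by rewrite oppr_le0 !mulr_ge0 ?exprn_ge0.
rewrite big_nat; apply: sumr_le0 => n /andP[Nn _]; apply: mulr_le0_ge0 => //.
by rewrite subr_le0; exact: jump.
Qed.

End Traces.

(** * Poincare inequality on short pieces of edges *)

Section Pieces.
Variables (R : realType) (G : metric_graph R).
Implicit Types (f : edge G -> R -> R[i]) (e : edge G) (a b l h k c : R).

(** The bound [c h^2 <= 1] absorbs the gradient term of [poincare] on each piece; the remainder
    consists of squared integrals, hence of finitely many functionals. *)
Lemma poincare_pieces (u g : R -> R) l h c K : 0 < h -> K%:R * h = l ->
  primitive 0 l u g -> 0 <= c -> c * h ^+ 2 <= 1 ->
  c * itg 0 l (fun t => u t ^+ 2) <= itg 0 l (fun t => g t ^+ 2) +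
    \sum_(j < K) c / h * itg (j%:R * h) (j.+1%:R * h) u ^+ 2.
Proof.
move=> h0 K1 pu c0 ch1.
have su := prim_sqi pu; have sg := prim_sqi' pu.
suff main j : (j <= K)%N ->
    c * itg 0 (j%:R * h) (fun t => u t ^+ 2) <= itg 0 (j%:R * h) (fun t => g t ^+ 2) +
    \sum_(i < j) c / h * itg (i%:R * h) (i.+1%:R * h) u ^+ 2.
  by have := main K (leqnn _); rewrite K1.
elim: j => [_|j IH jK]; first by rewrite mul0r !itg_point big_ord0 mulr0 addr0.
have jh0 : 0 <= j%:R * h by rewrite mulr_ge0 // ltW.
have jhS : j.+1%:R * h = j%:R * h + h by rewrite -natr1 mulrDl mul1r.
have jhlt : j%:R * h < j.+1%:R * h by rewrite jhS ltrDl.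
have jhl : j.+1%:R * h <= l by rewrite -K1 ler_wpM2r ?(ltW h0) // ler_nat.
have p1 := prim_sub pu jh0 jhl.
have := poincare jhlt p1; rewrite jhS addrAC subrr add0r -jhS => P.
rewrite big_ord_recr /= (@itg_split _ 0 (j%:R * h) (j.+1%:R * h) (fun t => u t ^+ 2)) ?(ltW jhlt) //;
  last exact: itgable_sub (lexx 0) jhl (sqi_sqr su).
rewrite (@itg_split _ 0 (j%:R * h) (j.+1%:R * h) (fun t => g t ^+ 2)) ?(ltW jhlt) //;
  last exact: itgable_sub (lexx 0) jhl (sqi_sqr sg).
have {}IH := IH (ltnW jK).
have := ler_wpM2l c0 P; rewrite mulrDr (mulrA c (h ^+ 2)) (mulrA c h^-1) => P1.
have g0 := itg_sqr_ge0 (j%:R * h) (j.+1%:R * h) g.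
have P2 := ler_wpM2r g0 ch1; rewrite mul1r in P2.
rewrite mulrDr; lra.
Qed.

Lemma itg_indic a b l (u : R -> R) : 0 <= a -> b <= l ->
  itg 0 l (fun t => u t * \1_`[a, b] t) = itg a b u.
Proof.
move=> a0 bl; rewrite /itg.
have -> : [set` `[a, b]] = [set` `[0, l]] `&` [set` `[a, b]].
  apply/seteqP; split=> t /=; last by case.
  by rewrite !in_itv /= => /andP[xa xb]; rewrite (le_trans a0 xa) (le_trans xb bl) xa xb.
rewrite Rintegral_mkcondr; apply: eq_Rintegral => t.
rewrite inE /= => t0l; rewrite /patch indicE.
have -> : (t \in [set` `[0, l]] `&` [set` `[a, b]]) = (t \in `[a, b]%classic).
  by apply/idP/idP; rewrite !inE //=; case.
by case: ifP; rewrite ?mulr1 ?mulr0.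
Qed.

Lemma sqi_indic a b l k : sqi 0 l (fun t => k * \1_`[a, b] t).
Proof.
apply: sqiZ; apply/sqiP; have mi : measurable_fun `[0, l] (\1_`[a, b] : R -> R).
  exact: measurable_indic.
split=> //; apply: (@itgable_le _ _ _ _ (fun=> 1)); last exact: itgable_cst.
  exact: measurable_funX.
by move=> t _; rewrite indicE; case: (_ \in _); rewrite ?expr1n ?expr0n ?normr0 ?normr1.
Qed.

(** A multiple of the indicator of a piece of one edge. With [k = sqrt (c / h)] the squared inner
    product with it is the remainder term of [poincare_pieces]. *)
Definition piece e a b k : edge G -> R -> R[i] :=
  fun e' t => if e' == e then (k * \1_`[a, b] t)%:C else 0.

Lemma csum1 (F : edge G -> R[i]) e : (forall e', e' != e -> F e' = 0) -> csum F = F e.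
Proof.
move=> F0; apply: complexP; rewrite /csum /=.
  rewrite (rsum_finite (finite_set1 e)) ?fsbig_set1 // => e' /eqP ne.
  by rewrite F0.
rewrite (rsum_finite (finite_set1 e)) ?fsbig_set1 // => e' /eqP ne.
by rewrite F0.
Qed.

Lemma piece_edge_L2 e e' a b k : edge_L2 (len e') (piece e a b k e').
Proof.
apply/edge_L2P; rewrite /piece; case: eqP => _ /=.
  by split; [exact: sqi_indic|exact: sqi_cst].
by split; exact: sqi_cst.
Qed.

Lemma piece_L2 e a b k : @L2 R G (piece e a b k).
Proof.
rewrite L2E; split=> [e'|]; first exact: piece_edge_L2.
apply: (summ_finite (finite_set1 e)) => e' /eqP/negbTE ne.
rewrite /piece ne (re_edge_ip_self (proj2 (edge_L2P _ _) _)) /=.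
  by rewrite expr0n /= itg0 addr0.
by split; exact: sqi_cst.
Qed.

Lemma ip_piece f e a b k : L2 f -> 0 <= a -> b <= len e ->
  normc (L2_ip f (piece e a b k)) ^+ 2 =
  k ^+ 2 * (itg a b (fun t => re (f e t)) ^+ 2 + itg a b (fun t => im (f e t)) ^+ 2).
Proof.
rewrite {1}L2E => -[Lf _] a0 bl.
rewrite L2_ipE /dsum_ip (@csum1 _ e); last first.
  move=> e' /negbTE ne; rewrite /piece ne.
  apply: complexP => /=; rewrite -[RHS](itg0 (0 : R) (len e')); apply: eq_itg => t _;
    by rewrite /= ?oppr0 ?mulr0 ?subr0 ?addr0.
have Lp := piece_edge_L2 e e a b k; have [fr fi] := (edge_L2P _ _).1 (Lf e).
have E (u : R -> R) : sqi 0 (len e) u ->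
    itg 0 (len e) (fun t => u t * (k * \1_`[a, b] t)) = k * itg a b u.
  move=> su; rewrite -(itg_indic u a0 bl) -itgZ.
    by apply: eq_itg => t _; rewrite mulrCA.
  by apply: itgableM => //; have := sqi_indic a b (len e) 1; under eq_fun do rewrite mul1r.
have Z (u : R -> R) : itg 0 (len e) (fun t => u t * 0) = 0.
  by rewrite -[RHS](itg0 (0 : R) (len e)); apply: eq_itg => t _; rewrite mulr0.
rewrite normc_sqr (re_edge_ip (Lf e) Lp) (im_edge_ip (Lf e) Lp).
rewrite /piece eqxx /= !E // !Z; ring.
Qed.

End Pieces.

Section LowerBounds.
Variables (R : realType) (q : nat) (s : R).
Hypothesis s0 : 0 <= s.
Local Notation G := (antitree q s).
Local Notation D := (@premin_dom R G).
Local Notation H := (kirchhoff_laplacian G).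
Implicit Types (f : edge G -> R -> R[i]) (c : R).

Lemma width_le1 n : width s n <= 1.
Proof.
rewrite /width -[leRHS](powRr0 n.+1%:R); apply: ler_powR.
  by rewrite ler1n.
by rewrite oppr_le0.
Qed.

Lemma antitree_lambda0_ge c :
  (forall f M, D f -> vanishes_from M f ->
     c * level_sum 0 M.+1 (edge_sqr f) <= level_sum 0 M.+1 (edge_sqr (deriv f))) ->
  (c%:E <= lambda0 H)%E.
Proof.
move=> cH; apply: (lambda0_ge (hilbert_L2 G) (@premin_L2 R G) (energy_sesq G)
  (@energy_closable R G)) => f Df.
have [M f0] := premin_vanishes Df; have f1 := vanishes_leq (leqnSn M) f0.
by rewrite [re (ip _ _)](re_ip_levels f1) (re_energy_levels f1); exact: cH.
Qed.

Lemma antitree_lambda0_ess_ge c N : 0 <= c ->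
  (forall f M, D f -> vanishes_from M f -> (N <= M)%N ->
     c * level_sum N M.+1 (edge_sqr f) <= level_sum N M.+1 (edge_sqr (deriv f))) ->
  (c%:E <= lambda0_ess H)%E.
Proof.
(* All edges have length at most 1, so [K] equal pieces of each edge are short enough as soon as
   [K^2 >= c]. *)
move=> c0 cH; have [K K0 cK] : exists2 K : nat, 0 < K%:R :> R & c <= K%:R ^+ 2.
  exists (Num.truncn c).+1; first by rewrite ltr0n.
  rewrite -natrX; apply: le_trans (ltW (truncnS_gt c)) _.
  by rewrite ler_nat -mulnn leq_pmulr.
pose h (e : edge G) : R := len e / K%:R.
have h0 (e : edge G) : 0 < h e by rewrite divr_gt0 // len_gt0.
have ch (e : edge G) : c * h e ^+ 2 <= 1.
  rewrite /h exprMn exprVn mulrA ler_pdivrMr ?exprn_gt0 // mul1r.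
  apply: le_trans cK; rewrite ler_piMr // exprn_ile1 ?(ltW (len_gt0 e)) //.
  exact: width_le1.
pose v (e : edge G) (j : nat) := @piece R G e (j%:R * h e) (j.+1%:R * h e) (Num.sqrt (c / h e)).
pose r := [seq v e j | e <- levels q s N, j <- iota 0 K].
apply: (@lambda0_ess_ge _ _ (hilbert_L2 G) _ _ (@premin_L2 R G) (energy_sesq G)
  (@energy_closable R G) c (size r) (fun i => nth 0 r i)).
  by move=> i; have /allpairsP[p [_ _ ->]] := mem_nth 0 (ltn_ord i); exact: piece_L2.
move=> f Df; have Lf := premin_L2 Df.
have key (e : edge G) : c * edge_sqr f e <= edge_sqr (deriv f) e +
    \sum_(j <- iota 0 K) normc (L2_ip f (v e j)) ^+ 2.
  have He : H2 (len e) (f e) by case: Df.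
  have [pr pi] := H2_prim He; have Ke : K%:R * h e = len e.
    by rewrite /h mulrC divfK // gt_eqF.
  have -> : \sum_(j <- iota 0 K) normc (L2_ip f (v e j)) ^+ 2 = \sum_(j < K)
     (c / h e * itg (j%:R * h e) (j.+1%:R * h e) (fun t => re (f e t)) ^+ 2 +
      c / h e * itg (j%:R * h e) (j.+1%:R * h e) (fun t => im (f e t)) ^+ 2).
    rewrite -{1}[K]subn0 -/(index_iota 0 K) big_mkord; apply: eq_bigr => j _.
    rewrite ip_piece //; [|by apply: mulr_ge0 => //; exact: ltW|].
      by rewrite (sqr_sqrtr (divr_ge0 c0 (ltW (h0 e)))) mulrDr.
    by rewrite -Ke ler_wpM2r ?(ltW (h0 e)) // ler_nat.
  rewrite big_split /= /edge_sqr (re_edge_ip_self (H2_L2 He)).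
  rewrite (re_edge_ip_self (H2_deriv_L2 He)) mulrDr.
  have h1 := poincare_pieces (h0 e) Ke pr c0 (ch e).
  have h2 := poincare_pieces (h0 e) Ke pi c0 (ch e).
  by rewrite addrACA; exact: lerD h1 h2.
rewrite -(big_mkord xpredT (fun i => normc (L2_ip f (nth 0 r i)) ^+ 2)) -(big_nth 0 xpredT
  (fun e => normc (L2_ip f e) ^+ 2)).
have [M0 f0] := premin_vanishes Df; pose M := maxn N M0.
have fM : vanishes_from M f := vanishes_leq (leq_maxr _ _) f0.
have f1 := vanishes_leq (leqnSn M) fM.
rewrite [re (ip _ _)](re_ip_levels f1) (re_energy_levels f1).
have NM : (N <= M)%N := leq_maxl _ _.
rewrite !(level_sum_cat _ (leq0n N) (leqW NM)) mulrDr.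
have := cH f M Df fM NM; suff : c * level_sum 0 N (edge_sqr f) <=
  level_sum 0 N (edge_sqr (deriv f)) + \sum_(w <- r) normc (L2_ip f w) ^+ 2 by lra.
rewrite big_allpairs_dep !level_sum_levels mulr_sumr -big_split.
by apply: ler_sum => e _; exact: key.
Qed.

(** This is [1 + 2 k / x <= (1 + 2 / x)^k] cleared of denominators. At [x = n + 1] and [k = q] it
    bounds from below the ratio of outgoing to incoming edges at a vertex. *)
Let bernoulli (x : R) k : 0 <= x -> x ^+ k * (x + 2 * k%:R) <= (x + 2) ^+ k * x.
Proof.
move=> x0; elim: k => [|k IH]; first by rewrite !expr0 mulr0 addr0.
apply: (@le_trans _ _ ((x + 2) * (x ^+ k * (x + 2 * k%:R)))); last first.
  by rewrite exprS -mulrA ler_wpM2l // addr_ge0.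
rewrite exprSr -[k.+1%:R]natr1; have xk : 0 <= x ^+ k by rewrite exprn_ge0.
have -> : (x + 2) * (x ^+ k * (x + 2 * k%:R)) =
  x ^+ k * x * (x + 2 * (k%:R + 1)) + x ^+ k * (4 * k%:R) by ring.
by rewrite lerDl !mulr_ge0.
Qed.

(* The Hardy weight on level n is G_n(x) = m - b (l_n - x). *)
Lemma hardy_affine f (c m b : R) N M : D f -> vanishes_from M f -> (N <= M)%N ->
  0 <= m -> 0 <= b -> c + m ^+ 2 <= b ->
  (forall n, (N <= n)%N -> b * width s n <= m) ->
  (forall n, (N <= n)%N -> b * width s n.+1 * (n.+1%:R + 2 * q%:R) <= 2 * q%:R * m) ->
  c * level_sum N M.+1 (edge_sqr f) <= level_sum N M.+1 (edge_sqr (deriv f)).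
Proof.
move=> Df f0 NM m0 b0 cb bw jump.
apply: (hardy_levels (A := fun n => m - b * width s n) (B := fun=> b)) => //.
- by rewrite subr_ge0; exact: bw.
(* As [b l_n <= m], the weight increases from a nonnegative value to [m], so its square is at most
   [m^2]. *)
- move=> n x Nn /andP[x0 xw]; apply: le_trans cb; rewrite lerD2l.
  have := bw n Nn; have := ler_wpM2l b0 xw; have := mulr_ge0 b0 x0 => h1 h2 h3.
  rewrite ler_pXn2r ?nnegrE //; lra.
(* By Bernoulli it suffices that [(1 + 2 q / (n + 1)) (m - b l_(n+1)) >= m], which is the last
   hypothesis. *)
- move=> n Nn; rewrite subrK.
  have n0 : 0 < n.+1%:R :> R by rewrite ltr0n.
  have B := bernoulli q (ltW n0).
  have -> : n.+3%:R = n.+1%:R + 2 :> R by rewrite -addn2 natrD.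
  have d0 : 0 < n.+1%:R + 2 * q%:R :> R by rewrite ltr_wpDr // mulr_ge0.
  rewrite -(ler_pM2r d0); apply: (@le_trans _ _ ((n.+1%:R + 2) ^+ q * n.+1%:R * m)).
    by rewrite mulrAC ler_wpM2r.
  rewrite -!mulrA ler_wpM2l ?exprn_ge0 ?addr_ge0 // mulrBl.
  have := jump n Nn; lra.
Qed.

End LowerBounds.

Lemma powR_large (R : realType) (p K : R) : 0 < p -> exists N, forall n, (N <= n)%N -> K <= n%:R `^ p.
Proof.
move=> p0; have [K0|K0] := leP K 0.
  by exists 0%N => n _; apply: le_trans K0 (powR_ge0 _ _).
exists (Num.truncn (K `^ p^-1)).+1 => n Nn.
have -> : K = (K `^ p^-1) `^ p by rewrite -powRrM mulVf ?gt_eqF // powRr1 // ltW.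
apply: ge0_ler_powR; rewrite ?nnegrE ?powR_ge0 ?(ltW p0) //.
by apply: le_trans (ltW (truncnS_gt _)) _; rewrite ler_nat.
Qed.

(** * Lower bounds for the antitree *)

Section ConcreteLowerBounds.
Variables (R : realType) (q : nat) (s : R).
Hypothesis q0 : (1 <= q)%N.
Local Notation G := (antitree q s).
Local Notation H := (kirchhoff_laplacian G).

Let q1 : (1 : R) <= q%:R. Proof. by rewrite ler1n. Qed.

Lemma antitree_lambda0_ge0 : (0 <= lambda0 H)%E.
Proof.
apply: antitree_lambda0_ge => f M Df f0; rewrite mul0r.
apply: level_sum_ge0 => e; apply: edge_sqr_ge0; apply: H2_deriv_L2.
by case: Df.
Qed.

Lemma width_le_inv n : 1 <= s -> width s n <= n.+1%:R^-1.
Proof.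
move=> s1; rewrite /width powRN lef_pV2 ?posrE ?powR_gt0 ?ltr0n //.
by rewrite -[leLHS]powRr1 // ler_powR // ler1n.
Qed.

(** Level 0 has width 1, which forces [b <= m] in [hardy_affine]; then [b - m^2 <= m - m^2] is
    largest at [m = b = 1/2]. *)
Lemma antitree_lambda0_ge_quarter : 1 <= s -> ((4^-1 : R)%:E <= lambda0 H)%E.
Proof.
move=> s1; apply: antitree_lambda0_ge => f M Df f0.
apply: (hardy_affine (m := 2^-1) (b := 2^-1) Df f0) => //.
- have -> : 4^-1 + 2^-1 ^+ 2 = 2^-1 :> R by field.
  by [].
- move=> n _; rewrite ger_pMr //; apply: width_le1; exact: le_trans s1.
- move=> n _; rewrite [leRHS]mulrC -mulrA ler_wpM2l //.
  apply: le_trans (ler_wpM2r _ (width_le_inv n.+1 s1)) _.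
    by rewrite addr_ge0 // mulr_ge0.
  rewrite ler_pdivrMl ?ltr0n // -[n.+2%:R]natr1.
  have : 0 <= (2 * q%:R - 1) * n.+1%:R :> R by apply: mulr_ge0 => //; have := q1; lra.
  lra.
Qed.

(** For widths [1 / (n + 1)] the condition at the spheres tends to [b <= 2 q m] as [n] grows, and
    [2 q m - m^2] is largest at [m = q], with value [q^2]. *)
Lemma antitree_lambda0_ess_ge_sqr : s = 1 -> ((q%:R ^+ 2 : R)%:E <= lambda0_ess H)%E.
Proof.
move=> s1; have s1' : 1 <= s by rewrite s1.
apply/lee_subgt0Pr => eps e0; pose c : R := Num.max 0 (q%:R ^+ 2 - eps).
have qq : 0 < q%:R ^+ 2 :> R by apply: exprn_gt0; apply: lt_le_trans q1.
have c0 : 0 <= c by rewrite le_max lexx.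
have cq : c < q%:R ^+ 2 by rewrite gt_max qq gtrBl.
apply: (@le_trans _ _ c%:E); first by rewrite -EFinB lee_fin le_max lexx orbT.
pose d := q%:R ^+ 2 - c; have d0 : 0 < d by rewrite subr_gt0.
pose b := c + q%:R ^+ 2.
have b0 : 0 <= b by rewrite addr_ge0 // ltW.
(* The first summand gives [n d >= 2 q b], which settles the spheres; the second gives [n >= 2 q],
   hence [b l_n <= q]. *)
pose N := ((Num.truncn (b * (2 * q%:R) / d)).+1 + 2 * q)%N.
have big n : (N <= n)%N -> b * (2 * q%:R) / d <= n%:R /\ 2 * q%:R <= n%:R :> R.
  move=> Nn; split.
    apply: le_trans (ltW (truncnS_gt _)) _; rewrite ler_nat.
    by apply: leq_trans Nn; rewrite leq_addr.
  by rewrite -natrM ler_nat; apply: leq_trans Nn; rewrite leq_addl.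
apply: (@antitree_lambda0_ess_ge _ _ _ _ _ N) => //.
  exact: le_trans s1'.
move=> f M Df f0 NM; apply: (hardy_affine (m := q%:R) (b := b) Df f0) => //.
- move=> n /big[_ qn]; apply: le_trans (ler_wpM2l b0 (width_le_inv n s1')) _.
  rewrite ler_pdivrMr ?ltr0n // -[n.+1%:R]natr1.
  have : b <= q%:R * (2 * q%:R) by rewrite /b; nra.
  have : q%:R * (2 * q%:R) <= q%:R * n%:R :> R by rewrite ler_wpM2l.
  by have := q1; rewrite mulrDr mulr1; lra.
- move=> n /big[nb _]; rewrite -mulrA.
  apply: le_trans (ler_wpM2l b0 (ler_wpM2r _ (width_le_inv n.+1 s1'))) _.
    by rewrite addr_ge0 // mulr_ge0.
  rewrite mulrCA ler_pdivrMl ?ltr0n // -[n.+2%:R]natr1 -[n.+1%:R]natr1.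
  move: nb; rewrite ler_pdivrMr // => nb.
  have -> : (n%:R + 1 + 1) * (2 * q%:R * q%:R) = (n%:R + 1 + 1) * (b + d) :> R.
    by rewrite /b /d; ring.
  have -> : b * (n%:R + 1 + 2 * q%:R) = b * n%:R + b + b * (2 * q%:R) by ring.
  have -> : (n%:R + 1 + 1) * (b + d) = b * n%:R + b + n%:R * d + (d + d + b) by ring.
  by lra.
Qed.

Lemma width_small K : 1 < s ->
  exists N, forall n, (N <= n)%N -> K * (width s n * n.+1%:R) <= 1.
Proof.
move=> s1; have ds : 0 < s - 1 by rewrite subr_gt0.
have [N HN] := powR_large K ds; exists N => n Nn.
have n0 : 0 < n.+1%:R :> R by rewrite ltr0n.
have -> : width s n * n.+1%:R = (n.+1%:R `^ (s - 1))^-1.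
  rewrite /width -[in X in _ * X](powRr1 (ltW n0)) -powRD; last by rewrite (gt_eqF n0) implybT.
  by rewrite -powRN opprB addrC.
by rewrite ler_pdivrMr ?powR_gt0 // mul1r HN // leqW.
Qed.

(** For [s > 1] the product [(n + 1) l_n] tends to 0, so far out both conditions of [hardy_affine]
    hold whatever the value of [b]. *)
Lemma antitree_lambda0_ess_pinfty : 1 < s -> lambda0_ess H = +oo%E.
Proof.
move=> s1; apply/eqyP => c c0; pose b := c + 1.
have b0 : 0 <= b by rewrite addr_ge0 // ltW.
have [N HN] := width_small b s1.
apply: (@antitree_lambda0_ess_ge _ _ _ _ _ N); rewrite ?(ltW c0) //.
  by apply: ltW; apply: lt_trans s1.
move=> f M Df f0 NM; apply: (hardy_affine (m := 1) (b := b) Df f0) => //.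
- by rewrite expr1n.
- move=> n /HN; apply: le_trans; rewrite ler_wpM2l // ler_pMr ?width_gt0 //.
  by rewrite ler1n.
- move=> n Nn; have h := HN n.+1 (leq_trans Nn (leqnSn n)).
  rewrite mulr1; apply: (@le_trans _ _ (b * width s n.+1 * (n.+2%:R * (2 * q%:R)))).
    apply: ler_wpM2l; first by rewrite mulr_ge0 // ltW // width_gt0.
    rewrite -[n.+2%:R]natr1; have : 0 <= (2 * q%:R - 1) * n.+1%:R :> R.
      by apply: mulr_ge0 => //; have := q1; lra.
    lra.
  rewrite mulrA -[leRHS]mul1r; apply: ler_wpM2r; first by rewrite mulr_ge0.
  by rewrite -mulrA.
Qed.

End ConcreteLowerBounds.

(** * Radial functions and quasi-modes *)

Section Radial.
Variables (R : realType) (q : nat) (s : R).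
Local Notation G := (antitree q s).
Local Notation D := (@premin_dom R G).
Implicit Types (f : edge G -> R -> R[i]) (X Y : nat -> R -> R).

Definition radial X : edge G -> R -> R[i] := fun e t => (X (level e) t)%:C.

Definition level_weight n : R := n.+1%:R ^+ q * n.+2%:R ^+ q.

Lemma level_weight_gt0 n : 0 < level_weight n.
Proof. by rewrite mulr_gt0 ?exprn_gt0 ?ltr0n. Qed.

Lemma level_sum_const N M (F : nat -> R) :
  level_sum N M (fun e : edge G => F (level e)) = \sum_(N <= n < M) level_weight n * F n.
Proof.
apply: eq_bigr => n _; rewrite (eq_bigr (fun=> F n)) // sumr_const card_level.
by rewrite -mulr_natl natrM !natrX.
Qed.

Section Square.
Variables (X : nat -> R -> R) (M : nat).
Hypothesis sX : forall n, sqi 0 (width s n) (X n).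
Hypothesis X0 : forall n t, (M <= n)%N -> 0 <= t <= width s n -> X n t = 0.

Lemma radial_edge_L2 e : edge_L2 (len e) (radial X e).
Proof. by apply/edge_L2P; split; [exact: sX|exact: sqi_cst]. Qed.

Lemma radial_vanishes : vanishes_from M (radial X).
Proof. by move=> e t Me tl; rewrite /radial X0. Qed.

Lemma radial_L2 : @L2 R G (radial X).
Proof.
rewrite L2E; split; first exact: radial_edge_L2.
apply: (summ_finite (finite_levels q s M)) => e /negP; rewrite -leqNgt => Me.
exact: (edge_sqr0 radial_vanishes Me).
Qed.

Lemma re_radial_ip f : (forall e, edge_L2 (len e) (f e)) ->
  re (L2_ip (radial X) f) =
  level_sum 0 M (fun e => itg 0 (len e) (fun t => X (level e) t * re (f e t))).
Proof.
move=> Lf; rewrite L2_ipE.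
have E (e : edge G) : re (edge_ip (len e) (radial X e) (f e)) =
    itg 0 (len e) (fun t => X (level e) t * re (f e t)).
  rewrite (re_edge_ip (radial_edge_L2 e) (Lf e)) /=.
  rewrite [X in _ + X](_ : _ = 0) ?addr0 //.
  by rewrite -[RHS](itg0 (0 : R) (len e)); apply: eq_itg => t _; rewrite mul0r.
transitivity (rsum (fun e : edge G => re (edge_ip (len e) (radial X e) (f e)))) => //.
rewrite (_ : (fun e => _) = fun e => itg 0 (len e) (fun t => X (level e) t * re (f e t))).
  apply: rsum_levels => e Me; rewrite -[RHS](itg0 (0 : R) (len e)).
  by apply: eq_itg => t tl; rewrite X0 // mul0r.
by apply: funext.
Qed.

Lemma hnorm_radial : hnorm (X := L2_space G) (radial X) ^+ 2 =
  \sum_(0 <= n < M) level_weight n * itg 0 (width s n) (fun t => X n t ^+ 2).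
Proof.
have HX := hilbert_L2 G.
rewrite [LHS](snorm_sqr (hilS HX)); last exact: radial_L2.
rewrite [LHS]re_radial_ip; last exact: radial_edge_L2.
by rewrite (level_sum_const _ _ (fun n => itg 0 (width s n) (fun t => X n t * X n t))).
Qed.

End Square.

Section Smooth.
Variables (X Y : nat -> R -> R) (M : nat).
Hypothesis hX : forall n, rH2 (width s n) (X n).
Hypothesis pX : forall n, primitive 0 (width s n) (X n) (Y n).
Hypothesis X0 : forall n t, (M <= n)%N -> 0 <= t <= width s n -> X n t = 0.
Hypothesis Xc : forall n, X n (width s n) = X n.+1 0.
Hypothesis Y0 : forall n, Y n 0 = 0.
Hypothesis Yw : forall n, Y n (width s n) = 0.

Lemma deriv_radial e t : 0 <= t <= len e -> deriv (radial X) e t = radial Y e t.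
Proof.
move=> tl; apply: complexP => /=.
  exact: (rderiv_prim (len_gt0 e) (pX (level e)) tl).
exact: (rderiv_prim (len_gt0 e) (prim_cst 0 (len e) 0) tl).
Qed.

(** Vanishing slopes at both ends of every edge satisfy the Kirchhoff conditions term by term,
    without any balance between incoming and outgoing edges. *)
Lemma radial_premin : D (radial X).
Proof.
split.
- by move=> e; apply/H2P; split; [exact: hX|exact: (rH2_smooth (len_gt0 e) (prim_cst _ _ 0) (prim_cst _ _ 0))].
- apply: (@sub_finite_set _ _ [set e : edge G | (level e < M)%N]); last exact: finite_levels.
  move=> e [t tl]; apply: contra_neqT; rewrite -leqNgt => Me.
  by rewrite /radial X0 // -in_itv.
- have V (v : vertex G) (e : edge G) : incident v e ->
      vertex_value (radial X) v e = (X (tag (v : antitree_vertex q)) 0)%:C.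
    rewrite /vertex_value => -[<-|<-]; first by rewrite eqxx.
    by rewrite (negbTE (loopless e)) /radial [X in X%:C](Xc (level e)).
  by move=> v e e' /V-> /V->.
- move=> v; rewrite fsbig1 // => e _; rewrite /outward_deriv.
  case: ifP => _; rewrite -/(deriv (radial X) e _) deriv_radial ?lexx ?(ltW (len_gt0 e)) //.
    by rewrite /radial Y0.
  by rewrite /radial [Y _ _](Yw (level e)) oppr0.
Qed.

Lemma energy_radial f : energy (radial X) f = L2_ip (radial Y) (deriv f).
Proof.
rewrite energyE L2_ipE; congr csum; apply: funext => e.
by apply: eq_edge_ip => t tl //; exact: deriv_radial.
Qed.

End Smooth.
End Radial.

(** * The upper bound from a test function *)

Section UpperBound.
Variables (R : realType) (q : nat) (s : R).
Local Notation G := (antitree q s).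
Local Notation H := (kirchhoff_laplacian G).

(** Chosen to vanish at 1 and to have slope 0 at 0 and at 1, as [radial_premin] requires. The edges
    at the root have length 1 for every [s]. *)
Let u (x : R) : R := (1 - x ^+ 2) ^+ 2.
Let u' (x : R) : R := - (4 * x * (1 - x ^+ 2)).
Let u'' (x : R) : R := 12 * x ^+ 2 - 4.

Let prim1 (a b : R) : primitive a b (fun x : R => 1 - x ^+ 2) (fun x => - (2 * x)).
Proof.
have := prim_lin (-1) (prim_mul (prim_id a b) (prim_id a b)) (prim_cst a b 1).
by apply: eq_prim => t _; rewrite ?expr2 /=; ring.
Qed.

Let primu (a b : R) : primitive a b u u'.
Proof.
by have := prim_mul (prim1 a b) (prim1 a b); apply: eq_prim => t _; rewrite /u /u'; ring.
Qed.

Let primu' (a b : R) : primitive a b u' u''.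
Proof.
have := prim_lin (- 4) (prim_mul (prim_id a b) (prim1 a b)) (prim_cst a b 0).
by apply: eq_prim => t _; rewrite /u' /u'' /=; ring.
Qed.

Let itg_u : itg 0 1 (fun x => u' x ^+ 2) = 3 * itg 0 1 (fun x => u x ^+ 2).
Proof.
(* An antiderivative of [3 u^2 - u'^2] is [(8/3) x (1 - x^2)^3 + (1/3) x (1 - x^2)^4], which
   vanishes at 0 and at 1. *)
have p3 := prim_mul (prim_mul (prim_id 0 1) (primu 0 1)) (prim1 0 1).
have p4 := prim_mul (prim_mul (prim_id 0 1) (primu 0 1)) (primu 0 1).
have := prim_diff (prim_lin (8 / 3) p3 (prim_lin (1 / 3) p4 (prim_cst 0 1 0))) (lexx 0)
  ler01 (lexx 1).
set F := (fun x : R => _ + (_ + 0)); set z := (X in X = _).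
have -> : z = 0 by rewrite /z /u; ring.
have -> : itg 0 1 F = itg 0 1 (fun x => 3 * u x ^+ 2 - u' x ^+ 2).
  by apply: eq_itg => x _; rewrite /F /u /u'; field.
have su := sqi_sqr (prim_sqi (primu 0 1)); have su' := sqi_sqr (prim_sqi (primu' 0 1)).
by rewrite (itgB (itgableZ 3 su) su') itgZ // => /esym/eqP; rewrite subr_eq0 => /eqP.
Qed.

Let itg_u_gt0 : 0 < itg 0 1 (fun x => u x ^+ 2).
Proof.
(* [u 0 = 1], while a zero integral would force the trace at 0 to vanish. *)
have := @trace_bound _ 0 1 u u' 0 ltr01 (primu 0 1); rewrite itg_u lexx ler01 subr0 => /(_ isT).
by rewrite {1}/u expr0n /= subr0 !expr1n; lra.
Qed.

Let X (n : nat) : R -> R := if n is 0 then u else fun=> 0.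
Let Y (n : nat) : R -> R := if n is 0 then u' else fun=> 0.

Lemma antitree_lambda0_le : (lambda0 H <= (pi ^+ 2)%:E)%E.
Proof.
have w0 : width s 0 = 1 by rewrite /width powR1.
have u1 : u 1 = 0 by rewrite /u expr1n subrr expr0n.
have pX n : primitive 0 (width s n) (X n) (Y n).
  by case: n => [|n]; [exact: primu|exact: prim_cst].
have hX n : rH2 (width s n) (X n).
  case: n => [|n]; first exact: (rH2_smooth (width_gt0 s 0) (primu _ _) (primu' _ _)).
  exact: (rH2_smooth (width_gt0 s n.+1) (prim_cst _ _ 0) (prim_cst _ _ 0)).
have X0 n t : (1 <= n)%N -> 0 <= t <= width s n -> X n t = 0 by case: n.
have Y0 n t : (1 <= n)%N -> 0 <= t <= width s n -> Y n t = 0 by case: n.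
have Xc n : X n (width s n) = X n.+1 0 by case: n => [|n] //; rewrite w0.
have Ya n : Y n 0 = 0 by case: n => [|n] //; rewrite /= /u' mulr0 mul0r oppr0.
have Yb n : Y n (width s n) = 0.
  by case: n => [|n] //; rewrite w0 /= /u' expr1n subrr mulr0 oppr0.
have DX := @radial_premin R q s X Y 1 hX pX X0 Xc Ya Yb.
have sX n : sqi 0 (width s n) (X n) := prim_sqi (pX n).
have sY n : sqi 0 (width s n) (Y n) := prim_sqi' (pX n).
have HX := hilbert_L2 G.
have nX := @hnorm_radial R q s X 1 sX X0.
have nY := @hnorm_radial R q s Y 1 sY Y0.
rewrite big_nat1 w0 in nX; rewrite big_nat1 w0 in nY.
have weight0 := level_weight_gt0 R q 0.
have n0 : 0 < hnorm (X := L2_space G) (radial X).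
  rewrite lt0r sqrtr_ge0 andbT -sqrf_eq0; apply/lt0r_neq0; rewrite nX.
  exact: mulr_gt0 weight0 itg_u_gt0.
apply: (lambda0_le (hilbert_L2 G) (@premin_L2 R G) (energy_sesq G)
  (@energy_closable R G) DX n0).
rewrite -[re (ip _ _)](snorm_sqr (hilS HX)); last exact: premin_L2.
rewrite [snorm _ _ ^+ 2]nX (energy_radial pX).
have -> : re (@L2_ip R G (radial Y) (deriv (radial X))) =
    hnorm (X := L2_space G) (radial Y) ^+ 2.
  rewrite [RHS](snorm_sqr (hilS HX)); last exact: (@radial_L2 R q s Y 1 sY Y0).
  congr re; rewrite !L2_ipE; congr csum; apply: funext => e.
  by apply: eq_edge_ip => t tl //; exact: (deriv_radial pX).
rewrite nY /= itg_u mulrCA ler_wpM2r //.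
  by rewrite mulr_ge0 ?(ltW weight0) // ltW // itg_u_gt0.
apply: le_trans (_ : 2 ^+ 2 <= _); first by rewrite expr2; lra.
by rewrite ler_pXn2r ?nnegrE ?pi_ge0 // pi_ge2.
Qed.

End UpperBound.

(** * Correcting the end slopes *)

Section Corner.
Variable R : realType.
Implicit Types (l a b c eps : R).

Lemma prim_pow (z : R -> R) a b c n : primitive a b z (fun=> c) ->
  primitive a b (fun t => z t ^+ n.+1) (fun t => c * n.+1%:R * z t ^+ n).
Proof.
move=> pz; elim: n => [|n IH].
  by apply: eq_prim pz => t _; rewrite ?expr1 // expr0; ring.
have := prim_mul pz IH; apply: eq_prim => t _; first by rewrite -exprS.
by rewrite -[n.+2%:R]natr1 !exprS; ring.
Qed.

Lemma itg_pow (z : R -> R) l c n : 0 <= l -> c != 0 -> primitive 0 l z (fun=> c) ->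
  itg 0 l (fun t => z t ^+ n) = (z l ^+ n.+1 - z 0 ^+ n.+1) / (c * n.+1%:R).
Proof.
move=> l0 c0 pz; have pn := prim_pow n pz.
have c1 : c * n.+1%:R != 0 by rewrite mulf_neq0 // pnatr_eq0.
rewrite (prim_diff pn (lexx 0) l0 (lexx l)) (itgZ (c * n.+1%:R)); last first.
  by case: n {pn c1} => [|n]; [exact: itgable_cst|exact: sqi_itgable (prim_sqi (prim_pow n pz))].
by rewrite mulrC mulKf.
Qed.

(* With K = k + 2 and z running affinely through [0, 1] with slope c, this is
   (z - 1) z^K / c, whose derivative is 1 at z = 1 and 0 at z = 0. *)
Let bump l c k (z : R -> R) : 0 < l -> c ^+ 2 * l ^+ 2 = 1 ->
  primitive 0 l z (fun=> c) -> z l - z 0 = c * l ->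
  (z 0 = 0 /\ z l = 1) \/ (z 0 = 1 /\ z l = 0) ->
  exists b b' b'' : R -> R,
    [/\ primitive 0 l b b', primitive 0 l b' b'',
        b 0 = 0 /\ b l = 0, b' 0 = z 0 /\ b' l = z l &
        itg 0 l (fun t => b t ^+ 2) <= l ^+ 3 / k.+1%:R /\
        itg 0 l (fun t => b' t ^+ 2) <= l / k.+1%:R].
Proof.
move=> l0 cl pz zd zz; have c0 : c != 0.
  by apply/eqP => c0; move/eqP: cl; rewrite c0 expr0n mul0r eq_sym oner_eq0.
have l0' := ltW l0.
have IP n : itg 0 l (fun t => z t ^+ n) = l / n.+1%:R.
  rewrite (itg_pow n l0' c0 pz).
  have -> : z l ^+ n.+1 - z 0 ^+ n.+1 = c * l.
    by rewrite -zd; case: zz => -[-> ->]; rewrite expr0n expr1n.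
  by rewrite invfM mulrACA divff // mul1r.
have PI n : itgable 0 l (fun t => z t ^+ n).
  by case: n => [|n]; [exact: itgable_cst|exact: sqi_itgable (prim_sqi (prim_pow n pz))].
pose K : R := k.+2%:R.
have K1 : K = k%:R + 2 by rewrite /K -addn2 natrD.
pose b t := c^-1 * (z t ^+ k.+3 - z t ^+ k.+2).
pose b' t := (K + 1) * z t ^+ k.+2 - K * z t ^+ k.+1.
pose b'' t := (K + 1) * (c * K * z t ^+ k.+1) - K * (c * k.+1%:R * z t ^+ k).
exists b, b', b''; split.
- have := prim_lin c^-1 (prim_pow k.+2 pz) (prim_lin (- c^-1) (prim_pow k.+1 pz) (prim_cst 0 l 0)).
  apply: eq_prim => t _; rewrite /b /b'; first by ring.
  by rewrite -[k.+3%:R]natr1 -/K; field.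
- have := prim_lin (K + 1) (prim_pow k.+1 pz) (prim_lin (- K) (prim_pow k pz) (prim_cst 0 l 0)).
  by apply: eq_prim => t _; rewrite /b' /b'' /K; ring.
- by rewrite /b; case: zz => -[-> ->]; rewrite !expr0n !expr1n !subrr !mulr0.
- by rewrite /b'; case: zz => -[-> ->]; rewrite !expr0n !expr1n !mulr0 !mulr1 subrr addrAC subrr add0r.
pose x : R := k%:R; have k0 : 0 <= x by rewrite /x.
have E n : n.+1%:R = n%:R + 1 :> R by rewrite natr1.
split.
  (* The squares are integrated exactly. Monomials of neighbouring degrees nearly cancel, which
     leaves decay of order [k^(-3)] here and of order [k^(-1)] for [b']. *)
  have -> : itg 0 l (fun t => b t ^+ 2) =
      l ^+ 2 * (l / (k.+3 + k.+3).+1%:R + (- 2 * (l / (k.+3 + k.+2).+1%:R) + l / (k.+2 + k.+2).+1%:R)).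
    rewrite -!IP -(itgZ (- 2)) // -itgD //; last exact: itgableZ.
    rewrite -itgD //; last by apply: itgableD => //; exact: itgableZ.
    rewrite -(itgZ (l ^+ 2)); last by apply: itgableD => //; apply: itgableD => //; exact: itgableZ.
    apply: eq_itg => t _; rewrite /b !exprMn !exprD.
    have -> : c^-1 ^+ 2 = l ^+ 2.
      by apply: (mulfI (expf_neq0 2 c0)); rewrite cl -exprMn mulfV // expr1n.
    by ring.
  have -> : (k.+3 + k.+3).+1%:R = 2 * x + 7 :> R by rewrite !addSn !addnS !E natrD /x; ring.
  have -> : (k.+3 + k.+2).+1%:R = 2 * x + 6 :> R by rewrite !addSn !addnS !E natrD /x; ring.
  have -> : (k.+2 + k.+2).+1%:R = 2 * x + 5 :> R by rewrite !addSn !addnS !E natrD /x; ring.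
  rewrite E -/x [l ^+ 3]exprSr -mulrA ler_wpM2l ?exprn_ge0 //.
  have -> : l / (2 * x + 7) + (- 2 * (l / (2 * x + 6)) + l / (2 * x + 5)) =
     l * (2 / ((2 * x + 5) * (2 * x + 6) * (2 * x + 7))).
    by field; lra.
  rewrite ler_wpM2l //; rewrite ler_pdivrMr; last by rewrite !mulr_gt0 //; lra.
  rewrite -ler_pdivrMl; last by rewrite invr_gt0; lra.
  rewrite invrK; nra.
have -> : itg 0 l (fun t => b' t ^+ 2) =
    (K + 1) ^+ 2 * (l / (k.+2 + k.+2).+1%:R) +
    (- 2 * K * (K + 1) * (l / (k.+2 + k.+1).+1%:R) + K ^+ 2 * (l / (k.+1 + k.+1).+1%:R)).
  rewrite -!IP -!itgZ // -itgD //; try exact: itgableZ.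
  rewrite -itgD //; [|exact: itgableZ|by apply: itgableD; exact: itgableZ].
  by apply: eq_itg => t _; rewrite /b' !exprD; ring.
have -> : (k.+2 + k.+2).+1%:R = 2 * x + 5 :> R by rewrite !addSn !addnS !E natrD /x; ring.
have -> : (k.+2 + k.+1).+1%:R = 2 * x + 4 :> R by rewrite !addSn !addnS !E natrD /x; ring.
have -> : (k.+1 + k.+1).+1%:R = 2 * x + 3 :> R by rewrite !addSn !addnS !E natrD /x; ring.
rewrite K1 E -/x.
have -> : (x + 2 + 1) ^+ 2 * (l / (2 * x + 5)) +
  (- 2 * (x + 2) * (x + 2 + 1) * (l / (2 * x + 4)) + (x + 2) ^+ 2 * (l / (2 * x + 3))) =
  l * ((x + 2) / ((2 * x + 5) * (2 * x + 3))).
  by field; lra.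
rewrite ler_wpM2l // ler_pdivrMr; last by rewrite mulr_gt0; lra.
rewrite -ler_pdivrMl; last by rewrite invr_gt0; lra.
rewrite invrK; nra.
Qed.

(* Subtracting such a function from a quasi-mode makes its end slopes vanish,
   hence enforces the Kirchhoff conditions, at no cost in H^1. *)
Lemma corner l a b eps : 0 < l -> 0 < eps -> exists c c' c'' : R -> R,
  [/\ primitive 0 l c c', primitive 0 l c' c'',
      c 0 = 0 /\ c l = 0, c' 0 = a /\ c' l = b &
      itg 0 l (fun t => c t ^+ 2) <= eps /\ itg 0 l (fun t => c' t ^+ 2) <= eps].
Proof.
move=> l0 eps0; have l0' := ltW l0; have ln0 : l != 0 by rewrite gt_eqF.
pose m := l ^+ 3 + l; have m0 : 0 < m by rewrite addr_gt0 ?exprn_gt0.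
pose S := 2 * (a ^+ 2 + b ^+ 2) * m.
pose k := Num.truncn (S / eps).
have kS : S / k.+1%:R <= eps.
  rewrite ler_pdivrMr ?ltr0n // mulrC -ler_pdivrMr //; exact/ltW/truncnS_gt.
(* The decreasing affine function carries the slope [a] at 0, the increasing one the slope [b] at
   [l]. *)
have p1 : primitive 0 l (fun t => (- l^-1) * t + 1) (fun=> - l^-1).
  by have := prim_lin (- l^-1) (prim_id 0 l) (prim_cst 0 l 1); apply: eq_prim => t _; ring.
have p2 : primitive 0 l (fun t => l^-1 * t) (fun=> l^-1).
  by have := prim_lin l^-1 (prim_id 0 l) (prim_cst 0 l 0); apply: eq_prim => t _ /=; ring.
have [|||b1 [b1' [b1'' [P1 P1' [z1 w1] [x1 y1] [i1 j1]]]]] := bump k l0 _ p1.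
- by field.
- by ring.
- by right; rewrite mulr0 add0r mulNr mulVf // addNr.
have [|||b2 [b2' [b2'' [P2 P2' [z2 w2] [x2 y2] [i2 j2]]]]] := bump k l0 _ p2.
- by field.
- by ring.
- by left; rewrite mulr0 mulVf.
exists (fun t => a * b1 t + (b * b2 t + 0)), (fun t => a * b1' t + (b * b2' t + 0)),
  (fun t => a * b1'' t + (b * b2'' t + 0)); split.
- exact: prim_lin P1 (prim_lin b P2 (prim_cst 0 l 0)).
- exact: prim_lin P1' (prim_lin b P2' (prim_cst 0 l 0)).
- by rewrite z1 w1 z2 w2; split; ring.
- by rewrite x1 y1 x2 y2; split; field.
have comb (u v : R -> R) (M : R) : sqi 0 l u -> sqi 0 l v -> M <= m ->
    itg 0 l (fun t => u t ^+ 2) <= M / k.+1%:R -> itg 0 l (fun t => v t ^+ 2) <= M / k.+1%:R ->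
    itg 0 l (fun t => (a * u t + (b * v t + 0)) ^+ 2) <= eps.
  move=> su sv Mm hu hv; apply: le_trans kS.
  have i1' := itgableZ (2 * a ^+ 2) (sqi_sqr su); have i2' := itgableZ (2 * b ^+ 2) (sqi_sqr sv).
  apply: (@le_trans _ _ (itg 0 l (fun t => 2 * a ^+ 2 * u t ^+ 2 + 2 * b ^+ 2 * v t ^+ 2))).
    apply: itg_le; [|exact: itgableD|].
      apply: sqi_sqr; apply: sqi_lin => //; apply: sqi_lin => //; exact: sqi_cst.
    move=> t _; have := sqr_ge0 (a * u t - b * v t); nra.
  rewrite itgD // (itgZ (2 * a ^+ 2) (sqi_sqr su)) (itgZ (2 * b ^+ 2) (sqi_sqr sv)).
  have a0 := sqr_ge0 a; have b0 := sqr_ge0 b.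
  have Mk : M / k.+1%:R <= m / k.+1%:R by rewrite ler_pM2r ?invr_gt0 ?ltr0n.
  have h1 := ler_wpM2l (mulr_ge0 (ler0n R 2) a0) (le_trans hu Mk).
  have h2 := ler_wpM2l (mulr_ge0 (ler0n R 2) b0) (le_trans hv Mk).
  apply: le_trans (lerD h1 h2) _; rewrite /S -mulrDl -mulrDr mulrA //.
split.
  apply: (comb _ _ (l ^+ 3)) => //; [exact: prim_sqi P1|exact: prim_sqi P2|].
  by rewrite /m lerDl.
apply: (comb _ _ l) => //; [exact: prim_sqi P1'|exact: prim_sqi P2'|].
by rewrite /m lerDr exprn_ge0.
Qed.

End Corner.

Section QuasiModeBound.
Variables (R : realType) (V : lmodType R[i]) (D : set V) (ip : V -> V -> R[i]).
Hypothesis HS : sesq D ip.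
Local Notation norm := (snorm ip).

(** Here [x], [y] stand for a function and its derivative, [f], [z] for a flux and its derivative,
    [c], [c'] for the correction and its derivative, [v'] for the derivative of [v]. Integration by
    parts turns [(y, v') - lam (x, v)] into [(y - f, v') - (z + lam x, v)], a sum of two small
    defects; the correction costs at most [(1 + |lam| + eps) eta]. *)
Lemma quasi_mode_bound (x y f z c c' v v' : V) (lam S eta d eps : R) :
  D x -> D y -> D f -> D z -> D c -> D c' -> D v -> D v' ->
  norm v <= S -> norm v' <= S -> re (ip f v') = - re (ip z v) ->
  norm c <= eta -> norm c' <= eta ->
  norm (y - f) + norm (z + lam%:C *: x) <= d * norm x ->
  (1 + `|lam| + eps) * eta <= (eps - d) * norm x -> 0 <= eps ->
  re (ip (y - c') v' - lam%:C * ip (x - c) v) <= eps * norm (x - c) * S.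
Proof.
move=> Dx Dy Df Dz Dc Dc' Dv Dv' Sv Sv' ibp cs cs' dX etaE eps0.
have S0 : 0 <= S := le_trans (snorm_ge0 _ _) Sv.
have bound g h : D g -> D h -> norm h <= S -> `|re (ip g h)| <= norm g * S.
  move=> Dg Dh hS; apply: le_trans (abs_re_le _) _; apply: le_trans (sesq_CS HS Dg Dh) _.
  by apply: ler_wpM2l hS; exact: snorm_ge0.
have nU : norm x - eta <= norm (x - c).
  by rewrite lerBlDl; apply: le_trans (snorm_sub_le HS Dx Dc) _; exact: lerD.
rewrite re_add re_opp re_rmul (sesqBl HS Dy Dc' Dv') (sesqBl HS Dx Dc Dv) !re_add !re_opp.
have Dyf : D (y - f) := sesqB HS Dy Df.
have Dlx : D (lam%:C *: x) := sesqZ HS lam%:C Dx.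
have Dzx : D (z + lam%:C *: x) := sesqD HS Dz Dlx.
have b1 := le_trans (bound _ _ Dc Dv Sv) (ler_wpM2r S0 cs).
have b2 := le_trans (bound _ _ Dc' Dv' Sv') (ler_wpM2r S0 cs').
have b3 := bound _ _ Dzx Dv Sv; rewrite (sesqDl HS Dz Dlx Dv) (sesqZl HS _ Dx Dv) re_add re_rmul in b3.
have b4 := bound _ _ Dyf Dv' Sv'; rewrite (sesqBl HS Dy Df Dv') re_add re_opp ibp in b4.
set i1 := re (ip c v) in b1 *; set i2 := re (ip c' v') in b2 *.
set i3 := re (ip z v) in b3 b4 *; set i4 := re (ip x v) in b3 *.
set i5 := re (ip y v') in b4 *.
have b5 : `|lam * i1| <= `|lam| * (eta * S) by rewrite normrM ler_wpM2l.
have dXS := ler_wpM2r S0 dX; have etaS := ler_wpM2r S0 etaE.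
have nUS := ler_wpM2l eps0 (ler_wpM2r S0 nU).
rewrite -mulrA; apply: le_trans nUS.
move: b2 b3 b4 b5; rewrite !ler_norml => /andP[b2 _] /andP[b3 _] /andP[_ b4] /andP[_ b5].
move: dXS etaS; rewrite !mulrDl mul1r !mulNr -!mulrA.
rewrite !mulrBr; lra.
Qed.

End QuasiModeBound.

(** The correction has to fit into the gap between [d] and [eps], and to be too small to annihilate
    the quasi-mode. *)
Lemma small_correction (R : realType) (x d eps m : R) : 0 < x -> d < eps -> 0 <= d -> 0 <= m ->
  exists eta, [/\ 0 < eta, (1 + m + eps) * eta <= (eps - d) * x & eta < x].
Proof.
move=> x0 de d0 m0; have D0 : 0 < 1 + m + eps by lra.
have n0 : 0 < (eps - d) * x by rewrite mulr_gt0 // subr_gt0.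
exists ((eps - d) * x / (1 + m + eps)); split.
- exact: divr_gt0.
- by rewrite mulrC divfK // gt_eqF.
rewrite ltr_pdivrMr // mulrC ltr_pM2l //; lra.
Qed.

Section QuasiMode.
Variables (R : realType) (q : nat) (s : R).
Local Notation G := (antitree q s).
Local Notation D := (@premin_dom R G).
Local Notation L2ip := (@L2_ip R G).
Local Notation L2norm := (snorm L2ip).
Local Notation rad := (@radial R q s).
Implicit Types (f v : edge G -> R -> R[i]).

Let HS : sesq (@L2 R G) L2ip := hilS (hilbert_L2 G).

Definition vanish M (X : nat -> R -> R) : Prop :=
  forall n t, (M <= n)%N -> 0 <= t <= width s n -> X n t = 0.

(** Integration by parts on each edge leaves only boundary terms, and the balance of [F] between the
    two sides of each sphere cancels them. *)
Lemma flux_ibp (F Z : nat -> R -> R) M v :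
  (forall n, primitive 0 (width s n) (F n) (Z n)) -> vanish M F -> vanish M Z ->
  F 0 0 = 0 ->
  (forall n, n.+1%:R ^+ q * F n (width s n) = n.+3%:R ^+ q * F n.+1 0) ->
  D v -> re (L2ip (rad F) (deriv v)) = - re (L2ip (rad Z) v).
Proof.
move=> pF F0 Z0 F00 Fc Dv.
have Hv e : H2 (len e) (v e) by case: Dv.
have F1 : vanish M.+1 F by move=> n t Mn; apply: F0; exact: ltnW.
have Z1 : vanish M.+1 Z by move=> n t Mn; apply: Z0; exact: ltnW.
rewrite (re_radial_ip (fun n => prim_sqi (pF n)) F1 (fun e => H2_deriv_L2 (Hv e))).
rewrite (re_radial_ip (fun n => prim_sqi' (pF n)) Z1 (fun e => H2_L2 (Hv e))).
apply/eqP; rewrite -addr_eq0; apply/eqP.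
pose phi n (i : 'I_(n.+1 ^ q)) : R := re (trace v i).
transitivity (flux (fun n => F n 0) (fun n => F n (width s n)) phi 0 M.+1).
  rewrite /level_sum /flux -big_split; apply: eq_bigr => n _ /=.
  rewrite -big_split; apply: eq_bigr => p _; set e := level_edge s p.
  have [pr _] := H2_prim (Hv e); have w0 := ltW (len_gt0 e).
  rewrite /phi -(trace_src p Dv) -(trace_tgt p Dv).
  rewrite [RHS](prim_diff (prim_mul (pF n) pr) (lexx 0) w0 (lexx _)).
  rewrite [RHS]itgD; first exact: addrC.
    by apply: itgableM; [exact: prim_sqi' (pF n)|exact: prim_sqi pr].
  by apply: itgableM; [exact: prim_sqi (pF n)|exact: prim_sqi' pr].
rewrite flux_vertices // F00 mul0r mul0r oppr0 add0r.
rewrite big1 => [|n _]; last by rewrite Fc subrr mul0r.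
by rewrite F0 ?mulr0 ?mul0r ?addr0 // ltW ?width_gt0 // lexx.
Qed.

Lemma radial_sub (X Y : nat -> R -> R) : rad (fun n t => X n t - Y n t) = rad X - rad Y.
Proof.
apply: funext => e; apply: funext => t; rewrite [RHS](_ : _ = rad X e t - rad Y e t) //.
by rewrite /radial -rmorphB.
Qed.

Lemma radial_lin (X Y : nat -> R -> R) (c : R) :
  rad (fun n t => X n t + c * Y n t) = rad X + c%:C *: rad Y.
Proof.
apply: funext => e; apply: funext => t; rewrite [RHS](_ : _ = rad X e t + c%:C * rad Y e t) //.
by rewrite /radial -rmorphM -rmorphD.
Qed.

Lemma radial_small (C : nat -> R -> R) M eps : 0 < eps ->
  (forall n, sqi 0 (width s n) (C n)) -> vanish M C ->
  (forall n, itg 0 (width s n) (fun t => C n t ^+ 2) <=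
     eps ^+ 2 / (M.+1%:R * level_weight R q n)) ->
  L2norm (rad C) <= eps.
Proof.
move=> e0 sC C0 Ceps; rewrite -(ler_pXn2r (ltn0Sn 1)) ?nnegrE ?sqrtr_ge0 ?(ltW e0) //.
rewrite [L2norm _ ^+ 2](@hnorm_radial R q s C M sC C0).
apply: (@le_trans _ _ (\sum_(0 <= n < M) eps ^+ 2 / M.+1%:R)).
  apply: ler_sum => n _; have w0 := level_weight_gt0 R q n.
  apply: le_trans (ler_wpM2l (ltW w0) (Ceps n)) _.
  by rewrite invfM mulrCA [X in _ * X]mulrCA mulfV ?gt_eqF // mulr1.
rewrite sumr_const_nat subn0 -[leLHS]mulr_natr -mulrA ler_piMr ?sqr_ge0 //.
by rewrite mulrC ler_pdivrMr ?ltr0n // mul1r ler_nat.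
Qed.

Lemma sqrt_energy_ge v : D v ->
  snorm L2ip v <= Num.sqrt (re (energy v v) + re (L2ip v v)) /\
  snorm L2ip (deriv v) <= Num.sqrt (re (energy v v) + re (L2ip v v)).
Proof.
move=> Dv; have e0 := sesq_ge0 (energy_sesq G) Dv.
have i0 := sesq_ge0 HS (premin_L2 Dv).
by split; apply: ler_wsqrtr; [exact: ler_wpDl e0 (lexx _)|exact: ler_wpDr i0 (lexx _)].
Qed.

(** The flux [F] may differ from [Y], and [Y] may be nonzero at the vertices: the first discrepancy
    is one of the two measured defects, and the second is removed by [corner] at a cost absorbed
    between [d] and [eps]. *)
Lemma quasi_mode (X Y W F Z : nat -> R -> R) M (lam d eps : R) :
  (forall n, primitive 0 (width s n) (X n) (Y n)) ->
  (forall n, primitive 0 (width s n) (Y n) (W n)) ->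
  (forall n, primitive 0 (width s n) (F n) (Z n)) ->
  vanish M X -> vanish M Y -> vanish M F -> vanish M Z ->
  (forall n, X n (width s n) = X n.+1 0) ->
  F 0 0 = 0 ->
  (forall n, n.+1%:R ^+ q * F n (width s n) = n.+3%:R ^+ q * F n.+1 0) ->
  0 < L2norm (rad X) ->
  L2norm (rad (fun n t => Y n t - F n t)) +
    L2norm (rad (fun n t => Z n t + lam * X n t)) <= d * L2norm (rad X) ->
  d < eps -> 0 <= d ->
  exists u, [/\ D u, 0 < L2norm u & forall v, D v ->
    re (energy u v - lam%:C * L2ip u v) <=
    eps * L2norm u * Num.sqrt (re (energy v v) + re (L2ip v v))].
Proof.
move=> pX pY pF X0 Y0 F0 Z0 Xc F00 Fc nX dX de d0.
have sX n := prim_sqi (pX n); have sY n := prim_sqi (pY n).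
have sF n := prim_sqi (pF n); have sZ n := prim_sqi' (pF n).
set x := L2norm (rad X) in nX dX.
have eps0 : 0 < eps by exact: le_lt_trans de.
have [eta [eta0 etaE etax]] := small_correction nX de d0 (normr_ge0 lam).
(* One correction for each level, with the share of the error that [radial_small] allots; from level
   [M] on it is 0, to keep the support finite. *)
have /choice[C CP] : forall n, exists c : (R -> R) * (R -> R) * (R -> R),
  [/\ primitive 0 (width s n) c.1.1 c.1.2, primitive 0 (width s n) c.1.2 c.2,
      c.1.1 0 = 0 /\ c.1.1 (width s n) = 0,
      c.1.2 0 = Y n 0 /\ c.1.2 (width s n) = Y n (width s n) &
      [/\ itg 0 (width s n) (fun t => c.1.1 t ^+ 2) <= eta ^+ 2 / (M.+1%:R * level_weight R q n),
       itg 0 (width s n) (fun t => c.1.2 t ^+ 2) <= eta ^+ 2 / (M.+1%:R * level_weight R q n) &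
       (M <= n)%N -> c.1.1 = (fun=> 0) /\ c.1.2 = (fun=> 0)]].
  move=> n; have w0 := level_weight_gt0 R q n; have wn := width_gt0 s n.
  have k0 : 0 < eta ^+ 2 / (M.+1%:R * level_weight R q n).
    by rewrite divr_gt0 ?exprn_gt0 // mulr_gt0 // ltr0n.
  have [nM|Mn] := ltnP n M.
    have [c [c' [c'' [p1 p2 z y [i1 i2]]]]] := corner (Y n 0) (Y n (width s n)) wn k0.
    by exists (c, c', c''); split.
  exists ((fun=> 0), (fun=> 0), (fun=> 0)); split=> /=; try exact: prim_cst.
  - by [].
  - by rewrite !Y0 ?lexx ?(ltW wn).
  - have z : itg 0 (width s n) (fun=> 0 ^+ 2) = 0 :> R.
      by rewrite -[RHS](itg0 (0 : R) (width s n)); apply: eq_itg => t _; rewrite expr0n.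
    by rewrite z; split=> //; exact: ltW.
pose c n := (C n).1.1; pose c' n := (C n).1.2.
have pc n : primitive 0 (width s n) (c n) (c' n) by case: (CP n).
have pc' n : primitive 0 (width s n) (c' n) (C n).2 by case: (CP n).
have c0 : vanish M c by move=> n t Mn _; rewrite /c; case: (CP n) => _ _ _ _ [_ _ /(_ Mn)[-> _]].
have c'0 : vanish M c' by move=> n t Mn _; rewrite /c'; case: (CP n) => _ _ _ _ [_ _ /(_ Mn)[_ ->]].
have ca n : c n 0 = 0 by case: (CP n) => _ _ [].
have cb n : c n (width s n) = 0 by case: (CP n) => _ _ [].
have c'a n : c' n 0 = Y n 0 by case: (CP n) => _ _ _ [].
have c'b n : c' n (width s n) = Y n (width s n) by case: (CP n) => _ _ _ [].
have sc n := prim_sqi (pc n); have sc' n := prim_sqi (pc' n).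
have cs : L2norm (rad c) <= eta.
  by apply: (radial_small eta0 sc c0) => n; case: (CP n) => _ _ _ _ [].
have cs' : L2norm (rad c') <= eta.
  by apply: (radial_small eta0 sc' c'0) => n; case: (CP n) => _ _ _ _ [].
pose U n t := X n t - c n t; pose U' n t := Y n t - c' n t.
have pU n : primitive 0 (width s n) (U n) (U' n).
  by have := prim_lin (-1) (pc n) (pX n); apply: eq_prim => t _; rewrite addrC mulN1r.
have pU' n : primitive 0 (width s n) (U' n) (fun t => W n t - (C n).2 t).
  by have := prim_lin (-1) (pc' n) (pY n); apply: eq_prim => t _; rewrite addrC mulN1r.
have DU : D (rad U).
  apply: (@radial_premin R q s U U' M) => //.
  - by move=> n; exact: (rH2_smooth (width_gt0 s n) (pU n) (pU' n)).
  - by move=> n t Mn tw; rewrite /U X0 // c0 // subr0.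
  - by move=> n; rewrite /U ca cb Xc.
  - by move=> n; rewrite /U' c'a subrr.
  - by move=> n; rewrite /U' c'b subrr.
have L Y' (sY' : forall n, sqi 0 (width s n) (Y' n)) : vanish M Y' -> L2 (rad Y').
  exact: radial_L2.
have LX := L _ sX X0; have Lc := L _ sc c0; have Lc' := L _ sc' c'0.
have LY := L _ sY Y0; have LF := L _ sF F0; have LZ := L _ sZ Z0.
have UE : rad U = rad X - rad c := radial_sub _ _.
have U'E : rad U' = rad Y - rad c' := radial_sub _ _.
have nU : x - eta <= L2norm (rad U).
  rewrite UE lerBlDl; apply: le_trans (snorm_sub_le HS LX Lc) _.
  exact: lerD cs (lexx _).
exists (rad U); split; [exact: DU|by apply: lt_le_trans nU; rewrite subr_gt0|].
move=> v Dv; have [Sv Sv'] := sqrt_energy_ge Dv.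
set S := Num.sqrt _ in Sv Sv' *; have S0 : 0 <= S by exact: sqrtr_ge0.
have Lv := premin_L2 Dv; have Lv' : L2 (deriv v) by rewrite L2E; exact: premin_deriv_L2.
rewrite (energy_radial pU) U'E UE.
apply: (quasi_mode_bound HS LX LY LF LZ Lc Lc' Lv Lv' Sv Sv' _ cs cs' _ etaE (ltW eps0)).
  exact: flux_ibp pF F0 Z0 F00 Fc Dv.
by move: dX; rewrite radial_sub radial_lin.
Qed.

End QuasiMode.

(** * Beats of two cosines *)

Section Trigonometry.
Variable R : realType.
Implicit Types (a b p al k x y : R).

Lemma prim_affine (u g : R -> R) a b p al :
  (forall x, is_derive x 1 u (g x)) -> continuous g ->
  primitive a b (fun t => u (al * (p + t))) (fun t => al * g (al * (p + t))).
Proof.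
move=> du cg.
have cz : continuous (fun t : R => al * (p + t)).
  by move=> t; apply: cvgM; [exact: cvg_cst|apply: cvgD; [exact: cvg_cst|exact: cvg_id]].
apply: prim_smooth => [x|].
  have dz : is_derive x 1 (fun t : R => al * (p + t)) al.
    have := is_deriveZ al (is_deriveD (is_derive_cst p x 1) (is_derive_id x (1 : R))).
    by rewrite add0r [al *: _]mulr1.
  by have := @is_derive1_comp R u (fun t => al * (p + t)) x _ _ (du _) dz; rewrite mulrC.
move=> t; apply: cvgM; first exact: cvg_cst.
exact: (continuous_comp (cz t) (cg _)).
Qed.

Lemma prim_expR a b p al : primitive a b (fun t => expR (al * (p + t)))
  (fun t => al * expR (al * (p + t))).
Proof. exact: (prim_affine a b p al (@is_derive_expR R) (@continuous_expR R)). Qed.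

Lemma prim_cos a b p al : primitive a b (fun t => cos (al * (p + t)))
  (fun t => al * - sin (al * (p + t))).
Proof.
apply: (prim_affine a b p al (@is_derive_cos R)) => t.
by apply: cvgN; exact: continuous_sin.
Qed.

Lemma prim_sin a b p al : primitive a b (fun t => sin (al * (p + t)))
  (fun t => al * cos (al * (p + t))).
Proof. exact: (prim_affine a b p al (@is_derive_sin R) (@continuous_cos R)). Qed.

Lemma sin_npi n : sin (n%:R * pi) = 0 :> R.
Proof.
elim: n => [|n IH]; first by rewrite mul0r sin0.
by rewrite -[n.+1%:R]natr1 mulrDl mul1r sinD sinpi IH mul0r mulr0 addr0.
Qed.

Section Beat.
Variables (a b : R).
Hypothesis (a0 : 0 < a) (ab : a < b).

(** A difference of cosines vanishes together with its slope at 0, and for the frequencies fixed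
    below also at [L]. Extension by zero outside the window then preserves continuity and flux. *)
Definition beat x : R := cos (a * x) - cos (b * x).
Definition beat1 x : R := b * sin (b * x) - a * sin (a * x).
Definition beat2 x : R := b ^+ 2 * cos (b * x) - a ^+ 2 * cos (a * x).

Lemma prim_beat x y p : primitive x y (fun t => beat (p + t)) (fun t => beat1 (p + t)).
Proof.
have := prim_lin (-1) (prim_cos x y p b) (prim_cos x y p a).
by apply: eq_prim => t _; rewrite /beat /beat1; ring.
Qed.

Lemma prim_beat1 x y p : primitive x y (fun t => beat1 (p + t)) (fun t => beat2 (p + t)).
Proof.
have := prim_lin b (prim_sin x y p b) (prim_lin (- a) (prim_sin x y p a) (prim_cst x y 0)).
by apply: eq_prim => t _; rewrite /beat1 /beat2; ring.
Qed.

Lemma beat_le x : `|beat x| <= 2.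
Proof.
apply: le_trans (ler_normB _ _) _; have := cos_max (a * x); have := cos_max (b * x); lra.
Qed.

Lemma beat1_le x : `|beat1 x| <= a + b.
Proof.
have b0 := lt_trans a0 ab.
apply: le_trans (ler_normB _ _) _; rewrite !normrM (gtr0_norm b0) (gtr0_norm a0).
have := ler_wpM2l (ltW b0) (sin_max (b * x)); have := ler_wpM2l (ltW a0) (sin_max (a * x)); lra.
Qed.

Lemma beat2_le k x :
  `|beat2 x + k ^+ 2 * beat x| <= `|b ^+ 2 - k ^+ 2| + `|a ^+ 2 - k ^+ 2|.
Proof.
have -> : beat2 x + k ^+ 2 * beat x =
    (b ^+ 2 - k ^+ 2) * cos (b * x) - (a ^+ 2 - k ^+ 2) * cos (a * x).
  by rewrite /beat2 /beat; ring.
by apply: le_trans (ler_normB _ _) _; apply: lerD; rewrite normrM ler_piMr ?cos_max.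
Qed.

Lemma beat_0 : beat 0 = 0. Proof. by rewrite /beat !mulr0 subrr. Qed.

Lemma beat1_0 : beat1 0 = 0. Proof. by rewrite /beat1 !mulr0 sin0 !mulr0 subrr. Qed.

(** The mixed terms come from [2 cos (a x) cos (b x) = cos ((b - a) x) + cos ((a + b) x)]. *)
Definition beat_int x : R := x + (4 * a)^-1 * sin (2 * a * x) + (4 * b)^-1 * sin (2 * b * x)
  - (b - a)^-1 * sin ((b - a) * x) - (a + b)^-1 * sin ((a + b) * x).

Lemma prim_beat_int x y p :
  primitive x y (fun t => beat_int (p + t)) (fun t => beat (p + t) ^+ 2).
Proof.
have b0 := lt_trans a0 ab; have ba : 0 < b - a by rewrite subr_gt0.
have sb := addr_gt0 a0 b0.
have := prim_lin (4 * a)^-1 (prim_sin x y p (2 * a)) (prim_lin (4 * b)^-1 (prim_sin x y p (2 * b))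
  (prim_lin (- (b - a)^-1) (prim_sin x y p (b - a))
  (prim_lin (- (a + b)^-1) (prim_sin x y p (a + b))
  (prim_lin 1 (prim_id x y) (prim_cst x y p))))).
apply: eq_prim => t _; rewrite /= /beat_int /beat; first by ring.
set z := p + t; have -> : 2 * a * z = (a * z) *+ 2 by ring.
have -> : 2 * b * z = (b * z) *+ 2 by ring.
rewrite !cos_mulr2n [(b - a) * z]mulrBl [(a + b) * z]mulrDl cosB cosD; field.
by rewrite !gt_eqF.
Qed.

Variables (L : R) (j : nat).
Hypotheses (L0 : 0 < L) (aL : a * L = j%:R * pi) (bL : b * L = j.+2%:R * pi).

Lemma beat_L : beat L = 0.
Proof.
(* [j] and [j + 2] have the same parity, so the two cosines agree at [L]. *)
rewrite /beat aL bL -[j.+2]addn2 natrD mulrDl cosD.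
have -> : 2 * pi = pi *+ 2 :> R by ring.
by rewrite cos2pi sin2pi mulr1 mulr0 subr0 subrr.
Qed.

Lemma beat1_L : beat1 L = 0.
Proof. by rewrite /beat1 aL bL !sin_npi !mulr0 subrr. Qed.

(** At [L] every sine is taken at a multiple of [pi]; the squared beat thus has mean exactly 1 over
    the window. *)
Lemma beat_int_L : beat_int L - beat_int 0 = L.
Proof.
rewrite /beat_int !mulr0 sin0 !mulr0 !(subr0, addr0).
have -> : 2 * a * L = (2 * j)%:R * pi by rewrite natrM -!mulrA aL.
have -> : 2 * b * L = (2 * j.+2)%:R * pi by rewrite natrM -!mulrA bL.
have -> : (b - a) * L = 2%:R * pi by rewrite mulrBl aL bL -[j.+2]addn2 natrD; ring.
have -> : (a + b) * L = (j + j.+2)%:R * pi by rewrite mulrDl aL bL natrD; ring.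
by rewrite !sin_npi !mulr0 !(subr0, addr0).
Qed.

End Beat.
End Trigonometry.

(** * Quasi-modes on a window *)

Section Window.
Variables (R : realType) (q : nat) (s : R).
Local Notation G := (antitree q s).
Local Notation D := (@premin_dom R G).
Local Notation L2ip := (@L2_ip R G).
Local Notation norm := (snorm L2ip).
Local Notation rad := (@radial R q s).
Local Notation weight := (level_weight R q).

Definition height n : R := \sum_(0 <= i < n) width s i.

Lemma heightS n : height n.+1 = height n + width s n.
Proof. by rewrite /height big_nat_recr. Qed.

Lemma sum_width N M : (N <= M)%N -> \sum_(N <= n < M) width s n = height M - height N.
Proof.
by move=> NM; rewrite /height (big_cat_nat (leq0n N) NM) /= addrAC subrr add0r.
Qed.

Variables (kap k c dl L a b : R) (N M j : nat).
Hypotheses (kap0 : 0 <= kap) (c0 : 0 < c) (NM : (N <= M)%N) (dl0 : 0 <= dl) (dl2 : dl <= 2^-1).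
Hypotheses (LE : height M - height N = L) (L0 : 0 < L).
Hypotheses (a0 : 0 < a) (ab : a < b).
Hypotheses (aL : a * L = j%:R * pi) (bL : b * L = j.+2%:R * pi).

Let om n x := c * expR (2 * kap * (height n + x)) / weight n.
Hypothesis om_near1 : forall n x, (N <= n < M)%N -> 0 <= x <= width s n ->
  1 - dl <= om n x <= 1 + dl.

Let lam := kap ^+ 2 + k ^+ 2.
Let inW n := (N <= n < M)%N.
Let pos n := height n - height N.
Let E n x := expR (- kap * (height n + x)).
Let bt n x := beat a b (pos n + x).
Let bt1 n x := beat1 a b (pos n + x).
Let bt2 n x := beat2 a b (pos n + x).

(* X = e^(-kap t) V with V = cos (a t) - cos (b t), Y = X', W = X'', F = om Y and
   Z = F'.  The factor om makes the total flux of F the same on both sides of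
   every sphere of the window, whereas the flux of Y jumps. *)
Let X n x := if inW n then E n x * bt n x else 0.
Let Y n x := if inW n then E n x * (bt1 n x - kap * bt n x) else 0.
Let W n x := if inW n then E n x * (bt2 n x - 2 * kap * bt1 n x + kap ^+ 2 * bt n x) else 0.
Let F n x := if inW n then c / weight n * (expR (kap * (height n + x)) * (bt1 n x - kap * bt n x))
  else 0.
Let Z n x := if inW n then c / weight n * (expR (kap * (height n + x)) * (bt2 n x - kap ^+ 2 * bt n x))
  else 0.

Let pbt n : primitive 0 (width s n) (bt n) (bt1 n).
Proof. exact: prim_beat. Qed.

Let pbt1 n : primitive 0 (width s n) (bt1 n) (bt2 n).
Proof. exact: prim_beat1. Qed.

Let pX n : primitive 0 (width s n) (X n) (Y n).
Proof.
rewrite /X /Y; case W0 : (inW n); last exact: prim_cst.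
have := prim_mul (prim_expR 0 (width s n) (height n) (- kap)) (pbt n).
by apply: eq_prim => t _ //; rewrite /E; ring.
Qed.

Let pY n : primitive 0 (width s n) (Y n) (W n).
Proof.
rewrite /Y /W; case W0 : (inW n); last exact: prim_cst.
have := prim_mul (prim_expR 0 (width s n) (height n) (- kap)) (prim_lin (- kap) (pbt n) (pbt1 n)).
by apply: eq_prim => t _; rewrite /E; ring.
Qed.

Let pF n : primitive 0 (width s n) (F n) (Z n).
Proof.
rewrite /F /Z; case W0 : (inW n); last exact: prim_cst.
have := prim_lin (c / weight n) (prim_mul (prim_expR 0 (width s n) (height n) kap)
  (prim_lin (- kap) (pbt n) (pbt1 n))) (prim_cst 0 (width s n) 0).
by apply: eq_prim => t _; ring.
Qed.

Let outW n : (M <= n)%N -> inW n = false.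
Proof. by move=> Mn; rewrite /inW ltnNge Mn andbF. Qed.

Let posM : pos M = L. Proof. exact: LE. Qed.

Let posN : pos N = 0. Proof. exact: subrr. Qed.

Let posS n : pos n.+1 = pos n + width s n.
Proof. by rewrite /pos heightS addrAC. Qed.

Let Xc n : X n (width s n) = X n.+1 0.
Proof.
have E1 : E n (width s n) = E n.+1 0 by rewrite /E heightS addr0.
have B1 : bt n (width s n) = bt n.+1 0 by rewrite /bt posS addr0.
rewrite /X E1 B1; case W1 : (inW n); case W2 : (inW n.+1) => //.
  have -> : n.+1 = M.
    apply/eqP; rewrite eqn_leq; move: W1 W2; rewrite /inW => /andP[Nn ->] /=.
    by rewrite (leqW Nn) /= => /negbT; rewrite -leqNgt.
  by rewrite /bt posM !addr0 (beat_L aL bL) mulr0.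
have -> : n.+1 = N.
  apply/eqP; rewrite eqn_leq; move: W1 W2; rewrite /inW => W1 /andP[-> nM].
  by rewrite andbT ltnNge; move: W1; rewrite (ltnW nM) andbT => ->.
by rewrite /bt posN !addr0 beat_0 mulr0.
Qed.

(** Since [weight n = (n + 1)^q (n + 2)^q], both sides carry the factor [(n + 2)^(- q)] inside the
    window; at its ends the beat and its slope vanish. *)
Let Fc n : n.+1%:R ^+ q * F n (width s n) = n.+3%:R ^+ q * F n.+1 0.
Proof.
have E1 : expR (kap * (height n + width s n)) = expR (kap * (height n.+1 + 0)).
  by rewrite heightS addr0.
have B1 : bt n (width s n) = bt n.+1 0 by rewrite /bt posS addr0.
have B2 : bt1 n (width s n) = bt1 n.+1 0 by rewrite /bt1 posS addr0.
have pw : n.+1%:R ^+ q != 0 :> R /\ n.+2%:R ^+ q != 0 :> R /\ n.+3%:R ^+ q != 0 :> R.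
  by split; [|split]; rewrite expf_neq0 // pnatr_eq0.
have [w1 [w2 w3]] := pw.
rewrite /F E1 B1 B2 /level_weight; case W1 : (inW n); case W2 : (inW n.+1).
- by field; rewrite w1 w2 w3.
- have -> : n.+1 = M.
    apply/eqP; rewrite eqn_leq; move: W1 W2; rewrite /inW => /andP[Nn ->] /=.
    by rewrite (leqW Nn) /= => /negbT; rewrite -leqNgt.
  by rewrite /bt /bt1 posM !addr0 (beat_L aL bL) (beat1_L aL bL) !mulr0 subr0 !mulr0.
- have -> : n.+1 = N.
    apply/eqP; rewrite eqn_leq; move: W1 W2; rewrite /inW => W1 /andP[-> nM].
    by rewrite andbT ltnNge; move: W1; rewrite (ltnW nM) andbT => ->.
  by rewrite /bt /bt1 posN !addr0 beat_0 beat1_0 !mulr0 subr0 !mulr0.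
by rewrite !mulr0.
Qed.

Let F00 : F 0 0 = 0.
Proof.
rewrite /F; case W0 : (inW 0) => //; have N0 : N = 0%N by move: W0; rewrite /inW leqn0 => /andP[/eqP].
have p0 : pos 0 = 0 by rewrite -[in LHS]N0 posN.
by rewrite /bt /bt1 p0 !addr0 beat_0 beat1_0 !mulr0 subr0 !mulr0.
Qed.

Let E_om n x : weight n * E n x ^+ 2 * om n x = c.
Proof.
have w0 : weight n != 0 by rewrite gt_eqF // level_weight_gt0.
have -> : weight n * E n x ^+ 2 * om n x = c * (E n x ^+ 2 * expR (2 * kap * (height n + x))).
  by rewrite /om; field.
rewrite /E expr2 -!expRD; have -> : - kap * (height n + x) + - kap * (height n + x) +
  2 * kap * (height n + x) = 0 by ring.
by rewrite expR0 mulr1.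
Qed.

(** As [dl <= 1/2], [om] lies between 1/2 and 3/2: multiplied by the number of edges of its level,
    [E^2] is comparable to the constant [c]. *)
Let E_bounds n x : inW n -> 0 <= x <= width s n ->
  2 / 3 * c <= weight n * E n x ^+ 2 <= 2 * c.
Proof.
move=> nW xw; have /andP[oa ob] := om_near1 nW xw; have e := E_om n x.
have A0 : 0 <= weight n * E n x ^+ 2 by rewrite mulr_ge0 ?sqr_ge0 // ltW // level_weight_gt0.
have h1 := ler_wpM2l A0 (le_trans (lerB (lexx 1) dl2) oa).
have h2 := ler_wpM2l A0 (le_trans ob (lerD (lexx 1) dl2)).
by rewrite e in h1 h2; apply/andP; split; lra.
Qed.

Let normX : 2 / 3 * (c * L) <= norm (rad X) ^+ 2.
Proof.
rewrite [norm _ ^+ 2](@hnorm_radial R q s X M (fun n => prim_sqi (pX n))); last first.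
  by move=> n t Mn _; rewrite /X outW.
have pI n : primitive 0 (width s n) (fun t => beat_int a b (pos n + t)) (fun t => bt n t ^+ 2).
  exact: prim_beat_int.
have LI : L = \sum_(N <= n < M) itg 0 (width s n) (fun t => bt n t ^+ 2).
  transitivity (\sum_(N <= n < M) (beat_int a b (pos n.+1) - beat_int a b (pos n))).
    by rewrite (telescope_sumr (fun n => beat_int a b (pos n))) // posM posN (beat_int_L aL bL).
  apply: eq_bigr => n _.
  by rewrite -(prim_diff (pI n) (lexx 0) (ltW (width_gt0 s n)) (lexx _)) addr0 posS.
rewrite mulrA [in leLHS]LI mulr_sumr.
rewrite (big_cat_nat (leq0n N) NM) /=; apply: ler_wpDl.
  apply: sumr_ge0 => n _; apply: mulr_ge0; first exact/ltW/level_weight_gt0.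
  exact: itg_sqr_ge0.
rewrite !big_nat; apply: ler_sum => n nW.
have sb := sqi_sqr (prim_sqi (pbt n)); have sX := sqi_sqr (prim_sqi (pX n)).
rewrite -(itgZ _ sb) -(itgZ _ sX).
apply: itg_le; [exact: itgableZ|exact: itgableZ|].
move=> t tw; have /andP[h _] := E_bounds nW tw.
by rewrite /X /inW nW exprMn [leRHS]mulrA; apply: ler_wpM2r h; exact: sqr_ge0.
Qed.

Let X_gt0 : 0 < norm (rad X).
Proof.
rewrite lt0r snorm_ge0 andbT -sqrf_eq0; apply/lt0r_neq0; apply: lt_le_trans normX.
by rewrite !mulr_gt0.
Qed.

(** The squared norm of [Q] is at most [2 c B^2 L], and [c L] is at most [3/2] times the squared
    norm of [X]; the resulting factor [3 B^2] is rounded up to [(2 B)^2]. *)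
Let norm_le (Q : nat -> R -> R) (B : R) : 0 <= B ->
  (forall n, sqi 0 (width s n) (Q n)) ->
  (forall n x, inW n -> 0 <= x <= width s n -> `|Q n x| <= B * E n x) ->
  (forall n x, ~~ inW n -> Q n x = 0) ->
  norm (rad Q) <= 2 * B * norm (rad X).
Proof.
move=> B0 sQ QB Q0.
have BX : 0 <= 2 * B * norm (rad X) by rewrite !mulr_ge0 // snorm_ge0.
rewrite -(ler_pXn2r (ltn0Sn 1)) ?nnegrE ?snorm_ge0 //.
rewrite [leLHS](@hnorm_radial R q s Q M sQ); last first.
  by move=> n t Mn _; rewrite Q0 // outW.
rewrite (big_cat_nat (leq0n N) NM) /= big_nat big1 ?add0r; last first.
  move=> n /andP[_ nN]; rewrite -[RHS](mulr0 (weight n)); congr (_ * _).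
  rewrite -[RHS](itg0 (0 : R) (width s n)); apply: eq_itg => t _.
  by rewrite Q0 ?expr0n // /inW leqNgt nN.
apply: (@le_trans _ _ (\sum_(N <= n < M) 2 * c * B ^+ 2 * width s n)).
  rewrite !big_nat; apply: ler_sum => n nW.
  have sQ2 := sqi_sqr (sQ n).
  rewrite -(itgZ _ sQ2) -[width s n]subr0 -(itg_cst _ (ltW (width_gt0 s n))).
  rewrite !subr0; apply: itg_le; [exact: itgableZ|exact: itgable_cst|].
  move=> t tw; have /andP[_ h] := E_bounds nW tw; have hQ := QB n t nW tw.
  apply: (@le_trans _ _ (weight n * (B * E n t) ^+ 2)).
    apply: ler_wpM2l; first exact/ltW/level_weight_gt0.
    rewrite -[Q n t ^+ 2]real_normK ?num_real // ler_pXn2r ?nnegrE //.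
    by rewrite mulr_ge0 // ltW // expR_gt0.
  by rewrite exprMn mulrCA mulrC ler_wpM2r // sqr_ge0.
rewrite -mulr_sumr sum_width // LE !exprMn.
have h := normX; have B2 := sqr_ge0 B; have h1 := ler_wpM2l B2 h.
have cL : 0 <= B ^+ 2 * (c * L) by rewrite mulr_ge0 // mulr_ge0 // ltW.
have -> : 2 * c * B ^+ 2 * L = 2 * (B ^+ 2 * (c * L)) by ring.
have -> : 2 ^+ 2 * B ^+ 2 * norm (rad X) ^+ 2 = 4 * (B ^+ 2 * norm (rad X) ^+ 2) :> R by ring.
have e : B ^+ 2 * (2 / 3 * (c * L)) = 2 / 3 * (B ^+ 2 * (c * L)) by ring.
rewrite e in h1; lra.
Qed.

(** The defects are [Y - F = (1 - om) Y] and [Z + lam X = E (om (bt2 + k^2 bt) + (1 - om) lam bt)].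
    With [|1 - om| <= dl], [om <= 2] and [|bt| <= 2], [norm_le] gives the two terms of the
    threshold. *)
Lemma window_quasi_mode (eps : R) :
  2 * (dl * (a + b + 2 * kap)) +
  2 * (2 * (`|b ^+ 2 - k ^+ 2| + `|a ^+ 2 - k ^+ 2|) + 2 * (dl * lam)) < eps ->
  exists u, [/\ D u, 0 < norm u & forall v, D v ->
    re (energy u v - lam%:C * L2ip u v) <=
    eps * norm u * Num.sqrt (re (energy v v) + re (L2ip v v))].
Proof.
set B2 := _ + `|a ^+ 2 - k ^+ 2|; set d := (X in X < _) => de.
have b0 := lt_trans a0 ab.
have l0 : 0 <= lam by rewrite addr_ge0 ?sqr_ge0.
have B20 : 0 <= B2 by rewrite addr_ge0.
have B10 : 0 <= a + b + 2 * kap by rewrite !addr_ge0 ?mulr_ge0 // ltW.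
have eE n x : c / weight n * expR (kap * (height n + x)) = om n x * E n x.
  rewrite /om /E [RHS]mulrAC -[in RHS](mulrA c) -expRD mulrAC; congr (_ * expR _ / _); ring.
have vn (Q : nat -> R -> R) : (forall n x, ~~ inW n -> Q n x = 0) ->
    forall n t, (M <= n)%N -> 0 <= t <= width s n -> Q n t = 0.
  by move=> Q0 n t Mn _; rewrite Q0 // outW.
have zX n x : ~~ inW n -> X n x = 0 by move=> /negbTE nW; rewrite /X nW.
have zY n x : ~~ inW n -> Y n x = 0 by move=> /negbTE nW; rewrite /Y nW.
have zF n x : ~~ inW n -> F n x = 0 by move=> /negbTE nW; rewrite /F nW.
have zZ n x : ~~ inW n -> Z n x = 0 by move=> /negbTE nW; rewrite /Z nW.
apply: (quasi_mode (d := d) pX pY pF (vn _ zX) (vn _ zY) (vn _ zF) (vn _ zZ) Xc F00 Fc X_gt0 _ de).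
  rewrite /d mulrDl; apply: lerD.
    apply: norm_le.
    - by rewrite mulr_ge0.
    - by move=> n; apply: sqiB; [exact: prim_sqi (pY n)|exact: prim_sqi (pF n)].
    - move=> n x nW xw; rewrite /Y /F nW mulrA eE.
      have -> : E n x * (bt1 n x - kap * bt n x) - om n x * E n x * (bt1 n x - kap * bt n x) =
        (1 - om n x) * (bt1 n x - kap * bt n x) * E n x by ring.
      rewrite normrM (ger0_norm (ltW (expR_gt0 _))) ler_wpM2r ?(ltW (expR_gt0 _)) //.
      rewrite normrM; apply: ler_pM => //.
        have /andP[oa ob] := om_near1 nW xw; rewrite ler_norml; have := dl2; have := dl0 => ? ?; apply/andP; split; lra.
      apply: le_trans (ler_normB _ _) _; apply: lerD; first exact: beat1_le.
      rewrite normrM (ger0_norm kap0) [leRHS]mulrC ler_wpM2l //; exact: beat_le.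
    - by move=> n x nW; rewrite zY // zF // subrr.
  apply: norm_le.
  - by rewrite addr_ge0 // mulr_ge0 // mulr_ge0.
  - move=> n; have := sqi_lin lam (prim_sqi (pX n)) (prim_sqi' (pF n)).
    by under eq_fun do rewrite addrC.
  - move=> n x nW xw; rewrite /Z /X nW mulrA eE.
    have -> : om n x * E n x * (bt2 n x - kap ^+ 2 * bt n x) + lam * (E n x * bt n x) =
      (om n x * (bt2 n x + k ^+ 2 * bt n x) + (1 - om n x) * (lam * bt n x)) * E n x.
      by rewrite /lam; ring.
    rewrite normrM (ger0_norm (ltW (expR_gt0 _))) ler_wpM2r ?(ltW (expR_gt0 _)) //.
    have /andP[oa ob] := om_near1 nW xw.
    apply: le_trans (ler_normD _ _) _; apply: lerD.
      rewrite normrM; apply: ler_pM => //; last exact: beat2_le.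
      by rewrite ler_norml; have := dl2; have := dl0 => ? ?; apply/andP; split; lra.
    rewrite normrM [leRHS]mulrC -mulrA; apply: ler_pM => //.
      by rewrite ler_norml; have := dl2; have := dl0 => ? ?; apply/andP; split; lra.
    by rewrite normrM (ger0_norm l0) ler_wpM2l //; exact: beat_le.
  - by move=> n x nW; rewrite zZ // zX // mulr0 addr0.
by rewrite /d addr_ge0 // !mulr_ge0 // addr_ge0 // !mulr_ge0.
Qed.

End Window.

(** * Long windows and the spectrum they produce *)

Section Windows.
Variables (R : realType) (q : nat) (s : R).
Local Notation G := (antitree q s).
Local Notation H := (kirchhoff_laplacian G).
Local Notation weight := (level_weight R q).
Local Notation height := (height s).

Definition has_windows (kap : R) : Prop := forall dl L0 : R, 0 < dl ->
  exists N M c, [/\ (N <= M)%N, 0 < c, L0 <= height M - height N &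
    forall n x, (N <= n < M)%N -> 0 <= x <= width s n ->
      1 - dl <= c * expR (2 * kap * (height n + x)) / weight n <= 1 + dl].

Let frequency_gap (h k a : R) : 0 < h -> h <= k -> 0 < a -> a <= k -> k < a + h ->
  `|(a + 2 * h) ^+ 2 - k ^+ 2| + `|a ^+ 2 - k ^+ 2| <= 10 * (h * k).
Proof.
move=> h0 hk a0 ak ka; have k0 : 0 < k by lra.
rewrite [X in _ + X]distrC !subr_sqr !normrM !ger0_norm; [|lra..].
have h1 : (a + 2 * h - k) * (a + 2 * h + k) <= 2 * h * (4 * k) by apply: ler_pM; lra.
have h2 : (k - a) * (k + a) <= h * (2 * k) by apply: ler_pM; lra.
lra.
Qed.

Lemma windows_spectrum kap x : 0 <= kap -> has_windows kap -> kap ^+ 2 < x ->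
  spectrum H x%:C.
Proof.
move=> kap0 win kx; pose k := Num.sqrt (x - kap ^+ 2).
have k0 : 0 < k by rewrite sqrtr_gt0 subr_gt0.
have -> : x = kap ^+ 2 + k ^+ 2 by rewrite sqr_sqrtr ?subr_ge0 ?(ltW kx) // addrC subrK.
apply: (weyl (hilbert_L2 G) (@premin_L2 R G) (energy_sesq G) (@energy_closable R G)).
move=> eps e0; have p0 : 0 < pi :> R := pi_gt0 R.
pose lam := kap ^+ 2 + k ^+ 2; have l0 : 0 <= lam by rewrite addr_ge0 ?sqr_ge0.
(* Collects the coefficients of [dl] in the threshold of [window_quasi_mode], with
   [a + b <= 4 k]. *)
pose C := 8 * k + 4 * kap + 4 * lam.
have C0 : 0 < C by rewrite /C; lra.
pose dl := Num.min 2^-1 (eps / (4 * C)).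
have dl0 : 0 < dl by rewrite lt_min divr_gt0 ?mulr_gt0 // invr_gt0 ltr0n.
have dl2 : dl <= 2^-1 by rewrite ge_min lexx.
have dlC : dl * C <= eps / 4.
  have : dl <= eps / (4 * C) by rewrite ge_min lexx orbT.
  rewrite ler_pdivlMr ?mulr_gt0 // => h; rewrite ler_pdivlMr //; lra.
(* The length [pi / k] makes the frequency step [h = pi / L] at most [k], so that [a > 0]; the other
   term makes [h k], and with it the frequency error, small compared with [eps]. *)
have [N [M [c [NM c0 LL om]]]] := win dl (pi / k + 192 * pi * k / eps) dl0.
set L := height M - height N in LL.
have pk : 0 < pi / k by rewrite divr_gt0.
have pke : 0 < 192 * pi * k / eps by exact: divr_gt0 (mulr_gt0 (mulr_gt0 (ltr0Sn R 191) p0) k0) e0.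
have L0 : 0 < L by lra.
pose h := pi / L; have h0 : 0 < h by rewrite divr_gt0.
have hk : h <= k.
  by rewrite ler_pdivrMr // mulrC -ler_pdivrMr //; lra.
have hke : 48 * (h * k) <= eps / 4.
  have : 192 * pi * k / eps <= L by lra.
  rewrite ler_pdivrMr // => h1; rewrite /h.
  have -> : 48 * (pi / L * k) = 48 * pi * k / L by field; rewrite gt_eqF.
  rewrite ler_pdivrMr //; lra.
(* The frequencies have to be multiples of [h] whose indices differ by 2: [a] is the largest
   multiple not above [k], and [b = a + 2 h] exceeds [k]. *)
pose j := Num.truncn (k / h).
have /andP[j1 j2] := truncn_itv (divr_ge0 (ltW k0) (ltW h0)).
rewrite -/j ler_pdivlMr // in j1; rewrite -/j ltr_pdivrMr // -natr1 mulrDl mul1r in j2.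
have jpos : (0 < j)%N.
  rewrite lt0n; apply/eqP => j0; move: j2.
  by rewrite j0 mul0r add0r ltNge hk.
have j0 : 0 < j%:R :> R by rewrite ltr0n.
pose a := j%:R * h; pose b := j.+2%:R * h.
have bE : b = a + 2 * h by rewrite /b /a -[j.+2]addn2 natrD mulrDl.
have a0 : 0 < a by rewrite mulr_gt0.
have ab : a < b by rewrite bE; lra.
have hL : h * L = pi by rewrite /h divfK // gt_eqF.
have aL : a * L = j%:R * pi by rewrite -mulrA hL.
have bL : b * L = j.+2%:R * pi by rewrite -mulrA hL.
apply: (window_quasi_mode kap0 c0 NM (ltW dl0) dl2 (erefl L) L0 a0 ab aL bL om).
have B := frequency_gap h0 hk a0 j1 j2; rewrite -bE in B.
have D1 : dl * (a + b + 2 * kap) <= dl * (4 * k + 2 * kap).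
  by apply: ler_wpM2l; [exact: ltW|rewrite bE /a; lra].
have CE : dl * C = 2 * (dl * (4 * k + 2 * kap)) + 4 * (dl * lam) by rewrite /C; ring.
rewrite -/lam; rewrite {}CE in dlC; lra.
Qed.

Let bernoulli (x : R) n : 0 <= x <= 1 -> 1 - n%:R * x <= (1 - x) ^+ n.
Proof.
move=> /andP[x0 x1]; elim: n => [|n IH]; first by rewrite mul0r subr0 expr0.
rewrite exprS -natr1; have h : 0 <= 1 - x by rewrite subr_ge0.
apply: le_trans (ler_wpM2l h IH); have := mulr_ge0 (ler0n R n) (sqr_ge0 x).
have -> : (1 - x) * (1 - n%:R * x) = 1 - (n%:R + 1) * x + n%:R * x ^+ 2 by ring.
lra.
Qed.

(** Between the levels [k m] and [(k + 1) m] the numbers of edges differ by a factor close to 1 for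
    large [k], whatever [m >= 1]. This window has length at least [m^(1 - s) / (k + 1)], which is
    unbounded in [m]. *)
Lemma windows_lt1 : 0 <= s -> s < 1 -> has_windows 0.
Proof.
move=> s0 s1 dl L0 dl0.
pose k := (Num.truncn ((2 * q)%:R / dl)).+1.
have k0 : 0 < k.+1%:R :> R by rewrite ltr0n.
have kd : (2 * q)%:R * k.+1%:R^-1 <= dl.
  rewrite ler_pdivrMr // mulrC -ler_pdivrMr //; apply: le_trans (ltW (truncnS_gt _)) _.
  by rewrite ler_nat.
have p0 : 0 < 1 - s by rewrite subr_gt0.
have [m0 /(_ (maxn m0 1) (leq_maxl _ _))] := powR_large (L0 * k.+1%:R) p0.
set m := maxn m0 1; have m1 : (0 < m)%N by rewrite leq_max orbT.
move=> mK; have mR : 0 < m%:R :> R by rewrite ltr0n.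
pose N := (k * m)%N; pose M := (k.+1 * m)%N.
have NM : (N <= M)%N by rewrite leq_mul2r leqnSn orbT.
exists N, M, (weight N); split=> //; first exact: level_weight_gt0.
  rewrite -sum_width //; apply: (@le_trans _ _ (\sum_(N <= n < M) M%:R `^ (- s))).
    rewrite sumr_const_nat -[leRHS]mulr_natl {1}/M {1}/N mulSn addnK.
    have ME : M%:R `^ (- s) = k.+1%:R `^ (- s) * m%:R `^ (- s) by rewrite /M natrM powRM.
    have h1 : k.+1%:R^-1 <= k.+1%:R `^ (- s) :> R.
      rewrite powRN lef_pV2 ?posrE ?powR_gt0 // -[leRHS]powRr1 ?(ltW k0) //.
      by rewrite ler_powR ?ler1n // ltW.
    have h2 : m%:R `^ (1 - s) = m%:R * m%:R `^ (- s) :> R.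
      by rewrite powRD ?powRr1 ?(ltW mR) // (gt_eqF mR) implybT.
    rewrite ME mulrCA -h2; apply: (@le_trans _ _ (k.+1%:R^-1 * m%:R `^ (1 - s))).
      by rewrite mulrC ler_pdivlMr.
    by rewrite ler_wpM2r // powR_ge0.
  rewrite !big_nat; apply: ler_sum => n /andP[_ nM]; rewrite /width !powRN.
  rewrite lef_pV2 ?posrE ?powR_gt0 ?ltr0n //.
    by apply: ge0_ler_powR; rewrite ?nnegrE // ler_nat.
  exact: leq_ltn_trans nM.
move=> n x /andP[Nn nM] _; rewrite !mulr0 !mul0r expR0 mulr1.
have W0 := level_weight_gt0 R q n.
rewrite ler_pdivlMr // ler_pdivrMr //.
apply/andP; split; last first.
  apply: (@le_trans _ _ (weight n)); last by rewrite ler_peMl ?(ltW W0) // lerDl ltW.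
  by apply: ler_pM; rewrite ?exprn_ge0 //; apply: lerXn2r; rewrite ?nnegrE // ler_nat.
pose y : R := k.+1%:R^-1; have y0 : 0 < y by rewrite invr_gt0.
have y1 : y <= 1 by rewrite invf_le1 // ler1n.
have B := @bernoulli y (2 * q) (introT andP (conj (ltW y0) y1)).
have yq : 1 - dl <= (1 - y) ^+ q * (1 - y) ^+ q.
  rewrite -exprD addnn -mul2n; apply: le_trans B; rewrite lerD2l lerN2; exact: kd.
apply: le_trans (ler_wpM2r (ltW W0) yq) _.
rewrite /level_weight mulrACA -!exprMn.
have y1' : 0 <= 1 - y by rewrite subr_ge0.
have yE : 1 - y = k%:R / k.+1%:R by rewrite /y -natr1; field; rewrite natr1 gt_eqF.
(* Inside the window [n + 1 <= (k + 1) m], hence [(k / (k + 1)) (n + 1) <= k m = N]. *)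
have nk : (k * n.+1 <= k.+1 * N)%N.
  by rewrite {1}/N mulnCA leq_mul2l; apply/orP; right; exact: nM.
have step i i' : (k * i <= k.+1 * i')%N -> (1 - y) * i%:R <= i'%:R.
  by move=> h; rewrite yE mulrAC ler_pdivrMr // -!natrM ler_nat [leqRHS]mulnC.
apply: lerXn2r; rewrite ?nnegrE ?mulr_ge0 //; apply: ler_pM; rewrite ?mulr_ge0 //; apply: step.
  by apply: leq_trans nk _; rewrite leq_mul2l leqnSn orbT.
have -> : (k * n.+2 = k * n.+1 + k)%N by rewrite mulnS addnC.
have -> : (k.+1 * N.+2 = k.+1 * N + k.+1 * 2)%N by rewrite -mulnDr addn2.
by rewrite leq_add //; apply: leq_trans (leqnSn k) _; exact: leq_pmulr.
Qed.

(** Here [height n] is the harmonic number H_n. The inequality [1 + x <= exp x], used at positive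
    and at negative [x], shows that [e n / (n + 1)] is nondecreasing and [e n / n] nonincreasing.
    Beyond level [N] the growth is therefore exponential up to a factor [(N + 1) / N], however far
    the window extends, and the harmonic series diverges. *)
Lemma windows_eq1 : s = 1 -> has_windows q%:R.
Proof.
move=> s1 dl L0 dl0.
have pos i : 0 < i.+1%:R :> R by rewrite ltr0n.
have wE n : width s n = n.+1%:R^-1 by rewrite /width s1 powRN powRr1.
pose e n := expR (height n).
have e0 n : 0 < e n := expR_gt0 _.
have eS n : e n.+1 = e n * expR n.+1%:R^-1 by rewrite /e heightS wE expRD.
have exp_lo n : n.+2%:R <= expR n.+1%:R^-1 * n.+1%:R :> R.
  rewrite -ler_pdivrMr //; apply: le_trans (expR_ge1Dx _).
  by rewrite -[n.+2%:R]natr1 mulrDl divff ?gt_eqF // mul1r.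
have exp_hi n x : 0 <= x <= n.+1%:R^-1 -> expR x * n%:R <= n.+1%:R :> R.
  move=> /andP[x0 xn]; have hx := expR_ge1Dx (- x).
  have h1 : n%:R <= n.+1%:R * expR (- x).
    apply: (@le_trans _ _ (n.+1%:R * (1 - n.+1%:R^-1))).
      by rewrite mulrBr mulr1 divff ?gt_eqF // -natr1 addrK.
    by rewrite ler_pM2l //; apply: le_trans hx; rewrite lerD2l lerN2.
  have := ler_wpM2l (expR_ge0 x) h1.
  by rewrite mulrCA -expRD subrr expR0 mulr1.
have lo N n : (N <= n)%N -> e N * n.+1%:R <= e n * N.+1%:R.
  elim: n => [|n IH]; first by rewrite leqn0 => /eqP->.
  rewrite leq_eqVlt => /predU1P[->//|/IH {}IH].
  apply: le_trans (ler_wpM2l (ltW (e0 N)) (exp_lo n)) _.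
  by rewrite eS mulrCA mulrAC [leRHS]mulrC; apply: ler_wpM2l IH; exact: expR_ge0.
have hi N n x : (N <= n)%N -> 0 <= x <= n.+1%:R^-1 -> e n * expR x * N%:R <= e N * n.+1%:R.
  move=> Nn xn; have {Nn} h : e n * N%:R <= e N * n%:R.
    elim: n Nn {xn} => [|n IH]; first by rewrite leqn0 => /eqP->.
    rewrite leq_eqVlt => /predU1P[->//|/IH {}IH].
    have xn : 0 <= (n.+1%:R^-1 : R) <= n.+1%:R^-1 by rewrite lexx invr_ge0 (ltW (pos n)).
    apply: le_trans (ler_wpM2l (ltW (e0 N)) (exp_hi n _ xn)).
    by rewrite eS mulrAC mulrCA mulrC; apply: ler_wpM2l IH; exact: expR_ge0.
  apply: le_trans (ler_wpM2l (ltW (e0 N)) (exp_hi n _ xn)).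
  by rewrite mulrAC mulrCA mulrC; apply: ler_wpM2l h; exact: expR_ge0.
(* Chosen so that [(1 + dl) (1 - 2 q / (N + 1)) >= 1], which combines with Bernoulli in the upper
   bound. *)
pose N := (Num.truncn ((2 * q)%:R * (1 + dl) / dl)).+1.
have Nd : (2 * q)%:R * (1 + dl) <= dl * N.+1%:R.
  rewrite -ler_pdivrMl // mulrC; apply: le_trans (ltW (truncnS_gt _)) _.
  by rewrite ler_nat.
(* [lo] at level 0 reads [M + 1 <= e M], so the heights are unbounded. *)
have [M NM ML] : exists2 M, (N <= M)%N & L0 <= height M - height N.
  exists (maxn N (Num.truncn (expR (L0 + height N))).+1); first exact: leq_maxl.
  set M := maxn _ _; rewrite lerBrDr -ler_expR -/(e M).
  have := lo 0%N M (leq0n M); rewrite mulr1 {1}/e /height big_geq // expR0 mul1r.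
  apply: le_trans; apply: le_trans (ltW (truncnS_gt _)) _; rewrite ler_nat.
  by apply: leq_trans (leq_maxr _ _) (leqnSn _).
pose r := N.+1%:R / e N; have r0 : 0 < r by rewrite divr_gt0.
exists N, M, (r ^+ (2 * q)); split=> //; first exact: exprn_gt0.
move=> n x /andP[Nn nM]; rewrite wE => xn; have /andP[x0 x1] := xn.
pose g := e n * expR x; have g0 : 0 < g by rewrite mulr_gt0 ?expR_gt0.
have gE : expR (2 * q%:R * (height n + x)) = g ^+ (2 * q).
  by rewrite -natrM expRM_natl expRD.
(* The exponential of the height divided by [n + 1], normalized to be 1 at the start of the window.
   The number of edges is [((n + 1) (n + 2))^q], and trading [n + 2] for [n + 1] costs the factor
   [1 - 1 / (n + 2)]. *)
pose y := r * g / n.+1%:R.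
have n0 : n.+1%:R != 0 :> R by rewrite gt_eqF.
have n1 : n.+2%:R != 0 :> R by rewrite gt_eqF.
have eN0 : e N != 0 by rewrite gt_eqF.
have -> : r ^+ (2 * q) * expR (2 * q%:R * (height n + x)) / weight n =
    (y ^+ 2 * (1 - n.+2%:R^-1)) ^+ q.
  rewrite gE /level_weight -exprMn exprM -[n.+1%:R ^+ q * _]exprMn -expr_div_n.
  congr (_ ^+ _); rewrite /y -[n.+2%:R]natr1; field.
  by rewrite !(addrC 1) !natr1 n1 n0.
have y1 : 1 <= y.
  rewrite /y /r ler_pdivlMr // mul1r mulrAC ler_pdivlMr // mulrC mulrC.
  apply: le_trans (_ : e n * N.+1%:R <= _); first by rewrite mulrC; exact: lo.
  by rewrite mulrC ler_pM2l // /g ler_peMr ?(ltW (e0 n)) // (le_trans _ (expR_ge1Dx x)) // lerDl.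
have yU : y * N%:R <= N.+1%:R.
  have := hi N n x Nn xn; rewrite -/g => h.
  have -> : y * N%:R = g * N%:R * (N.+1%:R / (e N * n.+1%:R)) by rewrite /y /r; field; rewrite (addrC 1) natr1 n0 eN0.
  apply: le_trans (ler_wpM2r _ h) _; first by rewrite divr_ge0 // mulr_ge0 // ltW.
  by rewrite mulrCA divff ?mulr1 // mulf_neq0.
have f0 : 0 <= (n.+2%:R^-1 : R) <= 1 by rewrite invr_ge0 (ltW (pos _)) invf_le1 // ler1n.
have /andP[fa fb] := f0.
have y2 : 1 <= y ^+ 2 by rewrite exprn_ege1.
have q1 : 0 <= 1 - n.+2%:R^-1 :> R by rewrite subr_ge0.
apply/andP; split.
  apply: (@le_trans _ _ ((1 - n.+2%:R^-1) ^+ q)); last first.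
    apply: lerXn2r; rewrite ?nnegrE; [exact: q1|exact: mulr_ge0 (sqr_ge0 y) q1|exact: (ler_peMl q1 y2)].
  apply: le_trans (bernoulli _ f0); rewrite lerD2l lerN2 ler_pdivrMr //.
  have h1 : q%:R <= (2 * q)%:R :> R by rewrite ler_nat leq_pmull.
  have h2 : (2 * q)%:R <= (2 * q)%:R * (1 + dl) :> R by rewrite ler_peMr // lerDl ltW.
  apply: le_trans (le_trans h1 (le_trans h2 Nd)) _.
  by rewrite ler_pM2l // ler_nat; exact: leqW.
pose z : R := 1 - N.+1%:R^-1.
have z0 : 0 <= (N.+1%:R^-1 : R) <= 1 by rewrite invr_ge0 (ltW (pos _)) invf_le1 // ler1n.
have zE : z = N%:R / N.+1%:R by rewrite /z -natr1; field; rewrite natr1 gt_eqF.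
have zp : 0 < z by rewrite zE divr_gt0.
have yz : y * z <= 1 by rewrite zE mulrA ler_pdivrMr // mul1r.
have zq : 1 <= (1 + dl) * z ^+ (2 * q).
  have d1 : 0 < 1 + dl by rewrite addr_gt0.
  apply: le_trans (ler_wpM2l (ltW d1) (bernoulli (2 * q) z0)).
  have : (2 * q)%:R * (1 + dl) / N.+1%:R <= dl by rewrite ler_pdivrMr.
  have -> : (1 + dl) * (1 - (2 * q)%:R / N.+1%:R) = 1 + dl - (2 * q)%:R * (1 + dl) / N.+1%:R by ring.
  by rewrite lerBrDr lerD2l.
have y0 : 0 <= y := le_trans ler01 y1.
apply: (@le_trans _ _ (y ^+ (2 * q))).
  have y20 := sqr_ge0 y; rewrite exprM; apply: lerXn2r.
  - exact: mulr_ge0 y20 q1.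
  - exact: y20.
  - by apply: (ler_piMr y20); rewrite lerBlDr lerDl.
rewrite -(ler_pM2r (exprn_gt0 (2 * q) zp)); apply: le_trans zq.
by rewrite -exprMn exprn_ile1 // mulr_ge0 // ltW.
Qed.

End Windows.

Section EssentialBottom.
Variables (R : realType) (q : nat) (s : R).
Local Notation G := (antitree q s).
Local Notation H := (kirchhoff_laplacian G).

Lemma antitree_lambda0_le_ess : (lambda0 H <= lambda0_ess H)%E.
Proof. exact: lambda0_le_ess. Qed.

Lemma windows_lambda0_ess_le (kap : R) : 0 <= kap -> has_windows q s kap ->
  (lambda0_ess H <= (kap ^+ 2)%:E)%E.
Proof.
move=> kap0 win; apply: lambda0_ess_le => x; exact: windows_spectrum.
Qed.

End EssentialBottom.

Theorem lemma8p9 (R : realType) (q : nat) (s : R)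
    (hq : (1 <= q)%N) (hs : 0 <= s) :
  let H := kirchhoff_laplacian (antitree q s) in
  ((lambda0 H = 0%E /\ lambda0_ess H = 0%E) <-> s \in `[0, 1[) /\
  (1 <= s ->
    [/\ uniformly_positive H,
        ((4%:R^-1)%:E <= lambda0 H)%E,
        (lambda0 H <= (pi ^+ 2)%:E)%E &
        lambda0_ess H = if s == 1 then (q%:R ^+ 2)%:E else +oo%E]).
Proof.
move=> H; have quarter := @antitree_lambda0_ge_quarter R q s hq.
have pos : 1 <= s -> uniformly_positive H.
  by move=> s1; apply: lt_le_trans (quarter s1); rewrite lte_fin invr_gt0 ltr0n.
split.
  rewrite in_itv /= hs /=; split=> [[l0 _]|s1].
    by rewrite ltNge; apply/negP => /pos; rewrite /uniformly_positive l0 ltxx.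
  have ge0 := antitree_lambda0_ge0 q s.
  have := windows_lambda0_ess_le (lexx 0) (windows_lt1 q hs s1); rewrite expr0n /= => le0.
  have le := antitree_lambda0_le_ess q s.
  by split; apply/eqP; rewrite eq_le; apply/andP; split=> //;
    [exact: le_trans le le0|exact: le_trans ge0 le].
move=> s1; split; [exact: pos|exact: quarter|exact: antitree_lambda0_le|].
case: eqP => [sE|/eqP sn]; last first.
  by apply: antitree_lambda0_ess_pinfty => //; rewrite lt_neqAle eq_sym sn.
apply/eqP; rewrite eq_le antitree_lambda0_ess_ge_sqr // andbT.
exact: windows_lambda0_ess_le (windows_eq1 q sE).
Qed.
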